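(* Let $\mathbf a,\mathbf b$ be integers with $|\mathbf a|,|\mathbf b|>1$ and $|\mathbf a|\ne|\mathbf b|$, and let $0\le\delta<\min\left\{\tfrac12,\tfrac{\min\{|\mathbf a|,|\mathbf b|\}-1}{2}\right\}$. Let $\tilde T:[0,1]^2\to[0,1]^2$ be a perturbed linear map as defined in the context (with $C^2$ perturbations), and let $\mu$ be its absolutely continuous invariant probability measure. Then for every $s>0$ there exists a sequence $(u_n)_{n\in\mathbb{N}}$ such that $\lim_{n\to\infty}n\,\mu(\{\varphi>u_n\})=s$ and $$\lim_{n\to\infty}\mu(M_n\le u_n)=e^{-s}.$$
   Context: Perturbed linear map: let $T(x,y)=(\mathbf a x\bmod 1,\mathbf b y\bmod 1)$ on $[0,1]^2$, with differentiability regions $I_{kl}=I_k\times J_l$, where $I_k=\left(\frac{k}{|\mathbf a|},\frac{k+1}{|\mathbf a|}\right)$, $0\le k\le|\mathbf a|-1$, and $J_l=\left(\frac{l}{|\mathbf b|},\frac{l+1}{|\mathbf b|}\right)$, $0\le l\le|\mathbf b|-1$. For each $k,l$ let $I_k'$, $J_l'$ be compact intervals with $\overline{I_k}\subseteq\operatorname{int}I_k'$, $\overline{J_l}\subseteq\operatorname{int}J_l'$, and let $f_k:I_k'\to\mathbb{R}$, $g_l:J_l'\to\mathbb{R}$ be $C^2$ functions such that $f_k(\overline{I_k})\subseteq[-1,1]$, $g_l(\overline{J_l})\subseteq[-1,1]$, $f_k=0$ on $\partial I_k$, $g_l=0$ on $\partial J_l$, and $|f_k'|\le1$ on $I_k'$,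 $|g_l'|\le1$ on $J_l'$. The map $\tilde T$ is defined by $$\tilde T(x,y)=T(x,y)+\delta\,(f_k(x),g_l(y))\quad\text{for }(x,y)\in I_{kl}$$ (and arbitrarily on the remaining Lebesgue-null set, as a product map). The map $\tilde T$ has a unique absolutely continuous invariant probability measure $\mu$. The observable is $\varphi(x,y)=-\log|x-y|$ (with value $\infty$ on the diagonal), and $M_n=\max_{0\le i\le n-1}\varphi\circ\tilde T^i$. *)

(* Defs.v *)
From mathcomp Require Import all_boot all_order all_algebra.
From mathcomp Require Import all_classical all_reals all_analysis.
Import Order.TTheory GRing.Theory Num.Theory.
Import numFieldNormedType.Exports.

Set Implicit Arguments.
Unset Strict Implicit.
Unset Printing Implicit Defensive.

Local Open Scope classical_set_scope.
Local Open Scope ring_scope.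

(* Differentiation relative to a set [D]: on a compact interval this is the
   usual derivative inside and the one-sided derivative at the endpoints. *)
Definition diff_quotient_within {R : realType} (D : set R) (f : R -> R) (x : R) :=
  (fun y => (f y - f x) / (y - x)) @ within D x^'.

Definition derivable_within {R : realType} (D : set R) (f : R -> R) (x : R) : Prop :=
  cvg (diff_quotient_within D f x).

Definition derive_within {R : realType} (D : set R) (f : R -> R) (x : R) : R :=
  lim (diff_quotient_within D f x).

Definition C2_on {R : realType} (D : set R) (f : R -> R) : Prop :=
  [/\ (forall x, D x -> derivable_within D f x),
      (forall x, D x -> derivable_within D (derive_within D f) x) &
      {within D, continuous (derive_within D (derive_within D f))}].

Definition mod1 {R : realType} (x : R) : R := x - (Num.floor x)%:~R.

Definition unit_square {R : realType} : set (R * R) := (`[0, 1] `*` `[0, 1])%classic.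

Definition linear_map {R : realType} (a b : int) (p : R * R) : R * R :=
  (mod1 (a%:~R * p.1), mod1 (b%:~R * p.2)).

Definition branch_interval {R : realType} (a : int) (k : nat) : set R :=
  `](k%:R / `|a|%:~R), (k.+1%:R / `|a|%:~R)[%classic.

(* [h] stands for any extension to [R] of a function on the compact interval
   [`[c, d]]; only its values there matter. *)
Definition branch_perturbation {R : realType} (a : int) (k : nat) (h : R -> R) : Prop :=
  let I : set R := branch_interval a k in
  exists c d : R, let I' : set R := `[c, d]%classic in
  [/\ closure I `<=` I'°,
      C2_on I' h,
      h @` closure I `<=` `[-1, 1]%classic,
      (forall x, (closure I `\` I°) x -> h x = 0) &
      (forall x, I' x -> `|derive_within I' h x| <= 1)].

Definition perturbed_linear_map {R : realType} (a b : int) (delta : R)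
    (T : R * R -> R * R) : Prop :=
  [/\ (forall p, unit_square p -> unit_square (T p)),
      (exists F G : R -> R, forall p, unit_square p -> T p = (F p.1, G p.2)) &
      exists f g : nat -> R -> R,
      [/\ (forall k, (k < `|a|)%N -> branch_perturbation a k (f k)),
          (forall l, (l < `|b|)%N -> branch_perturbation b l (g l)) &
          forall k l p, (k < `|a|)%N -> (l < `|b|)%N ->
            (branch_interval a k `*` branch_interval b l) p ->
            T p = ((linear_map a b p).1 + delta * f k p.1,
                   (linear_map a b p).2 + delta * g l p.2)]].

(* An absolutely continuous invariant probability of the self-map [T] of the
   unit square, seen as a Borel probability on the plane carried by the square.
   Intersecting with the square discards the irrelevant values of [T] outside. *)
Definition acip {R : realType} (T : R * R -> R * R)
    (mu : probability (measurableTypeR R * measurableTypeR R)%type R) : Prop :=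
  [/\ mu unit_square = 1%E,
      mu `<< (lebesgue_measure \x lebesgue_measure)%E &
      forall A : set (measurableTypeR R * measurableTypeR R),
        measurable A -> mu (unit_square `&` T @^-1` A) = mu A].

Definition observable {R : realType} (p : R * R) : \bar R :=
  if p.1 == p.2 then +oo%E else (- ln `|p.1 - p.2|)%:E.

Definition max_process {R : realType} (T : R * R -> R * R) (n : nat)
    (p : R * R) : \bar R :=
  \big[maxe/-oo%E]_(i < n) observable (iter i T p).

(* Main.v *)
(** Each factor of the map is piecewise expanding with full branches, so the
    Lebesgue transfer operator of the product preserves a cone of positive
    densities with bounded logarithmic Lipschitz constant. Two densities of the
    cone with equal mass share a fixed proportion of it, and removing the common
    part at every step makes correlations decay exponentially. The push-forwards
    of Lebesgue measure then converge to [mu], which inherits this decay and a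
    density bounded above and below.

    The exceedance [phi > u] is the tube [|x - y| < expR (- u)]. Since
    [|a| <> |b|] and [delta < 1/2], one factor expands uniformly faster than the
    other. Hence along a line [x - y = const], inside a product of two rank [j]
    cylinders, [F^j x - G^j y] is strictly monotone with slope at least a
    constant times the inverse length of the shorter cylinder, and the tube of
    radius [r] meets its [j]-th preimage in measure [O(r^2)], for every [j >= 1].

    Mixing over a time [t] and the absence of short returns give, for the
    probability [q_l] of no visit to the tube [A] in [l] steps, the renewal
    estimate [q_(l+1) = (1 - mu A) q_l + O(t (mu A)^2) + (mixing error)]. With
    [mu A = s / n] and [t] a small multiple of [n], this yields
    [q_n = (1 - s / n)^n + o(1)]. *)

From HB Require Import structures.
Require Import Defs.
From mathcomp Require Import all_boot all_order all_algebra.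
From mathcomp Require Import all_classical all_reals all_analysis measurable_realfun.
From mathcomp Require Import ring lra.
Import Order.TTheory GRing.Theory Num.Theory.
Import numFieldNormedType.Exports.

Set Implicit Arguments.
Unset Strict Implicit.
Unset Printing Implicit Defensive.

Local Open Scope classical_set_scope.
Local Open Scope ring_scope.

(** * Lebesgue measure on the unit square *)


(** The perturbations vanish at the ends of the branches, so every branch of either factor maps onto
    the whole unit interval and the transfer operator creates no jumps; this is why densities can
    stay log-Lipschitz on the entire square. The bound [delta < (min - 1) / 2] makes every slope
    exceed 3/2, which is the origin of the contraction 2/3 and of the constants of the cone. The
    main obstacle is that [mu] is only known to be absolutely continuous: nothing places its density
    in the cone beforehand. All estimates are therefore proved for the push-forwards of Lebesgue
    measure, uniformly in time, and reach [mu] through setwise convergence, which uses only the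
    invariance of [mu] and the existence of some density. The indicator of a tube is not in the cone
    either. It is replaced by a Lipschitz cutoff of width [eta], which costs a factor of order
    [1 / eta] in front of the exponential rate. This is harmless with [eta] polynomially small,
    because the mixing gap is proportional to [n]. *)

Definition clamp {R : realType} (x : R) : R := Num.max 0 (Num.min x 1).

Lemma clamp_itv {R : realType} (x : R) : 0 <= clamp x <= 1.
Proof.
by rewrite /clamp le_max lexx ge_max ler01 ge_min lexx orbT.
Qed.

Lemma clamp_id {R : realType} (x : R) : 0 <= x <= 1 -> clamp x = x.
Proof.
rewrite /clamp => /andP[x0 x1]; rewrite min_l// max_r//.
Qed.

Lemma clamp_lip {R : realType} (x y : R) : `|clamp x - clamp y| <= `|x - y|.
Proof.
have H (z : R) : [\/ z <= 0 /\ clamp z = 0, 0 <= z <= 1 /\ clamp z = z | 1 <= z /\ clamp z = 1].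
  have [z0|z0] := leP z 0; first by apply: Or31; split=> //; rewrite /clamp min_l ?max_l//; lra.
  have [z1|z1] := leP z 1; first by apply: Or32; rewrite clamp_id ?(ltW z0).
  by apply: Or33; split; [exact: ltW|rewrite /clamp min_r ?max_r ?ltW].
rewrite ler_norml; have := ler_norm (x - y); have := ler_norm (y - x).
by rewrite (distrC y x); case: (H x) => -[? ->]; case: (H y) => -[? ->]; lra.
Qed.

Lemma measurable_clamp {R : realType} : measurable_fun [set: measurableTypeR R]
  (clamp : measurableTypeR R -> measurableTypeR R).
Proof.
apply: measurable_maxr; first exact: measurable_cst.
by apply: measurable_minr; [exact: measurable_id|exact: measurable_cst].
Qed.

Section unit_lebesgue.
Context {R : realType}.
Local Notation leb := (@lebesgue_measure R).

Lemma lebesgue_unit_fin : (leb `[0%R, 1%R]%classic < +oo)%E.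
Proof. by rewrite lebesgue_measure_itv/= lte_fin ltr01 oppr0 adde0 ltry. Qed.

(** Restricting the measure rather than the functions keeps all maps and densities total, so that
    integrals range over the full space. *)
Definition lam : {sigma_finite_measure set (measurableTypeR R) -> \bar R} :=
  @mfrestr _ (measurableTypeR R) R _ leb (measurable_itv `[0%R, 1%R]) lebesgue_unit_fin.

Local Notation lam2 := (lam \x lam)%E.

Lemma lamE (A : set R) : lam A = leb (A `&` `[0%R, 1%R]%classic).
Proof. by []. Qed.

Lemma lamT : lam setT = 1%E.
Proof. by rewrite lamE setTI lebesgue_measure_itv/= lte_fin ltr01 oppr0 adde0. Qed.

Lemma measurable_unit_square :
  measurable (unit_square : set (measurableTypeR R * measurableTypeR R)).
Proof. by apply: measurableX; exact: measurable_itv. Qed.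

Lemma lam2E (A : set (measurableTypeR R * measurableTypeR R)) : measurable A ->
  lam2 A = (leb \x leb)%E (A `&` unit_square).
Proof.
move=> mA.
have H := product_measure_unique (m1:=lam) (m2:=lam) (m':=mrestr (leb \x leb)%E measurable_unit_square).
apply: H => // B C mB mC; rewrite /= /mrestr /unit_square -setXI.
by rewrite product_measure1E//; apply: measurableI => //; exact: measurable_itv.
Qed.

Lemma lam2T : lam2 setT = 1%E.
Proof.
by rewrite -setXTT product_measure1E// -[1%E]mule1; congr (_ * _)%E; exact: lamT.
Qed.

End unit_lebesgue.
Notation lam2 := (lam \x lam)%E.

(** * Full branches and the transfer operator *)


(** Functions on the unit interval are extended to the line so as to be constant outside it.
    Measuring distances after clamping makes their Lipschitz bounds valid at all real points, and
    bounds every distance by 1. *)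
Definition cdist {R : realType} (x y : R) : R := `|clamp x - clamp y|.

(** The [S i] are the inverse branches of [F], and [w i] plays the role of the absolute derivative
    of [S i]. The derivative enters only through the mean value identity [fb_mvt], with a sign [s]
    for the orientation, and the change of variables [fb_dual]. [D] is the log-Lipschitz constant of
    the weights. Branch endpoints, where [F] is arbitrary, are absorbed by the finite list of
    [fb_cover]. *)
Record full_branch {R : realType} {n : nat} (F : R -> R) (S w : 'I_n -> R -> R)
    (lo hi D : R) : Prop := FullBranch {
  fb_mF : measurable_fun [set: measurableTypeR R] (F : measurableTypeR R -> measurableTypeR R);
  fb_mS : forall i, measurable_fun [set: measurableTypeR R] (S i : measurableTypeR R -> measurableTypeR R);
  fb_mw : forall i, measurable_fun [set: measurableTypeR R] (w i : measurableTypeR R -> measurableTypeR R);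
  fb_S01 : forall i z, 0 <= S i z <= 1;
  fb_w : forall i z, [&& 0 < lo, lo <= w i z & w i z <= hi];
  fb_wD : forall i z z', w i z <= expR (D * cdist z z') * w i z';
  fb_mvt : forall i, exists2 s : R, s = 1 \/ s = -1 &
    forall z z' : R, 0 <= z -> z <= z' -> z' <= 1 ->
    exists2 y : R, z <= y <= z' & s * (S i z' - S i z) = w i y * (z' - z);
  fb_Sclamp : forall i z, S i (clamp z) = S i z;
  fb_S01o : forall i (z : R), 0 < z < 1 -> 0 < S i z < 1;
  fb_FS : forall i (z : R), 0 < z < 1 -> F (S i z) = z;
  fb_disj : forall i j (z z' : R), 0 < z < 1 -> 0 < z' < 1 -> S i z = S j z' -> i = j;
  fb_cover : exists s : seq R, forall x : R, 0 <= x <= 1 ->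
    x \in s \/ exists i (z : R), 0 < z < 1 /\ x = S i z;
  fb_dual : forall Phi : measurableTypeR R * measurableTypeR R -> \bar R,
    measurable_fun [set: measurableTypeR R * measurableTypeR R] Phi -> (forall p, 0 <= Phi p)%E ->
    (\int[lam]_x Phi (F x, x) = \sum_i \int[lam]_z ((w i z)%:E * Phi (z, S i z)))%E }.


Definition transfer {R : realType} {n m : nat} (S w : 'I_n -> R -> R) (U v : 'I_m -> R -> R)
    (phi : R * R -> R) (p : R * R) : R :=
  \sum_i \sum_j w i p.1 * v j p.2 * phi (S i p.1, U j p.2).

Definition prodmap {R : realType} (F G : R -> R) (p : R * R) : R * R := (F p.1, G p.2).

Section transfer.
Context {R : realType}.
Local Notation mR := (measurableTypeR R).
Local Notation mRR := (measurableTypeR R * measurableTypeR R)%type.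
Local Notation lam := (@lam R).

Lemma measurable_prodmap (F G : R -> R) :
  measurable_fun [set: mR] (F : mR -> mR) -> measurable_fun [set: mR] (G : mR -> mR) ->
  measurable_fun [set: mRR] (prodmap F G : mRR -> mRR).
Proof.
move=> mF mG; apply/measurable_fun_pairP; split.
  exact: (measurableT_comp mF measurable_fst).
exact: (measurableT_comp mG measurable_snd).
Qed.

Context {n m : nat} {F G : R -> R} {S w : 'I_n -> R -> R} {U v : 'I_m -> R -> R}.
Context {lo hi D lo' hi' D' : R}.
Hypothesis fF : full_branch F S w lo hi D.
Hypothesis fG : full_branch G U v lo' hi' D'.

Lemma fb_w_ge0 n0 F0 (S0 w0 : 'I_n0 -> R -> R) lo0 hi0 D0 i z :
  full_branch F0 S0 w0 lo0 hi0 D0 -> 0 < w0 i z.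
Proof.
by move=> f; have /and3P[l0 l1 _] := fb_w f i z; exact: lt_le_trans l1.
Qed.

Lemma measurable_transfer_term (phi : mRR -> R) i j : measurable_fun [set: mRR] phi ->
  measurable_fun [set: mRR] (fun p : mRR => w i p.1 * v j p.2 * phi (S i p.1, U j p.2)).
Proof.
move=> mphi.
apply: measurable_funM; first apply: measurable_funM.
- exact: (measurableT_comp (fb_mw fF i) measurable_fst).
- exact: (measurableT_comp (fb_mw fG j) measurable_snd).
- exact: (measurableT_comp mphi (measurable_prodmap (fb_mS fF i) (fb_mS fG j))).
Qed.

Lemma measurable_transfer (phi : mRR -> R) : measurable_fun [set: mRR] phi ->
  measurable_fun [set: mRR] (transfer S w U v phi : mRR -> R).
Proof.
move=> mphi; apply: measurable_sum => i; apply: measurable_sum => j.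
exact: measurable_transfer_term.
Qed.

(** Tonelli reduces this to [fb_dual] in one variable at a time: first in the second coordinate with
    [x] fixed, then in the first coordinate with [y] fixed. *)
Lemma transfer_dual (B : set mRR) (phi : mRR -> R) : measurable B ->
  measurable_fun [set: mRR] phi -> (forall p, 0 <= phi p) ->
  (\int[lam2]_(p in (prodmap F G) @^-1` B) (phi p)%:E =
   \int[lam2]_(p in B) (transfer S w U v phi p)%:E)%E.
Proof.
move=> mB mphi phi0.
have mT := measurable_prodmap (fb_mF fF) (fb_mF fG).
have mTB : measurable ((prodmap F G : mRR -> mRR) @^-1` B).
  by rewrite -[X in measurable X]setTI; exact: mT.
have m1B : measurable_fun [set: mRR] (\1_B : mRR -> R) by exact: measurable_indic.
have mid : measurable_fun [set: mR] (id : mR -> mR) by exact: measurable_id.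
pose H j (q : mRR) : \bar R := (v j q.2 * (\1_B (F q.1, q.2) * phi (q.1, U j q.2)))%:E.
have mH j : measurable_fun [set: mRR] (H j).
  apply/measurable_EFinP/measurable_funM.
    exact: (measurableT_comp (fb_mw fG j) measurable_snd).
  apply: measurable_funM.
    exact: (measurableT_comp m1B (measurable_prodmap (fb_mF fF) mid)).
  exact: (measurableT_comp mphi (measurable_prodmap mid (fb_mS fG j))).
have H0 j q : (0 <= H j q)%E.
  by rewrite lee_fin !mulr_ge0// (ltW (fb_w_ge0 _ _ fG)).
rewrite integral_mkcond.
have -> : (fun p => (phi p)%:E) \_ (prodmap F G @^-1` B) =
    (fun p => (\1_B (F p.1, G p.2) * phi p)%:E) :> (mRR -> \bar R).
  apply/funext => p; rewrite patchE indicE.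
  rewrite (_ : (p \in _) = (prodmap F G p \in B)); last by apply/idP/idP; rewrite !inE.
  rewrite /prodmap.
  by case: ifPn => _; rewrite ?mul1r ?mul0r.
rewrite fubini_tonelli1; last 2 first.
- apply/measurable_EFinP/measurable_funM => //.
  exact: (measurableT_comp m1B mT).
- by move=> p; rewrite lee_fin mulr_ge0.
rewrite /fubini_F /=.
under eq_integral.
  move=> x _.
  pose Phi (q : mRR) : \bar R := (\1_B (F x, q.1) * phi (x, q.2))%:E.
  rewrite (_ : (\int[lam]_y _)%E = \int[lam]_y Phi (G y, y))%E //.
  rewrite (fb_dual fG); last 2 first.
  - apply/measurable_EFinP/measurable_funM.
      apply: (measurableT_comp m1B).
      exact: (measurable_fun_pair (measurable_cst _) measurable_fst).
    apply: (measurableT_comp mphi).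
    exact: (measurable_fun_pair (measurable_cst _) measurable_snd).
  - by move=> p; rewrite lee_fin mulr_ge0.
  rewrite (_ : (\sum_i _)%E = (\sum_j \int[lam]_z H j (x, z))%E); last first.
    apply: eq_bigr => j _; apply: eq_integral => z _.
    by rewrite /H /Phi/= -EFinM.
  over.
rewrite ge0_integral_sum//; last 2 first.
- move=> j; exact: (measurable_fun_fubini_tonelli_F (H j) (mH j) (H0 j)).
- by move=> j x _; apply: integral_ge0 => z _.
rewrite [RHS]integral_mkcond.
have -> : (fun p => (transfer S w U v phi p)%:E) \_ B =
    (fun p => \sum_j \sum_i (\1_B p * (w i p.1 * v j p.2 * phi (S i p.1, U j p.2)))%:E)%E
     :> (mRR -> \bar R).
  apply/funext => p; rewrite patchE indicE.
  under eq_bigr do rewrite sumEFin.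
  rewrite sumEFin /transfer exchange_big/=.
  case: ifPn => _; first by congr (_%:E); apply: eq_bigr => j _; apply: eq_bigr => i _; rewrite mul1r.
  by rewrite big1// => j _; rewrite big1// => i _; rewrite mul0r.
have mK i j : measurable_fun [set: mRR] (fun p : mRR =>
    (\1_B p * (w i p.1 * v j p.2 * phi (S i p.1, U j p.2)))%:E).
  by apply/measurable_EFinP/measurable_funM => //; exact: measurable_transfer_term.
have K0 i j (p : mRR) : (0 <= (\1_B p * (w i p.1 * v j p.2 * phi (S i p.1, U j p.2)))%:E)%E.
  by rewrite lee_fin !mulr_ge0// ?(ltW (fb_w_ge0 _ _ fG))// (ltW (fb_w_ge0 _ _ fF)).
rewrite ge0_integral_sum//; last 2 first.
- by move=> j; apply: emeasurable_sum.
- by move=> j x _; apply: sume_ge0.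
apply: eq_bigr => j _.
rewrite fubini_tonelli//.
rewrite fubini_tonelli2//; last 2 first.
- exact: emeasurable_sum.
- by move=> p; apply: sume_ge0.
apply: eq_integral => y _; rewrite /fubini_G/=.
(* The second coordinate is already pulled back by [U j]; only [F] in the first one remains. *)
pose Phi (q : mRR) : \bar R := (v j y * (\1_B (q.1, y) * phi (q.2, U j y)))%:E.
rewrite (_ : (\int[lam]_x _)%E = \int[lam]_x Phi (F x, x))%E //.
have mpair2 (f : mRR -> mR) (c : mR) : measurable_fun [set: mRR] f ->
    measurable_fun [set: mRR] (fun q => (f q, c) : mRR).
  by move=> mf; apply: measurable_fun_pair => //; exact: measurable_cst.
rewrite (fb_dual fF); last 2 first.
- apply/measurable_EFinP/measurable_funM; first exact: measurable_cst.
  apply: measurable_funM.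
    exact: (measurableT_comp m1B (mpair2 _ _ measurable_fst)).
  exact: (measurableT_comp mphi (mpair2 _ _ measurable_snd)).
- by move=> p; rewrite lee_fin !mulr_ge0// (ltW (fb_w_ge0 _ _ fG)).
rewrite ge0_integral_sum//; last first.
  by move=> i; apply: (measurableT_comp (mK i j)); apply: measurable_fun_pair => //; exact: measurable_cst.
apply: eq_bigr => i _; apply: eq_integral => x _; rewrite /Phi/= -EFinM; congr (_%:E); ring.
Qed.

End transfer.

(** * Densities with log-Lipschitz constant *)


Definition pdist {R : realType} (p q : R * R) : R := cdist p.1 q.1 + cdist p.2 q.2.

Section metric.
Context {R : realType}.

Lemma cdist_ge0 (x y : R) : 0 <= cdist x y. Proof. exact: normr_ge0. Qed.

Lemma cdist_le1 (x y : R) : cdist x y <= 1.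
Proof.
rewrite /cdist ler_norml; have := clamp_itv x; have := clamp_itv y; lra.
Qed.

Lemma pdist_ge0 (p q : R * R) : 0 <= pdist p q.
Proof. by rewrite addr_ge0// cdist_ge0. Qed.

Lemma pdist_le2 (p q : R * R) : pdist p q <= 2.
Proof. by rewrite /pdist; have := cdist_le1 p.1 q.1; have := cdist_le1 p.2 q.2; lra. Qed.

Lemma fb_lip n (F : R -> R) (S w : 'I_n -> R -> R) lo hi D i z z' :
  full_branch F S w lo hi D -> cdist (S i z) (S i z') <= hi * cdist z z'.
Proof.
move=> f; rewrite /cdist !(@clamp_id _ (S i _)) ?(fb_S01 f)//.
rewrite -(fb_Sclamp f i z) -(fb_Sclamp f i z').
have [s s1 H] := fb_mvt f i.
wlog zz' : z z' / clamp z <= clamp z'.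
  by move=> W; have /orP[/W//|/W] := le_total (clamp z) (clamp z'); rewrite distrC [X in _ <= _ * X]distrC.
have /andP[z0 z1] := clamp_itv z; have /andP[z0' z1'] := clamp_itv z'.
have [y /andP[_ _] E] := H _ _ z0 zz' z1'.
rewrite distrC [X in _ <= _ * X]distrC.
have -> : `|S i (clamp z') - S i (clamp z)| = `|s * (S i (clamp z') - S i (clamp z))|.
  by rewrite normrM; case: s1 => ->; rewrite ?normrN normr1 mul1r.
rewrite E normrM; apply: ler_wpM2r => //; rewrite ger0_norm ?(ltW (fb_w_ge0 _ _ f))//.
by have /and3P[] := fb_w f i y.
Qed.

End metric.

Section integral.
Context {R : realType}.
Local Notation mRR := (measurableTypeR R * measurableTypeR R)%type.

Implicit Types (c : R) (phi psi : mRR -> R) (B C : set mRR) (p q : mRR).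

(** Boundedness makes all integrals finite, so that [wmeas] can be real-valued and the coupling
    argument is plain real arithmetic. *)
Definition bounded_density (phi : mRR -> R) :=
  measurable_fun [set: mRR] phi /\ exists M : R, forall p, 0 <= phi p <= M.

Definition wmeas (phi : mRR -> R) (B : set mRR) : R :=
  fine (\int[lam2]_(p in B) (phi p)%:E)%E.

Lemma lam2_le1 (B : set mRR) : measurable B -> (lam2 B <= 1)%E.
Proof. by move=> mB; rewrite -lam2T; apply: le_measure; rewrite ?inE. Qed.

Lemma lam2_fin (B : set mRR) : measurable B -> lam2 B = (fine (lam2 B))%:E.
Proof.
move=> mB; rewrite fineK// ge0_fin_numE//.
exact: le_lt_trans (lam2_le1 mB) (ltry 1).
Qed.

Lemma fine_lam2T : fine (lam2 [set: mRR]) = 1.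
Proof. by have -> : lam2 [set: mRR] = 1%E by exact: lam2T. Qed.

Section wmeas_theory.
Variables (phi : mRR -> R) (B : set mRR).
Hypotheses (nphi : bounded_density phi) (mB : measurable B).

Let mphi : measurable_fun B (EFin \o phi).
Proof. by apply/measurable_EFinP; apply: measurable_funTS; case: nphi. Qed.

Let phi0 p : (0 <= (phi p)%:E)%E.
Proof. by case: nphi => _ [M /(_ p)/andP[]]; rewrite lee_fin. Qed.

Lemma wmeasE : (\int[lam2]_(p in B) (phi p)%:E = (wmeas phi B)%:E)%E.
Proof.
rewrite /wmeas fineK// ge0_fin_numE ?integral_ge0//.
case: nphi => _ [M hM].
apply: (@le_lt_trans _ _ (\int[lam2]_(p in B) (cst M%:E p))%E).
  by apply: ge0_le_integral => // p _; rewrite lee_fin; case/andP: (hM p).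
rewrite integral_cst//.
have M0 : 0 <= M by case/andP: (hM point) => h1 /(le_trans h1).
apply: (@le_lt_trans _ _ (M%:E * 1)%E); last by rewrite mule1 ltry.
by rewrite lee_wpmul2l ?lee_fin// lam2_le1.
Qed.

Lemma wmeas_ge0 : 0 <= wmeas phi B.
Proof. by rewrite -lee_fin -wmeasE integral_ge0. Qed.


End wmeas_theory.

Lemma wmeasD phi psi B : bounded_density phi -> bounded_density psi -> measurable B ->
  wmeas (fun p => phi p + psi p) B = wmeas phi B + wmeas psi B.
Proof.
move=> nphi npsi mB; rewrite {1}/wmeas.
under eq_integral do rewrite EFinD.
rewrite ge0_integralD//.
- by rewrite !wmeasE.
- by move=> p _; rewrite lee_fin; case: nphi => _ [M /(_ p)/andP[]].
- by apply/measurable_EFinP; apply: measurable_funTS; case: nphi.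
- by move=> p _; rewrite lee_fin; case: npsi => _ [M /(_ p)/andP[]].
- by apply/measurable_EFinP; apply: measurable_funTS; case: npsi.
Qed.

Lemma wmeasZ phi c B : bounded_density phi -> 0 <= c -> measurable B ->
  wmeas (fun p => c * phi p) B = c * wmeas phi B.
Proof.
move=> nphi c0 mB; rewrite {1}/wmeas.
under eq_integral do rewrite EFinM.
rewrite ge0_integralZl_EFin//.
- by rewrite wmeasE.
- by move=> p _; rewrite lee_fin; case: nphi => _ [M /(_ p)/andP[]].
- by apply/measurable_EFinP; apply: measurable_funTS; case: nphi.
Qed.

Lemma le_wmeas phi psi B C : bounded_density phi -> bounded_density psi ->
  measurable B -> measurable C -> B `<=` C ->
  (forall p, B p -> phi p <= psi p) -> wmeas phi B <= wmeas psi C.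
Proof.
move=> nphi npsi mB mC BC le; rewrite -lee_fin -!wmeasE//.
apply: (@le_trans _ _ (\int[lam2]_(p in B) (psi p)%:E)%E).
  apply: ge0_le_integral => //.
  - by move=> p _; rewrite lee_fin; case: nphi => _ [M /(_ p)/andP[]].
  - by apply/measurable_EFinP; apply: measurable_funTS; case: nphi.
  - by apply/measurable_EFinP; apply: measurable_funTS; case: npsi.
apply: ge0_subset_integral => //.
- by apply/measurable_EFinP; apply: measurable_funTS; case: npsi.
- by move=> p _; rewrite lee_fin; case: npsi => _ [M /(_ p)/andP[]].
Qed.

Lemma bounded_density_cst (c : R) : 0 <= c -> bounded_density (fun=> c).
Proof. by move=> c0; split; [exact: measurable_cst|exists c => p; rewrite c0 lexx]. Qed.

Lemma wmeas_cst c B : 0 <= c -> measurable B -> wmeas (fun=> c) B = c * fine (lam2 B).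
Proof.
move=> c0 mB; rewrite /wmeas integral_cst//.
by rewrite [X in (_ * X)%E](lam2_fin mB).
Qed.

Lemma bounded_densityD phi psi : bounded_density phi -> bounded_density psi ->
  bounded_density (fun p => phi p + psi p).
Proof.
move=> [m1 [M1 h1]] [m2 [M2 h2]]; split; first exact: measurable_funD.
exists (M1 + M2) => p; have /andP[a1 b1] := h1 p; have /andP[a2 b2] := h2 p.
by rewrite addr_ge0//= lerD.
Qed.

Lemma bounded_densityM phi psi : bounded_density phi -> bounded_density psi ->
  bounded_density (fun p => phi p * psi p).
Proof.
move=> [m1 [M1 h1]] [m2 [M2 h2]]; split; first exact: measurable_funM.
exists (M1 * M2) => p; have /andP[a1 b1] := h1 p; have /andP[a2 b2] := h2 p.
by rewrite mulr_ge0//= ler_pM.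
Qed.

End integral.

Section cone.
Context {R : realType}.
Local Notation mR := (measurableTypeR R).
Local Notation mRR := (measurableTypeR R * measurableTypeR R)%type.

Implicit Types (K L c : R) (phi psi : mRR -> R) (p q : mRR).

(** The bound on differences of [ln phi] in multiplicative form. This form passes directly to sums,
    hence to the transfer operator. *)
Definition log_lipschitz (K : R) (phi : mRR -> R) :=
  [/\ measurable_fun [set: mRR] phi, (forall p, 0 < phi p) &
      forall p q, phi p <= expR (K * pdist p q) * phi q].

Lemma log_lipschitzW K K' phi : K <= K' -> log_lipschitz K phi -> log_lipschitz K' phi.
Proof.
move=> KK' [mphi phi0 H]; split=> // p q; apply: le_trans (H p q) _.
by apply: ler_wpM2r; [exact: ltW|rewrite ler_expR; apply: ler_wpM2r => //; exact: pdist_ge0].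
Qed.

Lemma log_lipschitz_bounded K phi : 0 <= K -> log_lipschitz K phi -> bounded_density phi.
Proof.
move=> K0 [mphi phi0 H]; split=> //; exists (expR (K * 2) * phi (0, 0)) => p.
rewrite (ltW (phi0 p))/=; apply: le_trans (H p (0, 0)) _.
by apply: ler_wpM2r; [exact: ltW|rewrite ler_expR; apply: ler_wpM2l => //; exact: pdist_le2].
Qed.

(** Since [pdist] is at most 2, the values of [phi] differ by a factor of at most [expR (K * 2)],
    and its mean for the probability [lam2] lies between its extremes. *)
Lemma log_lipschitz_lb K phi p : 0 <= K -> log_lipschitz K phi ->
  expR (- (K * 2)) * wmeas phi setT <= phi p.
Proof.
move=> K0 Lphi; have bphi := log_lipschitz_bounded K0 Lphi.
have [mphi phi0 H] := Lphi.
rewrite expRN mulrC ler_pdivrMr ?expR_gt0// mulrC.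
have c0 : 0 <= expR (K * 2) * phi p by rewrite mulr_ge0 ?expR_ge0// ltW.
rewrite -[leRHS]mulr1 -[X in _ <= _ * X]fine_lam2T -wmeas_cst//.
apply: le_wmeas => //; first exact: bounded_density_cst.
move=> q _; apply: le_trans (H q p) _.
by apply: ler_wpM2r; [exact: ltW|rewrite ler_expR; apply: ler_wpM2l => //; exact: pdist_le2].
Qed.

Lemma log_lipschitz_ub K phi p : 0 <= K -> log_lipschitz K phi ->
  phi p <= expR (K * 2) * wmeas phi setT.
Proof.
move=> K0 Lphi; have bphi := log_lipschitz_bounded K0 Lphi.
have [mphi phi0 H] := Lphi.
rewrite -wmeasZ ?expR_ge0//.
rewrite -[leLHS]mulr1 -[X in _ * X <= _]fine_lam2T -wmeas_cst ?(ltW (phi0 _))//.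
apply: le_wmeas => //; first exact: bounded_density_cst (ltW (phi0 _)).
  by apply: bounded_densityM => //; apply: bounded_density_cst; exact: expR_ge0.
move=> q _; apply: le_trans (H p q) _.
by apply: ler_wpM2r; [exact: ltW|rewrite ler_expR; apply: ler_wpM2l => //; exact: pdist_le2].
Qed.

(* With z = exp (K d / 3), the claim reduces to 4 z^3 <= 3 z^4 + 1. *)
Lemma log_lipschitz_sub K c phi : 0 <= K -> 0 <= c -> (forall p, 4 * c <= phi p) ->
  log_lipschitz K phi -> log_lipschitz (4 / 3 * K) (fun p => phi p - c).
Proof.
move=> K0 c0 hc [mphi phi0 H]; split.
- exact: measurable_funB.
- by move=> p; have := hc p; have := phi0 p; lra.
- move=> p q; pose z := expR (K / 3 * pdist p q).
  have z1 : 1 <= z.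
    by rewrite -[1]expR0 ler_expR mulr_ge0 ?pdist_ge0// divr_ge0.
  have zE k : expR (k%:R * (K / 3 * pdist p q)) = z ^+ k by rewrite expRM_natl.
  have := H p q; have := hc q; have := phi0 q.
  have -> : K * pdist p q = 3%:R * (K / 3 * pdist p q) by field.
  have -> : 4 / 3 * K * pdist p q = 4%:R * (K / 3 * pdist p q) by field.
  rewrite !zE => f0 f1 f2.
  (* This product expands to [3 z^4 - 4 z^3 + 1]. *)
  have h1 : 0 <= (z - 1) ^+ 2 * (3 * z ^+ 2 + 2 * z + 1).
    by rewrite mulr_ge0 ?sqr_ge0//; have := sqr_ge0 z; lra.
  have h2 : 0 <= (z ^+ 4 - 1) * (phi q / 4 - c).
    by apply: mulr_ge0; [rewrite subr_ge0 exprn_ege1|lra].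
  have h3 : 0 <= phi q * ((z - 1) ^+ 2 * (3 * z ^+ 2 + 2 * z + 1)) by rewrite mulr_ge0// ltW.
  rewrite lerBlDr; apply: le_trans f2 _.
  rewrite -subr_ge0.
  have -> : z ^+ 4 * (phi q - c) + c - z ^+ 3 * phi q =
    (z ^+ 4 - 1) * (phi q / 4 - c) + phi q * ((z - 1) ^+ 2 * (3 * z ^+ 2 + 2 * z + 1)) / 4.
    by field.
  by rewrite addr_ge0// divr_ge0.
Qed.

Lemma log_lipschitzM K K' phi psi : log_lipschitz K phi -> log_lipschitz K' psi ->
  log_lipschitz (K + K') (fun p => phi p * psi p).
Proof.
move=> [m1 p1 H1] [m2 p2 H2]; split.
- exact: measurable_funM.
- by move=> p; exact: mulr_gt0.
- move=> p q; rewrite mulrDl expRD mulrACA.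
  by apply: ler_pM => //; exact: ltW.
Qed.

Lemma log_lipschitz_cst K c : 0 <= K -> 0 < c -> log_lipschitz K (fun=> c).
Proof.
move=> K0 c0; split=> // p q.
rewrite ler_peMl ?(ltW c0)// -[1]expR0 ler_expR mulr_ge0// pdist_ge0//.
Qed.

(** A nonnegative Lipschitz function enters the cone once a constant is added: with [L / K] as
    floor, a change of [L * pdist] is a relative change of at most [K * pdist]. This brings cutoff
    functions into the cone. *)
Lemma log_lipschitz_lip L K psi : 0 < K -> 0 < L ->
  measurable_fun [set: mRR] psi -> (forall p, 0 <= psi p) ->
  (forall p q, `|psi p - psi q| <= L * pdist p q) ->
  log_lipschitz K (fun p => psi p + L / K).
Proof.
move=> K0 L0 mpsi psi0 H; split.
- by apply: measurable_funD => //; exact: measurable_cst.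
- by move=> p; rewrite ltr_wpDl// divr_gt0.
- move=> p q.
  have h : psi p + L / K <= (1 + K * pdist p q) * (psi q + L / K).
    have := le_trans (ler_norm _) (H p q).
    have -> : (1 + K * pdist p q) * (psi q + L / K) =
      psi q + L / K + K * pdist p q * psi q + L * pdist p q.
      by field; rewrite gt_eqF.
    have : 0 <= K * pdist p q * psi q by rewrite !mulr_ge0 ?pdist_ge0// ltW.
    lra.
  apply: le_trans h _; apply: ler_wpM2r; first by rewrite addr_ge0// divr_ge0// ltW.
  exact: expR_ge1Dx.
Qed.

End cone.

(** * Decay of correlations *)


(** The arithmetic that ends [decay]. There [lA] and [lAD] are the laws of [A] and of [A] with a
    visit to [B] at time [t], [dA] that of [A] minus [A'], [i] and [a] the cutoff counterparts of
    [lA] and [lAD], [b] the law of the later visit, [z] the contribution of the added constant, and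
    [X] the coupling error. *)
Lemma indep_estimate {R : realType} (lA dA lAD a i b X Y z : R) :
  0 <= b -> b <= 1 -> 0 <= dA -> i <= lA -> lA <= i + dA -> a <= lAD -> lAD <= a + dA ->
  i * b + z <= a + z + X -> a + z <= i * b + z + X -> X <= Y ->
  `|lAD - lA * b| <= dA + Y.
Proof.
move=> b0 b1 dA0 iA Ai aD Da c1 c2 XY.
have h1 : i * b <= lA * b by exact: ler_wpM2r.
have h2 : lA * b - i * b <= dA by rewrite -mulrBl (le_trans (ler_piMr _ b1)) ?subr_ge0// lerBlDl.
move: h1 h2 c1 c2; move: (i * b) (lA * b) => u v h1 h2 c1 c2.
rewrite ler_norml; apply/andP; split; lra.
Qed.

Section mixing.
Context {R : realType}.
Local Notation mR := (measurableTypeR R).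
Local Notation mRR := (measurableTypeR R * measurableTypeR R)%type.
Context {n m : nat} {F G : R -> R} {S w : 'I_n -> R -> R} {U v : 'I_m -> R -> R}.
Context {lo hi lo' hi' D K0 : R}.
Hypothesis fF : full_branch F S w lo hi D.
Hypothesis fG : full_branch G U v lo' hi' D.
Hypotheses (n0 : (0 < n)%N) (m0 : (0 < m)%N) (hi23 : hi <= 2 / 3) (hi23' : hi' <= 2 / 3).
Hypotheses (K0gt0 : 0 < K0) (DK0 : 9 * D <= K0).
Implicit Types (K L c : R) (phi psi : mRR -> R) (A B E : set mRR) (p q : mRR).

Local Notation T := (prodmap F G : mRR -> mRR).
Local Notation P := (transfer S w U v).

Lemma measurable_iter_prodmap k : measurable_fun [set: mRR] (iter k T : mRR -> mRR).
Proof.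
elim: k => [|k IH]; first exact: measurable_id.
exact: (measurableT_comp (measurable_prodmap (fb_mF fF) (fb_mF fG)) IH).
Qed.

Lemma measurable_preimage_iter k B : measurable B -> measurable (iter k T @^-1` B).
Proof.
by move=> mB; rewrite -[X in measurable X]setTI; exact: measurable_iter_prodmap.
Qed.

(** Inverse branches contract distances by 2/3, which acts on [K]; the weights contribute [D] in
    each coordinate, hence [D * pdist] altogether. *)
Lemma transfer_log_lipschitz K phi : 0 <= K -> log_lipschitz K phi ->
  log_lipschitz (2 / 3 * K + D) (P phi).
Proof.
move=> K1 [mphi phi0 H]; split; first exact: (measurable_transfer fF fG).
- move=> p; rewrite /transfer.
  rewrite (bigD1 (Ordinal n0))//= ltr_pwDl//.
    rewrite (bigD1 (Ordinal m0))//= ltr_pwDl//.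
      by rewrite !mulr_gt0// ?(fb_w_ge0 _ _ fF)// (fb_w_ge0 _ _ fG).
    by apply: sumr_ge0 => j _; rewrite ltW// !mulr_gt0// ?(fb_w_ge0 _ _ fF)// (fb_w_ge0 _ _ fG).
  by apply: sumr_ge0 => i _; apply: sumr_ge0 => j _; rewrite ltW// !mulr_gt0// ?(fb_w_ge0 _ _ fF)// (fb_w_ge0 _ _ fG).
- move=> p q; rewrite /transfer mulr_sumr; apply: ler_sum => i _.
  rewrite mulr_sumr; apply: ler_sum => j _.
  have w1 := fb_wD fF i p.1 q.1; have w2 := fb_wD fG j p.2 q.2.
  have g1 := fb_w_ge0 i p.1 fF; have g2 := fb_w_ge0 j p.2 fG.
  have h0 := H (S i p.1, U j p.2) (S i q.1, U j q.2).
  have : phi (S i p.1, U j p.2) <= expR (2 / 3 * K * pdist p q) * phi (S i q.1, U j q.2).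
    apply: le_trans h0 _; apply: ler_wpM2r; first exact: ltW.
    rewrite ler_expR (_ : 2 / 3 * K * _ = K * (2 / 3 * pdist p q)); last by ring.
    apply: ler_wpM2l => //.
    have h1 := fb_lip i p.1 q.1 fF; have h2 := fb_lip j p.2 q.2 fG.
    have := cdist_ge0 p.1 q.1; have := cdist_ge0 p.2 q.2; rewrite /pdist/= => c1 c2.
    have := ler_wpM2r c2 hi23; have := ler_wpM2r c1 hi23'; lra.
  move=> h3.
  have -> : (2 / 3 * K + D) * pdist p q = D * cdist p.1 q.1 + D * cdist p.2 q.2 + 2 / 3 * K * pdist p q.
    by rewrite /pdist; ring.
  rewrite !expRD.
  rewrite [leRHS](_ : _ = (expR (D * cdist p.1 q.1) * w i q.1) * (expR (D * cdist p.2 q.2) * v j q.2) *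
    (expR (2 / 3 * K * pdist p q) * phi (S i q.1, U j q.2))); last by ring.
  apply: (ler_pM _ _ _ h3); [by rewrite mulr_ge0 ?ltW|exact: ltW|].
  by apply: ler_pM => //; rewrite ltW.
Qed.

(** The 4/3 is the price of subtracting a constant in [log_lipschitz_sub]. One needs
    [8/9 * K + D <= K], that is [9 * D <= K]: this is the origin of [DK0]. *)
Lemma transfer_cone K phi : K0 <= K -> log_lipschitz (4 / 3 * K) phi -> log_lipschitz K (P phi).
Proof.
move: (K0gt0) (DK0) => K0p DK0p KK0 Lphi; have : log_lipschitz (2 / 3 * (4 / 3 * K) + D) (P phi).
  by apply: transfer_log_lipschitz => //; lra.
apply: log_lipschitzW; lra.
Qed.

Lemma transfer_cone' K phi : K0 <= K -> log_lipschitz K phi -> log_lipschitz K (P phi).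
Proof. by move: (K0gt0) => K0p KK0 Lphi; apply: transfer_cone => //; apply: log_lipschitzW Lphi; lra. Qed.

Lemma wmeas_transfer K phi B : 0 <= K -> log_lipschitz K phi -> measurable B ->
  wmeas phi (T @^-1` B) = wmeas (P phi) B.
Proof.
move=> K1 [mphi phi0 _] mB; rewrite /wmeas (transfer_dual fF fG)// => p; exact: ltW.
Qed.

(** The share of mass left after one coupling step: a quarter of the guaranteed lower bound
    [expR (- (K * 2))] of a normalised density is removed. *)
Definition mixrate K := 1 - expR (- (K * 2)) / 4.

Lemma mixrate_itv K : 0 <= K -> 0 < mixrate K < 1.
Proof.
move=> K1; rewrite /mixrate; have : expR (- (K * 2)) <= 1.
  by rewrite -[leRHS]expR0 ler_expR; lra.
have := expR_gt0 (- (K * 2)); lra.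
Qed.

Lemma bounded_density_sub phi c : bounded_density phi -> (forall p, c <= phi p) -> 0 <= c ->
  bounded_density (fun p => phi p - c).
Proof.
move=> [mphi [M h]] hc c0; split; first exact: measurable_funB.
by exists M => p; have := hc p; have /andP[] := h p; lra.
Qed.

(** Induction on [t]. Subtract the same constant [c] from both densities: the removed parts
    contribute equally and cancel, while the remainders, once transferred, are back in the cone of
    constant [K] with equal masses multiplied by [mixrate K]. At [t = 0] the whole mass bounds the
    difference. *)
Lemma coupling K t phi1 phi2 B : K0 <= K -> log_lipschitz K phi1 -> log_lipschitz K phi2 ->
  wmeas phi1 setT = wmeas phi2 setT -> measurable B ->
  wmeas phi1 (iter t T @^-1` B) <= wmeas phi2 (iter t T @^-1` B) + wmeas phi1 setT * mixrate K ^+ t.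
Proof.
move=> KK0; have K1 : 0 <= K by exact: le_trans (ltW K0gt0) KK0.
elim: t phi1 phi2 => [|t IH] phi1 phi2 L1 L2 e mB.
  rewrite expr0 mulr1 ler_wpDl//.
    by apply: wmeas_ge0 => //; exact: log_lipschitz_bounded L2.
  by apply: le_wmeas => //; exact: log_lipschitz_bounded L1.
set M := wmeas phi1 setT in e *.
have b1 := log_lipschitz_bounded K1 L1; have b2 := log_lipschitz_bounded K1 L2.
have M0 : 0 <= M by exact: wmeas_ge0.
(* A quarter of the lower bound of [log_lipschitz_lb], as [log_lipschitz_sub] requires; it is the
   same for both densities because their masses agree. *)
pose c := expR (- (K * 2)) / 4 * M.
have c0 : 0 <= c by rewrite mulr_ge0// divr_ge0// expR_ge0.
have hc1 p : 4 * c <= phi1 p.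
  by apply: le_trans (log_lipschitz_lb p K1 L1); rewrite -/M /c; lra.
have hc2 p : 4 * c <= phi2 p.
  by apply: le_trans (log_lipschitz_lb p K1 L2); rewrite -e /c; lra.
have S1 := log_lipschitz_sub K1 c0 hc1 L1; have S2 := log_lipschitz_sub K1 c0 hc2 L2.
have mtB := measurable_preimage_iter t mB.
have split (phi : mRR -> R) (C : set mRR) : bounded_density phi -> (forall p, 4 * c <= phi p) ->
    measurable C -> wmeas phi C = wmeas (fun p => phi p - c) C + c * fine (lam2 C).
  move=> bphi hc mC; rewrite -wmeas_cst// -wmeasD//.
  - by congr (wmeas _ _); apply/funext => p; rewrite subrK.
  - by apply: bounded_density_sub => // p; have := hc p; lra.
  - exact: bounded_density_cst.
have -> : iter t.+1 T @^-1` B = T @^-1` (iter t T @^-1` B).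
  by apply/seteqP; split=> p; rewrite /= -iterS iterSr.
have mTB : measurable (T @^-1` (iter t T @^-1` B)) by exact: (measurable_preimage_iter 1).
rewrite (split phi1)// (split phi2)//.
have K43 : 0 <= 4 / 3 * K by lra.
rewrite !(@wmeas_transfer (4 / 3 * K))//.
have T1 := transfer_cone KK0 S1; have T2 := transfer_cone KK0 S2.
have e1 : wmeas (P (fun p => phi1 p - c)) setT = mixrate K * M.
  rewrite -(wmeas_transfer K43 S1)// preimage_setT.
  by have := split phi1 setT b1 hc1 measurableT; rewrite fine_lam2T -/M /mixrate /c; lra.
have e2 : wmeas (P (fun p => phi2 p - c)) setT = mixrate K * M.
  rewrite -(wmeas_transfer K43 S2)// preimage_setT.
  by have := split phi2 setT b2 hc2 measurableT; rewrite fine_lam2T -e /mixrate /c; lra.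
have := IH _ _ T1 T2 (etrans e1 (esym e2)) mB.
by rewrite e1 exprS; lra.
Qed.

Definition lawdens k : mRR -> R := iter k P (fun=> 1).

(** The distribution at time [k] of an orbit started from Lebesgue measure. Its density [lawdens k]
    stays in the cone by construction, which is not known of the density of [mu]. *)
Definition law k B : R := fine (lam2 (iter k T @^-1` B)).

Lemma lawdens_log_lipschitz k : log_lipschitz K0 (lawdens k).
Proof.
elim: k => [|k IH]; first by apply: log_lipschitz_cst => //; exact: ltW.
exact: transfer_cone'.
Qed.

Lemma wmeas_iter k phi B : log_lipschitz K0 phi -> measurable B ->
  wmeas phi (iter k T @^-1` B) = wmeas (iter k P phi) B.
Proof.
move=> L mB; elim: k phi L => // k IH phi L.
rewrite [iter k.+1 P phi]iterSr -IH; last exact: transfer_cone'.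
have -> : iter k.+1 T @^-1` B = T @^-1` (iter k T @^-1` B).
  by apply/seteqP; split=> p; rewrite /= -iterS iterSr.
apply: wmeas_transfer L _; first exact: ltW.
exact: measurable_preimage_iter.
Qed.

Lemma lawE k B : measurable B -> law k B = wmeas (lawdens k) B.
Proof.
move=> mB; rewrite /lawdens -wmeas_iter//; last first.
  by apply: log_lipschitz_cst => //; exact: ltW.
by rewrite wmeas_cst// ?mul1r//; exact: measurable_preimage_iter.
Qed.

Lemma law_ge0 k B : 0 <= law k B. Proof. exact: fine_ge0. Qed.

Lemma lawT k : law k setT = 1.
Proof. by rewrite /law preimage_setT fine_lam2T. Qed.

Lemma le_law k A B : measurable A -> measurable B -> A `<=` B -> law k A <= law k B.
Proof.
move=> mA mB AB; rewrite /law; have mA' := measurable_preimage_iter k mA.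
have mB' := measurable_preimage_iter k mB.
rewrite -lee_fin -!lam2_fin//; apply: le_measure; rewrite ?inE//.
by move=> p; exact: AB.
Qed.

Lemma law_le1 k B : measurable B -> law k B <= 1.
Proof. by move=> mB; rewrite -(lawT k); apply: le_law. Qed.

Lemma lawD k A B : measurable A -> measurable B -> law k A = law k (A `&` B) + law k (A `\` B).
Proof.
move=> mA mB; rewrite /law preimage_setI.
have -> : iter k T @^-1` (A `\` B) = (iter k T @^-1` A) `\` (iter k T @^-1` B) by [].
have mA' := measurable_preimage_iter k mA.
have mB' := measurable_preimage_iter k mB.
apply: EFin_inj; rewrite EFinD -!lam2_fin; [|exact: measurableD|exact: measurableI|by []].
by rewrite (measureDI _ mA' mB')/= addeC.
Qed.

Lemma law_add k t B : measurable B -> law (k + t) B = law k (iter t T @^-1` B).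
Proof.
move=> mB; rewrite /law; congr (fine (lam2 _)).
by apply/seteqP; split=> p; rewrite /= addnC iterD.
Qed.

Lemma law_bounds k B : measurable B ->
  expR (- (K0 * 2)) * fine (lam2 B) <= law k B <= expR (K0 * 2) * fine (lam2 B).
Proof.
move=> mB; have K1 := ltW K0gt0; rewrite lawE//.
have L := lawdens_log_lipschitz k; have bL := log_lipschitz_bounded K1 L.
have mass : wmeas (lawdens k) setT = 1 by rewrite -lawE// lawT.
have e0 := expR_ge0 (- (K0 * 2)); have e1 := expR_ge0 (K0 * 2).
rewrite -!wmeas_cst//; apply/andP; split; apply: le_wmeas => //;
  try exact: bounded_density_cst.
- by move=> p _; have := log_lipschitz_lb p K1 L; rewrite mass mulr1.
- by move=> p _; have := log_lipschitz_ub p K1 L; rewrite mass mulr1.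
Qed.

(** The cutoff [psi] lies between the indicators of [A'] and [A]. Lifted by a constant and
    multiplied by the density of [law k], it is in the cone of constant [K0 + K0]; coupling compares
    it with a multiple of that density of the same mass. Replacing [psi] by the indicator of [A]
    costs at most the law of [A] minus [A']. The bound is uniform in [k] apart from that term. *)
Lemma decay k t L psi A A' B : 0 < L -> measurable A -> measurable A' -> measurable B ->
  measurable_fun [set: mRR] psi ->
  (forall p, 0 <= psi p <= 1) -> (forall p q, `|psi p - psi q| <= L * pdist p q) ->
  (forall p, A' p -> psi p = 1) -> (forall p, ~ A p -> psi p = 0) ->
  `|law k (A `&` (iter t T @^-1` B)) - law k A * law (k + t) B| <=
    law k (A `\` A') + (1 + L / K0) * mixrate (K0 + K0) ^+ t.
Proof.
move=> L0 mA mA' mB mpsi psi01 Lpsi psi1 psi0; move: (K0gt0) => K0p; have K1 := ltW K0gt0.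
set Dt := iter t T @^-1` B; have mDt : measurable Dt by exact: measurable_preimage_iter.
rewrite law_add// -/Dt.
set h := lawdens k; have Lh : log_lipschitz K0 h := lawdens_log_lipschitz k.
have bh := log_lipschitz_bounded K1 Lh.
have bpsi : bounded_density psi by split=> //; exists 1.
have bpsih := bounded_densityM bpsi bh.
(* The constant that [log_lipschitz_lip] adds to a function of Lipschitz constant [L]. *)
pose kap := L / K0; have kap0 : 0 < kap by exact: divr_gt0.
have L1 : log_lipschitz (K0 + K0) (fun p => (psi p + kap) * h p).
  apply: log_lipschitzM => //; apply: log_lipschitz_lip => // p.
  by case/andP: (psi01 p).
pose a C := wmeas (fun p => psi p * h p) C.
have E1 C : measurable C -> wmeas (fun p => (psi p + kap) * h p) C = a C + kap * law k C.
  move=> mC; rewrite lawE// -(wmeasZ bh (ltW kap0) mC) -wmeasD//.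
    by congr (wmeas _ _); apply/funext => p; rewrite mulrDl.
  by apply: bounded_densityM => //; apply: bounded_density_cst; exact: ltW.
have a0 C : measurable C -> 0 <= a C by move=> mC; exact: wmeas_ge0.
have aA C : measurable C -> a C <= law k (A `&` C).
  move=> mC; have mAC : measurable (A `&` C) by exact: measurableI.
  rewrite lawE// -/h /a {1}/wmeas.
  rewrite [X in (fine X)](_ : _ = (wmeas (fun p => psi p * h p) (A `&` C))%:E).
    apply: le_wmeas => // p _; rewrite ler_piMl//; last by case/andP: (psi01 p).
    by case: Lh => _ /(_ p)/ltW.
  rewrite -wmeasE// [LHS]integral_mkcond [RHS]integral_mkcond; apply: eq_integral => p _.
  rewrite !patchE in_setI; have [|/negP pA] := boolP (p \in A); rewrite ?inE//=.
  by case: ifP => // _; rewrite psi0 ?mul0r//; move: pA; rewrite inE.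
have Aa C : measurable C -> law k (A' `&` C) <= a C.
  move=> mC; have mAC : measurable (A' `&` C) by exact: measurableI.
  rewrite lawE//; apply: le_wmeas => // p [/psi1 ->].
  by rewrite mul1r.
pose i := a setT.
have i1 : i <= law k A by have := aA setT measurableT; rewrite setIT.
have i2 : law k A' <= i by have := Aa setT measurableT; rewrite setIT.
have A1 : law k A <= 1 by exact: law_le1.
have M1 : wmeas (fun p => (psi p + kap) * h p) setT = i + kap by rewrite E1// lawT mulr1.
have ik : 0 < i + kap by rewrite ltr_wpDl// a0.
have hT : wmeas h setT = 1 by rewrite -lawE// lawT.
have L2 : log_lipschitz (K0 + K0) (fun p => (i + kap) * h p).
  by apply: log_lipschitzM => //; exact: log_lipschitz_cst.
have E2 C : measurable C -> wmeas (fun p => (i + kap) * h p) C = (i + kap) * law k C.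
  by move=> mC; rewrite lawE// wmeasZ// ltW.
have M2 : wmeas (fun p => (i + kap) * h p) setT = i + kap by rewrite E2// lawT mulr1.
have KK : K0 <= K0 + K0 by rewrite lerDl ltW.
(* Coupling is one-sided, so it is applied in both directions. *)
have := coupling t KK L1 L2 (etrans M1 (esym M2)) mB.
have := coupling t KK L2 L1 (etrans M2 (esym M1)) mB.
rewrite -/Dt M1 M2 E1// E2//.
have K2 : 0 <= K0 + K0 by rewrite addr_ge0// ltW.
have /andP[r0 r1] := mixrate_itv K2.
set rt := mixrate _ ^+ t; have rt0 : 0 <= rt by rewrite exprn_ge0// ltW.
have rti : (i + kap) * rt <= (1 + kap) * rt.
  by apply: ler_wpM2r => //; rewrite lerD2r; exact: le_trans A1.
set b := law k Dt; have b0 : 0 <= b := law_ge0 _ _; have b1 : b <= 1 by exact: law_le1.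
have g1 : law k A = law k (A `&` A') + law k (A `\` A') by exact: lawD.
have g2 : law k (A `&` A') <= law k A' by apply: le_law => //; exact: measurableI.
have mADt : measurable (A `&` Dt) by exact: measurableI.
have g3 : law k (A `&` Dt) = law k (A `&` Dt `&` A') + law k (A `&` Dt `\` A') by exact: lawD.
have g4 : law k (A `&` Dt `&` A') <= law k (A' `&` Dt).
  by apply: le_law; [exact: measurableI|exact: measurableI|move=> p [[_ ?] ?]].
have g5 : law k (A `&` Dt `\` A') <= law k (A `\` A').
  by apply: le_law; [exact: measurableD|exact: measurableD|move=> p [[? _] ?]].
have g6 := aA Dt mDt; have g7 := Aa Dt mDt.
have g8 : law k A <= i + law k (A `\` A') by rewrite g1 lerD2r; exact: le_trans i2.
have g9 : law k (A `&` Dt) <= a Dt + law k (A `\` A').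
  by rewrite g3; apply: lerD g5; exact: le_trans g7.
rewrite -/kap !(mulrDl _ _ b) => c1 c2.
exact: (indep_estimate b0 b1 (law_ge0 _ _) i1 g8 g6 g9 c1 c2 rti).
Qed.

End mixing.


(** * Finite measures and a generating family for the plane *)

Lemma fine_mu_le {d} {T : measurableType d} {R : realType} (mu : {finite_measure set T -> \bar R})
  (A B : set T) : measurable A -> measurable B -> A `<=` B -> fine (mu A) <= fine (mu B).
Proof.
by move=> mA mB AB; apply: fine_le; rewrite ?fin_num_measure//; apply: le_measure; rewrite ?inE.
Qed.

Lemma fine_muD {d} {T : measurableType d} {R : realType} (mu : {finite_measure set T -> \bar R})
  (A B : set T) : measurable A -> measurable B ->
  fine (mu A) = fine (mu (A `&` B)) + fine (mu (A `\` B)).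
Proof.
move=> mA mB; rewrite -fineD ?fin_num_measure//; [|exact: measurableI|exact: measurableD].
by congr fine; rewrite [in LHS](measureDI _ mA mB) addeC.
Qed.

Lemma small_tail {d} {T : measurableType d} {R : realType} (mu : {measure set T -> \bar R})
  (A : (set T)^nat) (e : R) : (mu setT < +oo)%E -> (forall n, measurable (A n)) ->
  nonincreasing_seq A -> \bigcap_n A n = set0 -> 0 < e -> exists n, fine (mu (A n)) <= e.
Proof.
move=> muT mA niA A0 e0.
have : mu \o A @ \oo --> mu (\bigcap_n A n).
  apply: nonincreasing_cvg_mu => //; last by rewrite A0.
  by apply: le_lt_trans muT; apply: le_measure; rewrite ?inE.
rewrite A0 measure0 => /fine_cvgP[_] /cvgrPdist_le/(_ _ e0)[n _ /(_ n (leqnn n))].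
rewrite /= sub0r normrN ger0_norm ?fine_ge0// => H; by exists n.
Qed.

Lemma geometric_small {R : realType} (C r e : R) : 0 <= r < 1 -> 0 < e ->
  exists t0, forall t, (t0 <= t)%N -> C * r ^+ t <= e.
Proof.
move=> /andP[r0 r1] e0.
have : C * r ^+ t @[t --> \oo] --> C * 0.
  by apply: cvgMr; apply: cvg_expr; rewrite ger0_norm.
rewrite mulr0 => /cvgrPdist_le/(_ _ e0)[t0 _ H]; exists t0 => t /H/=.
rewrite sub0r normrN => /(le_trans (ler_norm _)); exact.
Qed.

Section borel_plane.
Context {R : realType}.
Local Notation mR := (measurableTypeR R).
Local Notation mRR := (measurableTypeR R * measurableTypeR R)%type.

(** Open quadrants form a pi-system generating the Borel sets, and on the square each is the
    positivity set of a Lipschitz function, which [decay] can handle. *)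
Definition quadrants : set (set mRR) :=
  [set A | exists x y : R, A = [set p | x < p.1 /\ y < p.2]].

Lemma setI_closed_quadrants : setI_closed quadrants.
Proof.
move=> _ _ [x [y ->]] [x' [y' ->]]; exists (Num.max x x'), (Num.max y y').
apply/seteqP; split=> p /=; rewrite !gt_max; first by move=> [[-> ->] [-> ->]].
by move=> [/andP[-> ->] /andP[-> ->]].
Qed.

Lemma measurable_quadrants : @measurable _ mRR `<=` <<s quadrants >>.
Proof.
have sig : sigma_algebra setT <<s quadrants >> by exact: smallest_sigma_algebra.
have pre (f : mRR -> mR) : (forall x : R, <<s quadrants >> (f @^-1` `]x, +oo[)) ->
    forall A : set mR, measurable A -> <<s quadrants >> (f @^-1` A).
  move=> fray A; rewrite (RGenOInfty.measurableE R) => mA.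
  suff : <<s @RGenOInfty.G R >> `<=` [set B : set R | <<s quadrants >> (f @^-1` B)] by exact.
  apply: smallest_sub; last by move=> _ [x ->]; exact: fray.
  split => /=.
  - by rewrite preimage_set0; case: sig.
  - move=> B sB; rewrite setTD preimage_setC -setTD; case: sig => _ + _; exact.
  - by move=> B sB; rewrite preimage_bigcup; case: sig => _ _; apply.
have fray x : <<s quadrants >> ((fst : mRR -> mR) @^-1` `]x, +oo[).
  have -> : (fst : mRR -> mR) @^-1` `]x, +oo[ = \bigcup_n [set p : mRR | x < p.1 /\ - n%:R < p.2].
    apply/seteqP; split => [p /=|p [n _ [xp _]]]; last by rewrite /= in_itv/= xp.
    rewrite in_itv/= andbT => xp; exists (Num.bound p.2) => //; split=> //.
    by rewrite ltrNl unstable.ltrNbound.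
  case: sig => _ _; apply => n; apply: sub_sigma_algebra; by exists x, (- n%:R).
have sray y : <<s quadrants >> ((snd : mRR -> mR) @^-1` `]y, +oo[).
  have -> : (snd : mRR -> mR) @^-1` `]y, +oo[ = \bigcup_n [set p : mRR | - n%:R < p.1 /\ y < p.2].
    apply/seteqP; split => [p /=|p [n _ [_ yp]]]; last by rewrite /= in_itv/= yp.
    rewrite in_itv/= andbT => yp; exists (Num.bound p.1) => //; split=> //.
    by rewrite ltrNl unstable.ltrNbound.
  case: sig => _ _; apply => n; apply: sub_sigma_algebra; by exists (- n%:R), y.
apply: smallest_sub => //; rewrite subUset; split => _ [A mA <-]; rewrite setTI; exact: pre.
Qed.

End borel_plane.

(** * Convergence of the push-forwards of Lebesgue measure *)


Lemma ler_dist_min {R : realType} (a b a' b' : R) :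
  `|Num.min a a' - Num.min b b'| <= `|a - b| + `|a' - b'|.
Proof.
have h1 := ler_norm (a - b); have h2 := ler_norm (b - a); rewrite distrC in h2.
have h3 := ler_norm (a' - b'); have h4 := ler_norm (b' - a'); rewrite distrC in h4.
rewrite ler_norml.
by case: (leP a a') => ?; case: (leP b b') => ?; apply/andP; split; lra.
Qed.

Section uniqueness.
Context {R : realType}.
Local Notation mR := (measurableTypeR R).
Local Notation mRR := (measurableTypeR R * measurableTypeR R)%type.
Context {n m : nat} {F G : R -> R} {S w : 'I_n -> R -> R} {U v : 'I_m -> R -> R}.
Context {lo hi lo' hi' D K0 : R}.
Hypothesis fF : full_branch F S w lo hi D.
Hypothesis fG : full_branch G U v lo' hi' D.
Hypotheses (n0 : (0 < n)%N) (m0 : (0 < m)%N) (hi23 : hi <= 2 / 3) (hi23' : hi' <= 2 / 3).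
Hypotheses (K0gt0 : 0 < K0) (DK0 : 9 * D <= K0).
Implicit Types (K L c : R) (phi psi : mRR -> R) (A B E : set mRR) (p q : mRR).

Local Notation T := (prodmap F G : mRR -> mRR).
Local Notation law := (@law R F G).

Let lam2_lty : (lam2 [set: mRR] < +oo)%E.
Proof. exact: (le_lt_trans (lam2_le1 measurableT) (ltry 1)). Qed.

Let mpre k B : measurable B -> measurable (iter k T @^-1` B).
Proof. exact: (measurable_preimage_iter fF fG). Qed.

Let lawle k A B : measurable A -> measurable B -> A `<=` B -> law k A <= law k B.
Proof. exact: (le_law fF fG). Qed.

Let lawd k A B : measurable A -> measurable B -> law k A = law k (A `&` B) + law k (A `\` B).
Proof. exact: (lawD fF fG). Qed.

Definition defect E t B := law 0 (E `&` (iter t T @^-1` B)) - law 0 E * law t B.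

(** No rate is asked for: a rate would not survive monotone limits of sets, whereas this property
    defines a lambda-system. *)
Definition asymptotically_indep E := measurable E /\
  forall B, measurable B -> forall e : R, 0 < e ->
    exists t0, forall t, (t0 <= t)%N -> `|defect E t B| <= e.

(** The sets where [d] is at least [1 / (k + 1)] increase to the positivity set, and the cutoff
    [clamp ((k + 1) * d)] separates them from its complement. Fix [k] so that the leftover is small,
    then let [t] grow in [decay]. *)
Lemma asymptotically_indep_open (d : mRR -> R) : measurable_fun [set: mRR] d ->
  (forall p q, `|d p - d q| <= pdist p q) -> asymptotically_indep [set p | 0 < d p].
Proof.
move=> md dl.
have mE (r : R) : measurable [set p | r < d p].
  rewrite -[X in measurable X]setTI (_ : [set p | _] = d @^-1` `]r, +oo[).
    exact: (md measurableT _ (measurable_itv _)).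
  by apply/seteqP; split => p /=; rewrite in_itv/= andbT.
have mE' (r : R) : measurable [set p | r <= d p].
  rewrite -[X in measurable X]setTI (_ : [set p | _] = d @^-1` `[r, +oo[).
    exact: (md measurableT _ (measurable_itv _)).
  by apply/seteqP; split => p /=; rewrite in_itv/= andbT.
split=> [|B mB e e0]; first exact: mE.
set E := [set p | 0 < d p].
have e2 : 0 < e / 2 by rewrite divr_gt0.
pose A' k := [set p | k.+1%:R^-1 <= d p].
have [k hk] : exists k, law 0 (E `\` A' k) <= e / 2.
  apply: (small_tail (A := fun k => E `\` A' k)) => //.
  - by move=> k; apply: measurableD; [exact: mE|exact: mE'].
  - move=> i j ij; apply/subsetPset => p [p1 p2]; split=> //; apply: contra_not p2.
    rewrite /A'/=; apply: le_trans; rewrite lef_pV2 ?posrE ?ltr0n// ler_nat.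
    by rewrite ltnS.
  - rewrite -subset0 => p H; have [p0 _] := H 0%N I.
    have [_] := H (Num.bound (d p)^-1) I; apply.
    rewrite /A'/= invf_ple ?posrE ?ltr0n//.
    apply: le_trans (ltW (unstable.ltr_bound _)) _; by rewrite ler_nat.
have L0 : 0 < k.+1%:R :> R by rewrite ltr0n.
have K2 : 0 <= K0 + K0 by rewrite addr_ge0 ?ltW.
have /andP[r0 r1] := mixrate_itv K2.
have r01 : 0 <= mixrate (K0 + K0) < 1 by rewrite (ltW r0).
have [t0 ht] := geometric_small (1 + k.+1%:R / K0) r01 e2.
exists t0 => t /ht{}ht.
have := @decay _ _ _ _ _ _ _ _ _ _ _ _ _ _ _ fF fG n0 m0 hi23 hi23' K0gt0 DK0 0 t k.+1%:R
  (fun p => clamp (k.+1%:R * d p)) E (A' k) B L0 (mE 0) (mE' _) mB.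
move=> H; rewrite (splitr e); apply: le_trans (lerD hk ht); apply: H.
- by apply: (measurableT_comp measurable_clamp); apply: measurable_funM => //; exact: measurable_cst.
- by move=> p; exact: clamp_itv.
- move=> p q; apply: le_trans (clamp_lip _ _) _; rewrite -mulrBr normrM (ger0_norm (ltW L0)).
  by apply: ler_wpM2l; [exact: ltW|exact: dl].
- move=> p; rewrite /A'/= => h; rewrite /clamp min_r ?max_r//.
  by rewrite -ler_pdivrMl// mulr1.
- move=> p; rewrite /E/= => /negP; rewrite -leNgt => h.
  have h' : k.+1%:R * d p <= 0 by rewrite pmulr_rle0.
  by rewrite /clamp min_l ?max_l//; exact: le_trans h' _.
Qed.

Lemma eq_law0 A B : measurable A -> measurable B ->
  A `&` unit_square = B `&` unit_square -> law 0 A = law 0 B.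
Proof. by move=> mA mB AB; rewrite /law/= !lam2E// AB. Qed.

(** The function [d] clamps the coordinates so as to be Lipschitz for [pdist]. Its positivity set
    agrees with the quadrant on the square only, and Lebesgue measure on the square sees nothing
    else. *)
Lemma asymptotically_indep_quadrant A : quadrants A -> asymptotically_indep A.
Proof.
move=> [x [y AE]].
pose d (p : mRR) : R := Num.min (clamp p.1 - x) (clamp p.2 - y).
have mc := @measurable_clamp R.
have md : measurable_fun [set: mRR] d.
  apply: measurable_minr.
    apply: measurable_funB; last exact: measurable_cst.
    exact: (measurableT_comp mc measurable_fst).
  apply: measurable_funB; last exact: measurable_cst.
  exact: (measurableT_comp mc measurable_snd).
have dl p q : `|d p - d q| <= pdist p q.
  rewrite /d; apply: le_trans (ler_dist_min _ _ _ _) _.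
  by rewrite /pdist /cdist !opprB !addrA !subrK.
have [mE gE] := asymptotically_indep_open md dl.
have mA : measurable A.
  rewrite AE (_ : mkset _ = `]x, +oo[ `*` `]y, +oo[).
    by apply: measurableX; exact: measurable_itv.
  by apply/seteqP; split=> p; rewrite /= !in_itv/= !andbT.
have EA : [set p | 0 < d p] `&` unit_square = A `&` unit_square.
  rewrite AE; apply/seteqP; split=> p [] /=; rewrite /d /unit_square/= !in_itv/= lt_min !subr_gt0.
    by move=> /andP[+ +] [p1 p2]; rewrite !clamp_id.
  by move=> [+ +] [p1 p2]; rewrite !clamp_id// => -> ->.
split=> // B mB e e0; have [t0 H] := gE B mB e e0; exists t0 => t /H.
have mD := mpre t mB; set Dt := iter t T @^-1` B in mD *.
have e1 : law 0 A = law 0 [set p | 0 < d p] by apply: eq_law0.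
have e2 : law 0 (A `&` Dt) = law 0 ([set p | 0 < d p] `&` Dt).
  apply: eq_law0; [exact: measurableI|exact: measurableI|].
  by rewrite setIAC -EA setIAC.
by rewrite /defect e1 -/Dt e2.
Qed.

(** The difference of the defects is itself a difference of two numbers between 0 and the law of [E]
    minus [E']. *)
Lemma defect_approx E E' t B : measurable E -> measurable E' -> measurable B -> E' `<=` E ->
  `|defect E t B - defect E' t B| <= law 0 (E `\` E').
Proof.
move=> mE mE' mB E'E; rewrite /defect.
have mD := mpre t mB; set Dt := iter t T @^-1` B in mD *.
have h1 := lawd 0 mE mE'; rewrite setIidr// in h1.
have h2 := lawd 0 (measurableI _ _ mE mD) mE'.
have h3 : E `&` Dt `&` E' = E' `&` Dt by rewrite setIAC (setIidr E'E).
rewrite h3 in h2.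
have h4 : law 0 (E `&` Dt `\` E') <= law 0 (E `\` E').
  by apply: lawle; [apply: measurableD => //; exact: measurableI|exact: measurableD|move=> p [[]]].
have h5 := law_ge0 0 (E `&` Dt `\` E'); have h6 := law_ge0 0 (E `\` E').
have h7 : law t B <= 1 by exact: (law_le1 fF fG).
have h8 := law_ge0 t B : 0 <= law t B.
have h9 : 0 <= law 0 (E `\` E') * law t B by exact: mulr_ge0.
have h10 : law 0 (E `\` E') * law t B <= law 0 (E `\` E') by rewrite ler_piMr.
have aux (a b c d f : R) : (a + b) - (c + d) * f - (a - c * f) = b - d * f by ring.
rewrite h2 h1 -/Dt aux.
rewrite ler_norml lerNl opprB; apply/andP; split.
  by apply: le_trans h10; rewrite gerBl.
by apply: le_trans h4; rewrite gerBl.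
Qed.

(** Dynkin's argument from the quadrants: the defect is additive on proper differences, and
    [defect_approx] controls it along increasing unions. *)
Lemma asymptotically_indep_measurable E : measurable E -> asymptotically_indep E.
Proof.
move=> mE; suff : lambda_system setT asymptotically_indep.
  move=> H; apply: (lambda_system_subset setI_closed_quadrants H asymptotically_indep_quadrant) => //.
  exact: measurable_quadrants.
split => //.
- split=> // B mB e e0; exists 0%N => t _.
  rewrite /defect setTI lawT mul1r.
  rewrite (_ : law 0 _ = law t B) ?subrr ?normr0 ?ltW//.
- move=> A B AB [mA gA] [mB gB]; split; first exact: measurableD.
  move=> C mC e e0; have e2 : 0 < e / 2 by rewrite divr_gt0.
  have [tA hA] := gA C mC _ e2; have [tB hB] := gB C mC _ e2.
  exists (maxn tA tB) => t; rewrite geq_max => /andP[/hA{}hA /hB{}hB].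
  have mD := mpre t mC.
  have -> : defect (A `\` B) t C = defect A t C - defect B t C.
    rewrite /defect (lawd 0 mA mB) (setIidr AB).
    rewrite (lawd 0 (measurableI _ _ mA mD) mB).
    rewrite (_ : A `&` _ `&` B = B `&` iter t T @^-1` C); last by rewrite setIAC (setIidr AB).
    rewrite (_ : A `&` _ `\` B = (A `\` B) `&` iter t T @^-1` C); last first.
      by rewrite !setDE setIAC.
    have aux (x y z u b : R) : y - x * b = z + y - (u + x) * b - (z - u * b) by ring.
    exact: aux.
  by rewrite (splitr e); apply: le_trans (ler_normB _ _) _; exact: lerD.
- move=> A nd gA; split; first by apply: bigcup_measurable => k _; case: (gA k).
  move=> C mC e e0; have e2 : 0 < e / 2 by rewrite divr_gt0.
  have mU : measurable (\bigcup_k A k) by apply: bigcup_measurable => k _; case: (gA k).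
  have [k hk] : exists k, law 0 (\bigcup_k A k `\` A k) <= e / 2.
    apply: (small_tail (A := fun k => \bigcup_k A k `\` A k)) => //.
    + by move=> k; apply: measurableD => //; case: (gA k).
    + move=> i j ij; apply/subsetPset => p [p1 p2]; split=> //; apply: contra_not p2.
      by move/subsetPset: (nd _ _ ij); apply.
    + by rewrite -subset0 => p H; have [[k _ kp] _] := H 0%N I; have [_] := H k I; apply.
  have [mk /(_ C mC _ e2)[t0 H]] := gA k.
  exists t0 => t /H{}H; rewrite (splitr e).
  rewrite -[defect _ _ _](subrK (defect (A k) t C)); apply: le_trans (ler_normD _ _) _.
  apply: lerD => //; apply: le_trans hk; apply: defect_approx => //.
  by move=> p Akp; exists k.
Qed.

End uniqueness.


(** A constant for [lam2] to which the finite-measure structure is attached, for use with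
    Radon-Nikodym derivatives. *)
Definition square_lebesgue {R : realType} :
  set (measurableTypeR R * measurableTypeR R) -> \bar R := (lam \x lam)%E.

HB.instance Definition _ {R : realType} := Measure.on (@square_lebesgue R).

Lemma square_lebesgue_fin {R : realType} : fin_num_fun (@square_lebesgue R).
Proof.
move=> A mA; rewrite ge0_fin_numE ?measure_ge0//.
exact: (le_lt_trans (lam2_le1 mA) (ltry 1)).
Qed.

HB.instance Definition _ {R : realType} :=
  Measure_isFinite.Build _ _ _ (@square_lebesgue R) square_lebesgue_fin.

Import HBNNSimple.

(** Moving each of the four quantities of a covariance bound by [e] changes it by at most [4 * e],
    because the factors of the product lie in the unit interval. *)
Lemma covariance_perturb {R : realType} (x x' a a' b b' y y' c e : R) :
  0 <= a' -> a' <= 1 -> 0 <= b -> b <= 1 ->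
  `|x - x'| <= e -> `|a - a'| <= e -> `|b - b'| <= e -> `|y - y'| <= e ->
  `|x' - a' * b'| <= y' + c -> `|x - a * b| <= y + c + 4 * e.
Proof.
move=> a0 a1 b0 b1 hx ha hb hy h.
have -> : x - a * b = (x' - a' * b') + (x - x') - (a - a') * b - a' * (b - b') by ring.
have n1 : `|(a - a') * b| <= e.
  by rewrite normrM (ger0_norm b0); apply: le_trans ha; rewrite ler_piMr.
have n2 : `|a' * (b - b')| <= e.
  by rewrite normrM (ger0_norm a0); apply: le_trans hb; rewrite ler_piMl.
apply: le_trans (ler_normB _ _) _.
have := ler_normB (x' - a' * b' + (x - x')) ((a - a') * b).
have := ler_normD (x' - a' * b') (x - x').
have := ler_norm (y' - y); rewrite (distrC y').
lra.
Qed.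

(** * Convergence to the invariant measure and transfer of the estimates to it *)

Section invariant_measure.
Context {R : realType}.
Local Notation mR := (measurableTypeR R).
Local Notation mRR := (measurableTypeR R * measurableTypeR R)%type.
Context {n m : nat} {F G : R -> R} {S w : 'I_n -> R -> R} {U v : 'I_m -> R -> R}.
Context {lo hi lo' hi' D K0 : R}.
Hypothesis fF : full_branch F S w lo hi D.
Hypothesis fG : full_branch G U v lo' hi' D.
Hypotheses (n0 : (0 < n)%N) (m0 : (0 < m)%N) (hi23 : hi <= 2 / 3) (hi23' : hi' <= 2 / 3).
Hypotheses (K0gt0 : 0 < K0) (DK0 : 9 * D <= K0).
Implicit Types (K L c : R) (phi psi : mRR -> R) (A B E : set mRR) (p q : mRR).

Local Notation T := (prodmap F G : mRR -> mRR).
Local Notation law := (@law R F G).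

Variable mu : probability mRR R.
Hypothesis mu_inv : forall A, measurable A -> mu (T @^-1` A) = mu A.
Hypothesis mu_ac : mu `<< (lam \x lam)%E.

Lemma mu_inv_iter k A : measurable A -> mu (iter k T @^-1` A) = mu A.
Proof.
move=> mA; elim: k => // k IH.
rewrite -IH -[RHS]mu_inv; last exact: (measurable_preimage_iter fF fG).
by congr (mu _); apply/seteqP; split=> p; rewrite /= -iterS iterSr.
Qed.

Lemma wmeas_indic A B : measurable A -> measurable B ->
  wmeas (\1_A : mRR -> R) B = law 0 (A `&` B).
Proof.
by move=> mA mB; rewrite /wmeas integral_indic.
Qed.

(** Asymptotic independence extends by linearity from sets to nonnegative simple functions, encoded
    as lists of pairs of a coefficient and a set. *)
Lemma simple_mixing (s : seq (R * set mRR)) : (forall x, x \in s -> 0 <= x.1 /\ measurable x.2) ->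
  let g p : R := \sum_(x <- s) x.1 * \1_(x.2) p in
  bounded_density g /\
  forall B, measurable B -> forall e : R, 0 < e -> exists t0, forall t, (t0 <= t)%N ->
    `|wmeas g (iter t T @^-1` B) - wmeas g setT * law t B| <= e.
Proof.
elim: s => [_ /=|[c A] s IH H].
  rewrite (_ : (fun p => _) = fun=> 0); last by apply/funext => p; rewrite big_nil.
  split; first exact: bounded_density_cst.
  move=> B mB e e0; exists 0%N => t _; rewrite !wmeas_cst// ?mul0r ?subrr ?normr0 ?ltW//.
  exact: (measurable_preimage_iter fF fG).
have [|bs ms] := IH; first by move=> x xs; apply: H; rewrite inE xs orbT.
have [/= c0 mA] := H (c, A) (mem_head _ _).
set g' := (fun p => _) in bs ms *.
have -> : (fun p => \sum_(x <- (c, A) :: s) x.1 * \1_(x.2) p) = (fun p => c * \1_A p + g' p).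
  by apply/funext => p; rewrite big_cons.
have bA : bounded_density (\1_A : mRR -> R).
  by split; [exact: measurable_indic|exists 1 => p; rewrite indicE; case: (_ \in _); rewrite ?lexx ?ler01].
have bcA : bounded_density (fun p => c * \1_A p : R).
  by apply: bounded_densityM => //; exact: bounded_density_cst.
split; first exact: bounded_densityD.
move=> B mB e e0.
have e2 : 0 < e / 2 by rewrite divr_gt0.
have [t1 h1] := ms B mB _ e2.
have e3 : 0 < e / 2 / (c + 1) by rewrite divr_gt0// ltr_wpDl.
have [_ /(_ B mB _ e3)[t2 h2]] := asymptotically_indep_measurable fF fG n0 m0 hi23 hi23' K0gt0 DK0 mA.
exists (maxn t1 t2) => t; rewrite geq_max => /andP[/h1{}h1 /h2{}h2].
have mD : measurable (iter t T @^-1` B) by exact: (measurable_preimage_iter fF fG).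
rewrite !wmeasD// !wmeasZ// !wmeas_indic//.
rewrite setIT.
have aux (a b b' x y : R) : c * a + x - (c * b + y) * b' = c * (a - b * b') + (x - y * b') by ring.
rewrite aux (splitr e); apply: le_trans (ler_normD _ _) _; apply: lerD => //.
rewrite normrM (ger0_norm c0).
have c1 : 0 < c + 1 by rewrite ltr_wpDl.
apply: le_trans (ler_wpM2l c0 h2) _.
rewrite mulrA ler_pdivrMr// [leLHS]mulrC.
by apply: ler_wpM2l; [exact: ltW|rewrite lerDl].
Qed.

(** Take a simple function below the density of [mu] with almost all its mass. Its integral over the
    preimage of [B] at time [t] is close to its mass times [law t B], by mixing, and close to
    [mu B], by invariance. Hence every absolutely continuous invariant probability is the limit of
    the push-forwards. *)
Lemma law_to_mu B : measurable B -> forall e : R, 0 < e -> exists t0, forall t, (t0 <= t)%N ->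
  `|fine (mu B) - law t B| <= e.
Proof.
move=> mB e e0.
have [f [f0 ffin intf fE]] := @radon_nikodym_sigma_finite _ _ R square_lebesgue mu mu_ac.
have mf : measurable_fun setT f by case/integrableP: intf.
pose g := nnsfun_approx measurableT mf.
have gcvg : (fun k => \int[lam2]_(p in setT) (g k p)%:E)%E @ \oo --> (\int[lam2]_(p in setT) f p)%E.
  have -> : (\int[lam2]_(p in setT) f p = \int[lam2]_(p in setT) (fun p => limn (fun k => (g k p)%:E)) p)%E.
    apply: eq_integral => p _; apply/esym/cvg_lim => //.
    exact: cvg_nnsfun_approx.
  apply: cvg_monotone_convergence => //.
  - by move=> k; exact/measurable_EFinP.
  - by move=> k p _; rewrite lee_fin.
  - by move=> p _ i j ij; rewrite lee_fin; exact/lefP/nd_nnsfun_approx.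
have e1 : (\int[lam2]_(p in setT) f p)%E = 1%E :=
  etrans (esym (fE _ measurableT)) (probability_setT mu).
rewrite e1 in gcvg.
have e3 : 0 < e / 3 by rewrite divr_gt0.
have [k hk] : exists k, `|1 - wmeas (g k) setT| <= e / 3.
  move: gcvg => /fine_cvgP[_] /cvgrPdist_le/(_ _ e3)[k _ /(_ k (leqnn k))] H; by exists k.
pose s := [seq (y, g k @^-1` [set y]) | y <- finmap.enum_fset (fset_set (range (g k)))].
have gE : (g k : mRR -> R) = (fun p => \sum_(x <- s) x.1 * \1_(x.2) p).
  apply/funext => p; rewrite big_map/= fimfunE fsbig_finite//=.
have hs x : x \in s -> 0 <= x.1 /\ measurable x.2.
  move=> /mapP[y + ->]/=; rewrite in_fset_set// inE => -[p _ <-]; split=> //.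
have [bg /(_ B mB _ e3)[t0 H]] := simple_mixing hs.
rewrite -gE in bg H.
exists t0 => t /H{}H.
set Dt := iter t T @^-1` B in H.
have mD : measurable Dt by exact: (measurable_preimage_iter fF fG).
have gf C : measurable C -> wmeas (g k) C <= fine (mu C).
  move=> mC; rewrite -lee_fin -wmeasE// fineK ?fin_num_measure// fE//.
  apply: ge0_le_integral => //.
  - by move=> p _; rewrite lee_fin.
  - by apply/measurable_EFinP; apply: measurable_funTS.
  - by apply: measurable_funTS.
  - move=> p _; rewrite /g nnsfun_approxE; exact: le_approx.
(* The bound on the complement turns the one-sided comparison of [g k] with [mu] into a two-sided
   one: on [Dt] they differ by at most the missing mass. *)
have mDC : measurable (~` Dt) by exact: measurableC.
have h1 : wmeas (g k) Dt <= fine (mu Dt) by exact: gf.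
have h2 := gf _ mDC.
have h3 : fine (mu Dt) + fine (mu (~` Dt)) = 1.
  by rewrite probability_setC// fineB ?fin_num_measure//= addrC subrK.
have h4 : wmeas (g k) Dt + wmeas (g k) (~` Dt) = wmeas (g k) setT.
  apply: EFin_inj; rewrite EFinD -!wmeasE// -(setvU Dt) setUC ge0_integral_setU//.
  - by apply/measurable_EFinP; apply: measurable_funTS.
  - by move=> p _; rewrite lee_fin.
  - by apply/disj_setPCl.
have h5 : fine (mu B) = fine (mu Dt) by rewrite /Dt mu_inv_iter.
rewrite h5.
have b0 := law_ge0 t B : 0 <= law t B.
have b1 : law t B <= 1 by exact: (law_le1 fF fG).
move: hk H; rewrite !ler_norml => /andP[k1 k2] /andP[H1 H2].
have h6 : (1 - wmeas (g k) setT) * law t B <= e / 3.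
  have h7 : 0 <= 1 - wmeas (g k) setT by rewrite -h3 -h4 subr_ge0 lerD.
  by apply: le_trans k2; rewrite ler_piMr.
have h7 : 0 <= (1 - wmeas (g k) setT) * law t B.
  by rewrite mulr_ge0// -h3 -h4 subr_ge0 lerD.
move: h1 h2 h3 h4 b0 b1 k1 k2 H1 H2 h6 h7; clear.
move: (wmeas _ _) (wmeas _ _) (wmeas _ _) (fine _) (fine _) (law _ _) => x1 x2 x3 x4 x5 b.
move=> *; apply/andP; split; lra.
Qed.

(** The bounds of [law_bounds] do not depend on the time, so they pass to the limit: [mu] has a
    density bounded above and below. *)
Lemma mu_bounds B : measurable B ->
  expR (- (K0 * 2)) * fine (lam2 B) <= fine (mu B) <= expR (K0 * 2) * fine (lam2 B).
Proof.
move=> mB.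
have H k := law_bounds fF fG n0 m0 hi23 hi23' K0gt0 DK0 k mB.
apply/andP; split; apply/ler_addgt0Pr => e e0; have [t0 /(_ _ (leqnn _))] := law_to_mu mB e0;
  have /andP[h1 h2] := H t0; rewrite ler_norml => /andP[h3 h4].
- by apply: le_trans h1 _; rewrite -lerBlDl -opprB lerNl.
- by rewrite -lerBlDl; apply: le_trans h4 => //; rewrite lerB.
Qed.

(** The gap [t] stays fixed while the starting time [k] of [decay] tends to infinity. *)
Lemma mu_decay t L psi A A' B : 0 < L -> measurable A -> measurable A' -> measurable B ->
  measurable_fun [set: mRR] psi ->
  (forall p, 0 <= psi p <= 1) -> (forall p q, `|psi p - psi q| <= L * pdist p q) ->
  (forall p, A' p -> psi p = 1) -> (forall p, ~ A p -> psi p = 0) ->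
  `|fine (mu (A `&` (iter t T @^-1` B))) - fine (mu A) * fine (mu B)| <=
    fine (mu (A `\` A')) + (1 + L / K0) * mixrate (K0 + K0) ^+ t.
Proof.
move=> L0 mA mA' mB mpsi psi01 Lpsi psi1 psi0.
have H k := @decay _ _ _ _ _ _ _ _ _ _ _ _ _ _ _ fF fG n0 m0 hi23 hi23' K0gt0 DK0 k t L
  psi A A' B L0 mA mA' mB mpsi psi01 Lpsi psi1 psi0.
have mD : measurable (iter t T @^-1` B) by exact: (measurable_preimage_iter fF fG).
apply/ler_addgt0Pr => e e0.
have e4 : 0 < e / 4 by rewrite divr_gt0.
have [t1 h1] := law_to_mu (measurableI _ _ mA mD) e4.
have [t2 h2] := law_to_mu mA e4.
have [t3 h3] := law_to_mu mB e4.
have [t4 h4] := law_to_mu (measurableD mA mA') e4.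
pose k := (t1 + t2 + t3 + t4)%N.
have {}h1 := h1 k _; have {}h2 := h2 k _; have {}h3 := h3 (k + t)%N _; have {}h4 := h4 k _.
have {}h1 := h1 ltac:(by rewrite /k -!addnA leq_addr).
have {}h2 := h2 ltac:(by rewrite /k (addnC t1) -!addnA leq_addr).
have {}h3 := h3 ltac:(by rewrite /k (addnC _ t3) -!addnA leq_addr).
have {}h4 := h4 ltac:(by rewrite /k leq_addl).
have {}H := H k.
have a0 := law_ge0 k A : 0 <= law k A.
have a1 : law k A <= 1 by exact: (law_le1 fF fG).
have b0 : 0 <= fine (mu B) by exact: fine_ge0.
have b1 : fine (mu B) <= 1.
  by rewrite -[leRHS]/(fine 1%:E) -(probability_setT mu) fine_mu_le.
have e4E : e = 4 * (e / 4) by rewrite mulrC divfK.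
by rewrite [in leRHS]e4E; exact: (covariance_perturb a0 a1 b0 b1 h1 h2 h3 h4 H).
Qed.

End invariant_measure.

(** * Cylinders and close returns *)


Section words.
Context {R : realType} {n : nat} {F : R -> R} {S w : 'I_n -> R -> R} {lo hi D : R}.
Hypothesis fF : full_branch F S w lo hi D.
Implicit Types (u : seq 'I_n) (x y z : R).

(** The inverse branch of the iterate [F^(size u)] with itinerary [u]: the head letter, applied
    last, is the branch visited first. *)
Definition wordmap (S : 'I_n -> R -> R) u z := foldr (fun i y => S i y) z u.
Local Notation Sw := (wordmap S).

Lemma wordmap_oo u z : 0 < z < 1 -> 0 < Sw u z < 1.
Proof. by move=> z01; elim: u => //= i u; exact: (fb_S01o fF). Qed.

Lemma wordmap_cc u z : 0 <= z <= 1 -> 0 <= Sw u z <= 1.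
Proof. by move=> z01; case: u => //= i u; exact: (fb_S01 fF). Qed.

Lemma iter_wordmap u z : 0 < z < 1 -> iter (size u) F (Sw u z) = z.
Proof.
move=> z01; elim: u => // i u IH.
by rewrite [size _]/= iterSr [Sw _ _]/= (fb_FS fF)// wordmap_oo.
Qed.

Lemma wordmap_inj u u' z z' : size u = size u' -> 0 < z < 1 -> 0 < z' < 1 ->
  Sw u z = Sw u' z' -> u = u'.
Proof.
elim: u u' => [|i u IH] [|i' u']//= [su] z01 z01' E.
have y01 := wordmap_oo u z01; have y01' := wordmap_oo u' z01'.
have ii := fb_disj fF y01 y01' E; rewrite -ii in E *.
congr (_ :: _); apply: IH => //.
by rewrite -(fb_FS fF i y01) E (fb_FS fF).
Qed.

Lemma wordmap_cover j : exists s : seq R, forall x, 0 <= x <= 1 ->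
  x \in s \/ exists u z, [/\ size u = j, 0 < z < 1 & x = Sw u z].
Proof.
have [s0 h0] := fb_cover fF.
elim: j => [|j [s IH]].
  (* The empty word already misses 0 and 1, as cylinders are images of the open interval. *)
  exists [:: 0; 1] => x /andP[x0 x1]; rewrite !inE.
  have [->|xn0] := eqVneq x 0; first by left.
  have [->|xn1] := eqVneq x 1; first by left; rewrite orbT.
  by right; exists [::], x; split=> //; rewrite !lt_neqAle x0 x1 xn1 eq_sym xn0.
exists (s0 ++ [seq S i y | i <- enum 'I_n, y <- s]) => x x01.
have [xs|[i [y [y01 ->]]]] := h0 x x01; first by left; rewrite mem_cat xs.
have [|ys|[u [z [su z01 ->]]]] := IH y; first by case/andP: y01 => /ltW-> /ltW->.
  by left; rewrite mem_cat; apply/orP; right; apply/allpairsP; exists (i, y); rewrite mem_enum.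
by right; exists (i :: u), z; split=> //=; rewrite su.
Qed.

Lemma branch_bounds i : exists2 s : R, s = 1 \/ s = -1 &
  forall z z', 0 <= z -> z <= z' -> z' <= 1 ->
    lo * (z' - z) <= s * (S i z' - S i z) <= hi * (z' - z).
Proof.
have [s s1 H] := fb_mvt fF i; exists s => // z z' z0 zz' z1.
have [y _ ->] := H z z' z0 zz' z1; have /and3P[_ a b] := fb_w fF i y.
by apply/andP; split; apply: ler_wpM2r => //; rewrite subr_ge0.
Qed.

Hypothesis lo0 : 0 < lo.
Hypothesis hi0 : 0 < hi.

Lemma wordmap_bounds u : exists2 s : R, s = 1 \/ s = -1 &
  forall z z', 0 <= z -> z <= z' -> z' <= 1 ->
    lo ^+ size u * (z' - z) <= s * (Sw u z' - Sw u z) <= hi ^+ size u * (z' - z).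
Proof.
elim: u => [|i u [s s1 H]].
  by exists 1; [left|move=> z z' _ _ _; rewrite !expr0 !mul1r !lexx].
have [t t1 Hi] := branch_bounds i.
exists (t * s).
  by case: s1 => ->; case: t1 => ->; rewrite ?mulr1 ?mulrN1 ?opprK; [left|right|right|left].
move=> z z' z0 zz' z1; rewrite [Sw _ z]/= [Sw _ z']/= !exprS.
have /andP[H1 H2] := H z z' z0 zz' z1.
have zc : 0 <= z <= 1 by rewrite z0 (le_trans zz').
have zc' : 0 <= z' <= 1 by rewrite z1 (le_trans z0).
have /andP[a0 a1] := wordmap_cc u zc; have /andP[b0 b1] := wordmap_cc u zc'.
have l0 : 0 <= lo ^+ size u * (z' - z) by rewrite mulr_ge0 ?subr_ge0// exprn_ge0// ltW.
have g : lo * (s * (Sw u z' - Sw u z)) <= t * s * (S i (Sw u z') - S i (Sw u z)) <= hi * (s * (Sw u z' - Sw u z)).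
  case: s1 H1 H2 => ->; rewrite ?mul1r ?mulN1r ?opprB => H1 H2.
    by rewrite mulr1; apply: Hi => //; rewrite -subr_ge0; exact: le_trans l0 H1.
  rewrite mulrN1 mulNr -mulrN opprB; apply: Hi => //.
  by rewrite -subr_ge0; exact: le_trans l0 H1.
case/andP: g => g1 g2; apply/andP; split.
  by apply: le_trans g1; rewrite -mulrA; apply: ler_wpM2l => //; exact: ltW.
by apply: le_trans g2 _; rewrite -mulrA; apply: ler_wpM2l => //; exact: ltW.
Qed.

Lemma wordmap_abs_bounds u z z' : 0 <= z <= 1 -> 0 <= z' <= 1 ->
  lo ^+ size u * `|z - z'| <= `|Sw u z - Sw u z'| <= hi ^+ size u * `|z - z'|.
Proof.
have [s s1 H] := wordmap_bounds u => z01 z01'.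
have W : forall z z', 0 <= z <= 1 -> 0 <= z' <= 1 -> z <= z' ->
  lo ^+ size u * `|z - z'| <= `|Sw u z - Sw u z'| <= hi ^+ size u * `|z - z'|.
  move=> {z01 z01'}z {}z' /andP[z0 _] /andP[_ z1] zz'.
  have /andP[h1 h2] := H z z' z0 zz' z1.
  have E : s * (Sw u z' - Sw u z) = `|Sw u z - Sw u z'|.
    have : 0 <= s * (Sw u z' - Sw u z).
      by apply: le_trans h1; rewrite mulr_ge0 ?subr_ge0// exprn_ge0// ltW.
    move=> /ger0_norm <-; rewrite normrM distrC.
    by case: s1 => ->; rewrite ?normrN normr1 mul1r.
  by rewrite distrC ger0_norm ?subr_ge0// -E h1 h2.
have [zz'|zz'] := leP z z'; first exact: W.
by rewrite distrC (distrC (Sw u z)); apply: W => //; exact: ltW.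
Qed.

Lemma branch_lipschitz i z z' : `|S i z - S i z'| <= hi * `|z - z'|.
Proof.
have := fb_lip i z z' fF.
rewrite {1}/cdist !(@clamp_id _ (S i _)) ?(fb_S01 fF)// => /le_trans; apply.
by apply: ler_wpM2l; [exact: ltW|exact: clamp_lip].
Qed.

Lemma wordmap_continuous u : continuous (Sw u).
Proof.
have H z z' : `|Sw u z - Sw u z'| <= hi ^+ size u * `|z - z'|.
  elim: u => [|i u IH]; first by rewrite expr0 mul1r.
  rewrite [Sw _ z]/= [Sw _ z']/= exprS -mulrA; apply: le_trans (branch_lipschitz _ _ _) _.
  by apply: ler_wpM2l; [exact: ltW|].
move=> x; apply/cvgrPdist_le => e e0.
have c0 : 0 < hi ^+ size u by rewrite exprn_gt0.
have d0 : 0 < e / hi ^+ size u by rewrite divr_gt0.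
near=> y.
apply: le_trans (H _ _) _; rewrite mulrC -ler_pdivlMr//.
Unshelve. all: by end_near. Qed.

Lemma wordmap_ivt u x : (Sw u 0 < x < Sw u 1) || (Sw u 1 < x < Sw u 0) ->
  exists2 z, 0 < z < 1 & Sw u z = x.
Proof.
have cS : {within `[0, 1], continuous (Sw u)}.
  by apply: continuous_subspaceT; exact: wordmap_continuous.
move=> H.
have [|z /itvP z01 E] := @IVT R (Sw u) 0 1 x ler01 cS.
  rewrite ge_min le_max; move: H => /orP[/andP[/ltW-> /ltW->]|/andP[/ltW-> /ltW->]];
  by rewrite ?orbT.
exists z => //; rewrite !lt_neqAle !z01 !andbT; apply/andP; split; apply/eqP => z0.
  by move: H; rewrite -E -z0 ltxx andbF.
by move: H; rewrite -E z0 ltxx andbF.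
Qed.

(** The cylinder of [u] has length at least [lo ^+ size u], so the shorter interval from [p] to [q]
    cannot contain it; if they meet, an endpoint of the interval lies in the cylinder. *)
Lemma cylinder_endpoint u z (p q : R) : 0 < z < 1 -> p < Sw u z < q -> q - p < lo ^+ size u ->
  (exists2 z', 0 < z' < 1 & Sw u z' = p) \/ (exists2 z', 0 < z' < 1 & Sw u z' = q).
Proof.
move=> z01 /andP[pz zq] pq.
have [s s1 H] := wordmap_bounds u.
have /andP[z0 z1] := z01.
have l0 : 0 < lo ^+ size u by rewrite exprn_gt0.
have /andP[a _] := H 0 z (lexx _) (ltW z0) (ltW z1).
have /andP[b _] := H z 1 (ltW z0) (ltW z1) (lexx _).
have {}a : 0 < s * (Sw u z - Sw u 0) by apply: lt_le_trans a; rewrite mulr_gt0// subr_gt0.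
have {}b : 0 < s * (Sw u 1 - Sw u z) by apply: lt_le_trans b; rewrite mulr_gt0// subr_gt0.
have /andP[c _] := H 0 1 (lexx _) ler01 (lexx _).
rewrite subr0 mulr1 in c.
have ivtp x := @wordmap_ivt u x.
case: s1 H a b c => -> _; rewrite ?mul1r ?mulN1r ?opprB !subr_gt0 => a b c.
- have [px|px] := ltP (Sw u 0) p; first by left; apply: ivtp; rewrite px (lt_trans pz b).
  have [qx|qx] := ltP q (Sw u 1); first by right; apply: ivtp; rewrite qx (lt_trans a zq).
  have := lt_le_trans pq c; lra.
- have [px|px] := ltP (Sw u 1) p.
    by left; apply: ivtp; rewrite px (lt_trans pz a) orbT.
  have [qx|qx] := ltP q (Sw u 0).
    by right; apply: ivtp; rewrite qx (lt_trans b zq) orbT.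
  have := lt_le_trans pq c; lra.
Qed.

Lemma branch_mvt i z z' : 0 <= z <= 1 -> 0 <= z' <= 1 ->
  exists y, (z <= y <= z') || (z' <= y <= z) /\ `|S i z - S i z'| = w i y * `|z - z'|.
Proof.
have [s s1 H] := fb_mvt fF i.
have W : forall z z', 0 <= z <= 1 -> 0 <= z' <= 1 -> z <= z' ->
  exists2 y, (z <= y <= z') & `|S i z - S i z'| = w i y * `|z - z'|.
  move=> {}z {}z' /andP[z0 _] /andP[_ z1] zz'.
  have [y yz E] := H z z' z0 zz' z1; exists y => //.
  have : 0 <= s * (S i z' - S i z) by rewrite E mulr_ge0 ?subr_ge0// ltW// (fb_w_ge0 _ _ fF).
  move=> /ger0_norm; rewrite normrM [_ * _](_ : _ = `|S i z' - S i z|); last first.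
    by case: s1 => ->; rewrite ?normrN normr1 mul1r.
  by rewrite distrC => ->; rewrite E distrC (ger0_norm (_ : 0 <= z' - z))// subr_ge0.
move=> z01 z01'; have [zz'|zz'] := leP z z'.
  by have [y yz E] := W z z' z01 z01' zz'; exists y; rewrite yz.
have [y yz E] := W z' z z01' z01 (ltW zz'); exists y; rewrite yz orbT; split => //.
by rewrite distrC E distrC.
Qed.

Hypothesis D0 : 0 <= D.
Hypothesis hi23 : hi <= 2 / 3.

(** Bounded distortion: the letter placed in front of a word of length [k] is evaluated at points at
    distance at most [(2 / 3) ^+ k], so it costs a factor [expR (D * (2 / 3) ^+ k)]. The exponent is
    the partial sum of this geometric series. *)
Lemma wordmap_distortion u x x' y y' :
  0 <= x <= 1 -> 0 <= x' <= 1 -> 0 <= y <= 1 -> 0 <= y' <= 1 ->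
  `|Sw u x - Sw u x'| * `|y - y'| <=
    expR (3 * D * (1 - (2 / 3) ^+ size u)) * (`|Sw u y - Sw u y'| * `|x - x'|).
Proof.
move=> x01 x01' y01 y01'; elim: u => [|i u IH].
  by rewrite expr0 subrr mulr0 expR0 mul1r mulrC.
rewrite [size _]/= ![Sw (i :: u) _]/=.
set X := Sw u x; set X' := Sw u x'; set Y := Sw u y; set Y' := Sw u y'.
set k := size u.
have X01 : 0 <= X <= 1 := wordmap_cc u x01. have X01' : 0 <= X' <= 1 := wordmap_cc u x01'.
have Y01 : 0 <= Y <= 1 := wordmap_cc u y01. have Y01' : 0 <= Y' <= 1 := wordmap_cc u y01'.
have [s [sX ->]] := branch_mvt i X01 X01'.
have [t [tY ->]] := branch_mvt i Y01 Y01'.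
have diam a b : 0 <= a <= 1 -> 0 <= b <= 1 -> `|Sw u a - Sw u b| <= (2 / 3) ^+ k.
  move=> a01 b01; have /andP[_ h] := wordmap_abs_bounds u a01 b01.
  apply: le_trans h _; rewrite -[leRHS]mulr1; apply: ler_pM => //.
  - by rewrite exprn_ge0// ltW.
  - by apply: lerXn2r; rewrite ?nnegrE ?divr_ge0// ltW.
  - by rewrite ler_norml; case/andP: a01 => ? ?; case/andP: b01 => ? ?; apply/andP; split; lra.
(* Both points lie between values of [wordmap S u], hence within the diameter of its image. *)
have st : `|s - t| <= (2 / 3) ^+ k.
  have := diam _ _ x01 y01; have := diam _ _ x01 y01'; have := diam _ _ x01' y01; have := diam _ _ x01' y01'.
  rewrite -/X -/X' -/Y -/Y'; clear -sX tY; set d := _ ^+ _; clearbody d X X' Y Y'.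
  rewrite !ler_norml => /andP[? ?] /andP[? ?] /andP[? ?] /andP[? ?].
  by case/orP: sX => /andP[? ?]; case/orP: tY => /andP[? ?]; apply/andP; split; lra.
have wst : w i s <= expR (D * (2 / 3) ^+ k) * w i t.
  apply: le_trans (fb_wD fF i s t) _; apply: ler_wpM2r; first by rewrite ltW// (fb_w_ge0 _ _ fF).
  rewrite ler_expR; apply: ler_wpM2l => //; apply: le_trans st; exact: clamp_lip.
rewrite -/X -/X' -/Y -/Y' -/k in IH.
have -> : 3 * D * (1 - (2 / 3) ^+ k.+1) = D * (2 / 3) ^+ k + 3 * D * (1 - (2 / 3) ^+ k).
  by rewrite exprS; field.
rewrite expRD -[leLHS]mulrA.
rewrite [leRHS](_ : _ = expR (D * (2 / 3) ^+ k) * w i t * (expR (3 * D * (1 - (2 / 3) ^+ k)) * (`|Y - Y'| * `|x - x'|))); last by ring.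
apply: ler_pM => //; first by rewrite ltW// (fb_w_ge0 _ _ fF).
Qed.

(** Distortion compared with the full cylinder: the local contraction is at most a constant times
    the length of the cylinder. *)
Lemma wordmap_length u z z' : 0 <= z <= 1 -> 0 <= z' <= 1 ->
  `|Sw u z - Sw u z'| <= expR (3 * D) * `|Sw u 1 - Sw u 0| * `|z - z'|.
Proof.
move=> z01 z01'.
have i0 : 0 <= (0 : R) <= 1 by rewrite lexx ler01.
have i1 : 0 <= (1 : R) <= 1 by rewrite lexx ler01.
have := wordmap_distortion u z01 z01' i1 i0.
rewrite subr0 normr1 mulr1 => /le_trans; apply; rewrite -[leRHS]mulrA.
apply: ler_wpM2r; first exact: mulr_ge0.
rewrite ler_expR -[leRHS]mulr1; apply: ler_wpM2l; first by rewrite mulr_ge0.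
by rewrite gerBl exprn_ge0// divr_ge0.
Qed.

End words.


Section short_returns.
Context {R : realType} {n m : nat} {F G : R -> R} {S w : 'I_n -> R -> R} {U v : 'I_m -> R -> R}.
Context {lo hi lo' hi' D : R}.
Hypothesis fF : full_branch F S w lo hi D.
Hypothesis fG : full_branch G U v lo' hi' D.
Hypotheses (lo0 : 0 < lo) (hi0 : 0 < hi) (lo0' : 0 < lo') (hi0' : 0 < hi').
Hypotheses (D0 : 0 <= D) (hi23 : hi <= 2 / 3) (fast : hi < lo').
Local Notation leb := (@lebesgue_measure R).
Local Notation mR := (measurableTypeR R).

Local Notation Sw := (wordmap S).
Local Notation Uw := (wordmap U).

Definition cylinder (u : seq 'I_n) : set mR :=
  `]Num.min (Sw u 0) (Sw u 1), Num.max (Sw u 0) (Sw u 1)[%classic.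

Lemma cylinderP u x : cylinder u x <-> exists2 z, 0 < z < 1 & Sw u z = x.
Proof.
rewrite /cylinder/= in_itv/=; split.
  move=> H; apply: (wordmap_ivt fF hi0); move: H.
  by case: (leP (Sw u 0) (Sw u 1)) => _ ->; rewrite ?orbT.
move=> [z /andP[z0 z1] <-].
have [s s1 H] := wordmap_bounds fF lo0 hi0 u.
have /andP[a _] := H 0 z (lexx _) (ltW z0) (ltW z1).
have /andP[b _] := H z 1 (ltW z0) (ltW z1) (lexx _).
have l0 : 0 < lo ^+ size u by rewrite exprn_gt0.
have {}a : 0 < s * (Sw u z - Sw u 0) by apply: lt_le_trans a; rewrite mulr_gt0// subr_gt0.
have {}b : 0 < s * (Sw u 1 - Sw u z) by apply: lt_le_trans b; rewrite mulr_gt0// subr_gt0.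
case: s1 a b => ->; rewrite ?mul1r ?mulN1r ?opprB !subr_gt0 => a b.
  by rewrite gt_min a lt_max b orbT.
by rewrite gt_min b orbT lt_max a.
Qed.

Lemma measurable_cylinder u : measurable (cylinder u).
Proof. exact: measurable_itv. Qed.

Lemma lebesgue_cylinder u : leb (cylinder u) = (`|Sw u 1 - Sw u 0|)%:E.
Proof.
rewrite /cylinder lebesgue_measure_itv/= lte_fin.
case: (ltgtP (Sw u 0) (Sw u 1)) => [h|h|->]; last by rewrite ltxx subrr normr0.
- by rewrite h ger0_norm ?subr_ge0 ?ltW.
- by rewrite h distrC ger0_norm ?subr_ge0 ?ltW.
Qed.

Lemma cylinder_sum j : (\sum_(u \in [set: j.-tuple 'I_n]) leb (cylinder u) <= 1)%E.
Proof.
rewrite -(@measure_fin_bigcup _ _ _ leb)//; last 3 first.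
- exact: finite_finset.
- move=> u u' _ _ [x [/cylinderP[z z01 <-] /cylinderP[z' z01' E]]].
  by apply: val_inj; apply/esym; apply: (wordmap_inj fF _ z01' z01 E); rewrite !size_tuple.
- by move=> u _; exact: measurable_cylinder.
have -> : 1%E = leb `[0%R, 1%R]%classic by rewrite lebesgue_measure_itv/= lte_fin ltr01 oppr0 adde0.
apply: le_measure; rewrite ?inE//.
  by apply: fin_bigcup_measurable => [|u _]; [exact: finite_finset|exact: measurable_cylinder].
move=> x [u _ /cylinderP[z z01 <-]]; rewrite /= in_itv/=.
by apply: (wordmap_cc fF); case/andP: z01 => /ltW-> /ltW->.
Qed.

Section returns.
Variables (j : nat) (j0 : (0 < j)%N) (c r : R) (r0 : 0 < r).

Let q := hi / lo'.
(** Bound for the spread of close returns inside one product of cylinders; it is proportional to the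
    length of the cylinder of the faster map [F]. *)
Let d (u : seq 'I_n) := 2 * r * expR (3 * D) * `|Sw u 1 - Sw u 0| / (1 - q).

(** The trace on the line [x - y = c], parametrised by [y], of the points of the square whose image
    under the [j]-th iterate is in the tube of radius [r]. *)
Definition close_return : set R := [set y |
  [/\ 0 <= y <= 1, 0 <= y + c <= 1 & `|iter j F (y + c) - iter j G y| < r]].

Lemma fast_ratio_lt1 : 0 < hi / lo' < 1.
Proof. by rewrite divr_gt0//= ltr_pdivrMr// mul1r. Qed.

(* On a common cylinder F^j spreads distances by at least q^-j more than G^j. *)
Lemma close_return_dist u u' y y' z z' t t' : size u = j -> size u' = j ->
  close_return y -> close_return y' -> 0 < z < 1 -> 0 < z' < 1 -> 0 < t < 1 -> 0 < t' < 1 ->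
  y + c = Sw u z -> y' + c = Sw u z' -> y = Uw u' t -> y' = Uw u' t' ->
  `|y - y'| <= d u.
Proof.
move=> su su' [_ _ hy] [_ _ hy'] z01 z01' t01 t01' yz yz' yt yt'.
have oc (x : R) : 0 < x < 1 -> 0 <= x <= 1 by case/andP => /ltW-> /ltW->.
have yy : y - y' = Sw u z - Sw u z' by rewrite -yz -yz' opprD addrACA subrr addr0.
rewrite yz {1}yt -su (iter_wordmap fF)// su -su' (iter_wordmap fG)// in hy.
rewrite yz' {1}yt' -su (iter_wordmap fF)// su -su' (iter_wordmap fG)// in hy'.
have /andP[_ h1] := wordmap_abs_bounds fF lo0 hi0 u (oc _ z01) (oc _ z01').
have /andP[h2 _] := wordmap_abs_bounds fG lo0' hi0' u' (oc _ t01) (oc _ t01').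
rewrite -yt -yt' yy su' in h2; rewrite su in h1.
have /andP[q0 q1] := fast_ratio_lt1; rewrite -/q in q0 q1.
have tz : `|t - t'| <= q * `|z - z'|.
  have lj : 0 < lo' ^+ j by rewrite exprn_gt0.
  have h3 : `|t - t'| <= q ^+ j * `|z - z'|.
    by rewrite /q expr_div_n mulrAC ler_pdivlMr// mulrC (le_trans h2).
  apply: le_trans h3 _; apply: ler_wpM2r => //.
  by rewrite -[leRHS]expr1; apply: ler_wiXn2l => //; exact: ltW.
(* Both [z - t] and [z' - t'] have absolute value below [r], while [t - t'] is at most [q] times
   [z - z'] in absolute value. *)
have zz : (1 - q) * `|z - z'| <= 2 * r.
  have := ler_normD (z - t) (t - z' - (t - t')); have := ler_normB (z' - t') (z - t).
  have -> : z' - t' - (z - t) = - ((z - z') - (t - t')) by ring.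
  rewrite normrN => h4 _; have := lerB_dist (z - z') (t - t').
  lra.
rewrite yy; apply: le_trans (wordmap_length fF lo0 hi0 D0 hi23 u (oc _ z01) (oc _ z01')) _.
have q1' : 0 < 1 - q by rewrite subr_gt0.
rewrite /d ler_pdivlMr//.
rewrite [leLHS](_ : _ = expR (3 * D) * `|Sw u 1 - Sw u 0| * ((1 - q) * `|z - z'|)); last by ring.
rewrite (_ : 2 * r * _ * _ = expR (3 * D) * `|Sw u 1 - Sw u 0| * (2 * r)); last by ring.
by apply: ler_wpM2l => //; rewrite mulr_ge0// expR_ge0.
Qed.

(** As [hi ^+ j < lo' ^+ j], a fast cylinder is shorter than any slow one of the same rank. A slow
    cylinder meeting its translate therefore contains one of its two endpoints. This leaves at most
    two products of cylinders, hence two clusters of close returns. *)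
Lemma close_return_cylinder u : size u = j -> exists y0 y1, forall y, close_return y ->
  (exists2 z, 0 < z < 1 & Sw u z = y + c) ->
  (exists u' t, [/\ size u' = j, 0 < t < 1 & y = Uw u' t]) ->
  `|y - y0| <= d u \/ `|y - y1| <= d u.
Proof.
move=> su.
pose Q (e : R) := fun y => [/\ close_return y, exists2 z, 0 < z < 1 & Sw u z = y + c &
  exists u' t t', [/\ size u' = j, 0 < t < 1, 0 < t' < 1, Uw u' t = y & Uw u' t' = e]].
(* Slow cylinders of one rank are disjoint, so all close returns whose slow cylinder contains [e]
   share it, and any of them serves as centre. If there is none, 0 is a vacuous choice. *)
have pick e : exists y0, forall y, Q e y -> `|y - y0| <= d u.
  have [[y0 [cy0 [z0 z01 E0] [u0 [t0 [s0 [su0 t01 s01 Et0 Es0]]]]]]|nQ] := pselect (exists y, Q e y); last first.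
    by exists 0 => y Qy; exfalso; apply: nQ; exists y.
  exists y0 => y [cy [z z01' E] [u' [t [t' [su' t01' t01'' Et Et']]]]].
  have uu : u' = u0 by apply: (wordmap_inj fG _ t01'' s01); rewrite ?Et' ?Es0// su' su0.
  rewrite uu in Et.
  exact: (close_return_dist su su0 cy cy0 z01' z01 t01' t01 (esym E) (esym E0) (esym Et) (esym Et0)).
have [y0 H0] := pick (Num.min (Sw u 0) (Sw u 1) - c).
have [y1 H1] := pick (Num.max (Sw u 0) (Sw u 1) - c).
exists y0, y1 => y cy hz [u' [t [su' t01 Et]]].
have /cylinderP : exists2 z, 0 < z < 1 & Sw u z = y + c by [].
rewrite /cylinder/= in_itv/= -ltrBlDr -ltrBrDr opprK -ltrBrDr -ltrBlDr Et => H; rewrite -Et.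
have len : Num.max (Sw u 0) (Sw u 1) - c - (Num.min (Sw u 0) (Sw u 1) - c) < lo' ^+ size u'.
  rewrite opprB addrA subrK.
  have i0 : 0 <= (0 : R) <= 1 by rewrite lexx ler01.
  have i1 : 0 <= (1 : R) <= 1 by rewrite lexx ler01.
  have /andP[_] := wordmap_abs_bounds fF lo0 hi0 u i0 i1.
  rewrite sub0r normrN normr1 mulr1 su su' => h.
  have h' : hi ^+ j < lo' ^+ j by rewrite ltrXn2r -?lt0n// ltW.
  apply: le_lt_trans h'; apply: le_trans h.
  have := ler_norm (Sw u 0 - Sw u 1); have := ler_norm (Sw u 1 - Sw u 0); rewrite (distrC (Sw u 1)).
  by case: (leP (Sw u 0) (Sw u 1)).
have [[t' t01' E]|[t' t01' E]] := cylinder_endpoint fG lo0' hi0' t01 H len.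
  by left; apply: H0; split; [exact: cy|exact: hz|exists u', t, t'; split].
by right; apply: H1; split; [exact: cy|exact: hz|exists u', t, t'; split].
Qed.

(** Each fast word contributes two intervals of length [2 * d u]. Since [d u] is proportional to the
    length of its cylinder and these lengths sum to at most 1, the bound depends neither on [j] nor
    on [c]. *)
Lemma lebesgue_close_return : measurable (close_return : set mR) ->
  (leb close_return <= (8 * expR (3 * D) / (1 - q) * r)%:E)%E.
Proof.
move=> mE.
have [sF hF] := wordmap_cover fF j; have [sG hG] := wordmap_cover fG j.
(* The finitely many points of the line missed by a cylinder of one of the two maps. *)
pose exc : set mR := [set` sG ++ [seq x - c | x <- sF]].
have fexc : finite_set exc by exact: finite_seq.
have cexc : countable exc by exact: finite_set_countable.
have mexc : measurable exc by exact: countable_measurable.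
have exc0 : leb exc = 0%E by exact: countable_lebesgue_measure0.
have /choice[y0 /choice[y1 H]] : forall u : j.-tuple 'I_n, exists y0 y1, forall y, close_return y ->
  (exists2 z, 0 < z < 1 & Sw u z = y + c) ->
  (exists u' t, [/\ size u' = j, 0 < t < 1 & y = Uw u' t]) ->
  `|y - y0| <= d u \/ `|y - y1| <= d u.
  by move=> u; apply: close_return_cylinder; rewrite size_tuple.
have /andP[q0 q1] := fast_ratio_lt1; rewrite -/q in q0 q1.
have q1' : 0 < 1 - q by rewrite subr_gt0.
have d0 u : 0 <= d u by rewrite /d divr_ge0 ?(ltW q1')// !mulr_ge0 ?expR_ge0// ltW.
pose B (u : j.-tuple 'I_n) : set mR :=
  `[y0 u - d u, y0 u + d u]%classic `|` `[y1 u - d u, y1 u + d u]%classic.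
have mB u : measurable (B u) by apply: measurableU; exact: measurable_itv.
have lB u : (leb (B u) <= (4 * expR (3 * D) * 2 / (1 - q) * r)%:E * leb (cylinder u))%E.
  rewrite lebesgue_cylinder.
  have litv (y : R) : leb `[y - d u, y + d u]%classic = (d u + d u)%:E.
    rewrite lebesgue_measure_itv/= lte_fin.
    case: ltP => h; last by congr (_%:E); have := d0 u; lra.
    by rewrite -EFinB; congr (_%:E); ring.
  apply: (@le_trans _ _ ((d u + d u)%:E + (d u + d u)%:E)%E).
    have := measureU2 leb (measurable_itv `[y0 u - d u, y0 u + d u]) (measurable_itv `[y1 u - d u, y1 u + d u]).
    by rewrite [X in (_ <= X + _)%E]litv [X in (_ <= _ + X)%E]litv.
  rewrite -EFinD -EFinM lee_fin le_eqVlt; apply/orP; left; apply/eqP.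
  by rewrite /d; field; rewrite gt_eqF.
have EB : close_return `<=` exc `|` \bigcup_(u in [set: j.-tuple 'I_n]) B u.
  move=> y cy; have [y01 yc01 _] := cy.
  have [ys|hu'] := hG y y01; first by left; rewrite /exc/= mem_cat ys.
  have [ys|[u [z [su z01 E]]]] := hF _ yc01.
    by left; rewrite /exc/= mem_cat; apply/orP; right; apply/mapP; exists (y + c); rewrite ?addrK.
  right; have su' : size u == j by rewrite su.
  exists (Tuple su') => //.
  have := H (Tuple su') y cy; case=> //; first by exists z.
    by rewrite ler_distl => h; left; rewrite /= in_itv/=.
  by rewrite ler_distl => h; right; rewrite /= in_itv/=.
have mU : measurable (\bigcup_(u in [set: j.-tuple 'I_n]) B u) by apply: fin_bigcup_measurable => //; exact: finite_finset.
apply: (@le_trans _ _ (leb (exc `|` \bigcup_(u in [set: j.-tuple 'I_n]) B u))).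
  by apply: le_measure; rewrite ?inE//; exact: measurableU.
apply: le_trans (measureU2 _ mexc mU) _; rewrite [X in (X + _)%E]exc0 add0e.
have sub : (leb (\bigcup_(u in [set: j.-tuple 'I_n]) B u) <=
    \sum_(u \in [set: j.-tuple 'I_n]) leb (B u))%E.
  by apply: content_sub_fsum => //; exact: finite_finset.
apply: (le_trans sub).
set C := 8 * expR (3 * D) / (1 - q) * r.
have C0 : 0 <= C by rewrite mulr_ge0 ?divr_ge0 ?mulr_ge0 ?expR_ge0 ?ltW.
apply: (@le_trans _ _ (\sum_(u \in [set: j.-tuple 'I_n]) C%:E * leb (cylinder u))%E).
  apply: lee_fsum => [|u _]; [exact: finite_finset|apply: le_trans (lB u) _].
  by rewrite (_ : 4 * _ * 2 / _ * r = C)//; rewrite /C; field; rewrite gt_eqF.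
rewrite -ge0_mule_fsumr; last by move=> u; exact: measure_ge0.
rewrite -[leRHS]mule1; apply: lee_wpmul2l; first by rewrite lee_fin.
exact: cylinder_sum.
Qed.

End returns.
End short_returns.

(** * Returns of a tube around the diagonal *)


Section shear.
Context {R : realType}.
Local Notation leb := (@lebesgue_measure R).
Local Notation mR := (measurableTypeR R).
Local Notation mRR := (measurableTypeR R * measurableTypeR R)%type.

Lemma measurable_translate (c : R) : measurable_fun [set: mR] (fun x : mR => x + c : mR).
Proof. exact: measurable_funD. Qed.

Lemma lebesgue_translate (c : R) (A : set mR) : measurable A ->
  pushforward leb (fun x : mR => x + c : mR) A = leb A.
Proof.
move=> mA.
have mt := measurable_translate c.
apply/esym; apply: (@lebesgue_measure_unique R (pushforward leb (fun x : mR => x + c : mR))) => //.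
move=> _ [[a b] _ <-]; rewrite /pushforward/=.
rewrite [RHS](_ : _ = leb `]a - c, b - c]%classic); last first.
  by congr (leb _); apply/seteqP; split => x /=; rewrite !in_itv/= ltrBlDr lerBrDr.
rewrite !lebesgue_measure_itv/= !lte_fin ltrD2r; case: ifP => // _.
by rewrite -!EFinB; congr (_%:E); ring.
Qed.

Lemma ge0_integral_translate (c : R) (f : mR -> \bar R) : measurable_fun [set: mR] f ->
  (forall x, 0 <= f x)%E -> (\int[leb]_x f x = \int[leb]_x f (x + c)%R)%E.
Proof.
move=> mf f0.
rewrite [RHS](_ : _ = \int[leb]_(x in (fun x : mR => (x + c)%R : mR) @^-1` setT) (f \o (fun x : mR => (x + c)%R : mR)) x)%E; last by rewrite preimage_setT.
rewrite -(ge0_integral_pushforward (measurable_translate c))//.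
by apply: eq_measure_integral => [|mt A mA _]; [exact: measurable_translate|exact/esym/lebesgue_translate].
Qed.

(** The substitution [x = y + u] slices the plane along lines parallel to the diagonal. *)
Lemma ge0_integral_shear (f : mRR -> \bar R) : measurable_fun [set: mRR] f ->
  (forall p, 0 <= f p)%E ->
  (\int[leb]_y \int[leb]_x f (x, y) = \int[leb]_u \int[leb]_y f ((y + u)%R, y))%E.
Proof.
move=> mf f0.
have mshift : measurable_fun [set: mRR] (fun p : mRR => (p.1 + p.2, p.1) : mRR).
  apply/measurable_fun_pairP; split; last exact: measurable_fst.
  exact: (measurable_funD measurable_fst measurable_snd).
have := @fubini_tonelli _ _ mR mR R leb leb (f \o (fun p : mRR => (p.1 + p.2, p.1))).
move=> /(_ (measurableT_comp mf mshift) (fun p => f0 _))/= <-.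
apply: eq_integral => y _.
rewrite (@ge0_integral_translate y (fun x => f (x, y)))//.
  by apply: eq_integral => x _; rewrite addrC.
apply: (measurableT_comp mf); apply: measurable_fun_pair; first exact: measurable_id.
exact: measurable_cst.
Qed.

Lemma measurable_diagonal_section (E : set mRR) (u : R) : measurable E ->
  measurable [set y : mR | E (y + u, y)].
Proof.
move=> mE; rewrite -[X in measurable X]setTI.
apply: (_ : measurable_fun [set: mR] (fun y : mR => (y + u, y) : mRR)) => //.
by apply: measurable_fun_pair; [exact: measurable_translate|exact: measurable_id].
Qed.

(** Only the lines with [u] between [- r] and [r] meet [E]; they form a strip of width [2 * r]. *)
Lemma diagonal_sections_bound (E : set mRR) (r M : R) : measurable E -> 0 < r -> 0 <= M ->
  (forall p, E p -> `|p.1 - p.2| < r) ->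
  (forall u, (leb [set y | E ((y + u)%R, y)] <= M%:E)%E) ->
  (\int[leb]_y \int[leb]_x (\1_E (x, y))%:E <= (2 * r * M)%:E)%E.
Proof.
move=> mE r0 M0 Er H.
have mI : measurable_fun [set: mRR] (EFin \o \1_E : mRR -> \bar R).
  by apply/measurable_EFinP; exact: measurable_indic.
rewrite (ge0_integral_shear mI); last by move=> p; rewrite lee_fin.
have sec u : (\int[leb]_y (\1_E ((y + u)%R, y))%:E = leb [set y | E ((y + u)%R, y)])%E.
  transitivity (\int[leb]_y (\1_[set y : mR | E ((y + u)%R, y)] y)%:E)%E; first by [].
  by rewrite integral_indic ?setIT//; exact: measurable_diagonal_section.
under eq_integral do rewrite sec.
apply: (@le_trans _ _ (\int[leb]_(u in `](- r)%R, r[) (cst M%:E u))%E); last first.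
  rewrite integral_cst//= lebesgue_measure_itv/= lte_fin gtrN// -EFinB -EFinM lee_fin.
  by rewrite opprK mulrC; apply: ler_wpM2r => //; lra.
rewrite [leRHS]integral_mkcond; apply: ge0_le_integral => //.
- rewrite (_ : (fun u => _) = (fun u : mR => \int[leb]_y (\1_E ((y + u)%R, y))%:E)%E); last first.
    by apply/funext => u; rewrite sec.
  have mshift : measurable_fun [set: mRR] (fun p : mRR => (p.1 + p.2, p.1) : mRR).
    apply/measurable_fun_pairP; split; last exact: measurable_fst.
    exact: (measurable_funD measurable_fst measurable_snd).
  apply: (measurable_fun_fubini_tonelli_G _ (measurableT_comp mI mshift)) => p.
  by rewrite lee_fin.
- by apply/(measurable_restrictT _ _).1 => //; exact: measurable_cst.
- move=> u _; rewrite patchE; case: ifPn => // /negP; rewrite inE/= in_itv/= => ur.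
  rewrite (_ : mkset _ = set0) ?measure0// -subset0 => y /= /Er/=.
  by rewrite addrAC subrr add0r => ur'; apply: ur; rewrite -ltr_norml.
Qed.

End shear.

Definition tube {R : realType} (r : R) : set (measurableTypeR R * measurableTypeR R) :=
  [set p | `|p.1 - p.2| < r].

Section tube_returns.
Context {R : realType} {n m : nat} {F G : R -> R} {S w : 'I_n -> R -> R} {U v : 'I_m -> R -> R}.
Context {lo hi lo' hi' D : R}.
Hypothesis fF : full_branch F S w lo hi D.
Hypothesis fG : full_branch G U v lo' hi' D.
Hypotheses (lo0 : 0 < lo) (hi0 : 0 < hi) (lo0' : 0 < lo') (hi0' : 0 < hi').
Hypotheses (D0 : 0 <= D) (hi23 : hi <= 2 / 3) (hi23' : hi' <= 2 / 3).
Local Notation leb := (@lebesgue_measure R).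
Local Notation mR := (measurableTypeR R).
Local Notation mRR := (measurableTypeR R * measurableTypeR R)%type.
Local Notation T := (prodmap F G : mRR -> mRR).

Lemma measurable_tube (r : R) : measurable (tube r : set mRR).
Proof.
have md : measurable_fun [set: mRR] (fun p : mRR => `|p.1 - p.2| : R).
  apply: measurableT_comp; first exact: normr_measurable.
  exact: (measurable_funB measurable_fst measurable_snd).
rewrite -[X in measurable X]setTI (_ : tube r = (fun p : mRR => `|p.1 - p.2| : R) @^-1` `]-oo, r[).
  exact: (md measurableT _ (measurable_itv _)).
by apply/seteqP; split => p; rewrite /tube/= in_itv.
Qed.

Lemma iter_prodmap j p : iter j T p = (iter j F p.1, iter j G p.2).
Proof. by elim: j => [|j IH]; [case: p|rewrite !iterS IH]. Qed.

(** One factor [r] comes from the width of the tube and one from the close returns on each line.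
    Either factor of the map may be the faster one, and [q] is the corresponding ratio of
    contraction rates. *)
Lemma tube_return (j : nat) (r : R) : (0 < j)%N -> 0 < r -> hi < lo' \/ hi' < lo ->
  exists2 q, q = (if hi < lo' then hi / lo' else hi' / lo) &
  (lam2 (tube r `&` iter j T @^-1` tube r) <= (2 * r * (8 * expR (3 * D) / (1 - q) * r))%:E)%E.
Proof.
move=> j0 r0 fast; eexists; first by reflexivity.
have mT : measurable (tube r `&` iter j T @^-1` tube r).
  by apply: measurableI; [exact: measurable_tube|exact: (measurable_preimage_iter fF fG) (measurable_tube r)].
rewrite lam2E//; set E := _ `&` unit_square.
have mE : measurable E by apply: measurableI => //; exact: measurable_unit_square.
have mI : measurable_fun [set: mRR] (EFin \o \1_E : mRR -> \bar R).
  by apply/measurable_EFinP; exact: measurable_indic.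
have I0 p : (0 <= (EFin \o \1_E : mRR -> \bar R) p)%E by rewrite lee_fin.
have iE : ((leb \x leb)%E E = \int[leb \x leb]_p (\1_E p)%:E)%E by rewrite integral_indic// setIT.
have M0 q : 0 < q < 1 -> 0 <= 8 * expR (3 * D) / (1 - q) * r.
  by move=> /andP[q0 q1]; rewrite mulr_ge0 ?divr_ge0 ?mulr_ge0 ?expR_ge0 ?ltW// subr_gt0.
case: ifPn => [f1|f1].
  rewrite iE (fubini_tonelli2 _ mI I0).
  apply: diagonal_sections_bound => //; first by apply: M0; exact: fast_ratio_lt1.
    by move=> p [[]].
  move=> u; have [ur|ur] := ltP `|u| r; last first.
    rewrite (_ : mkset _ = set0) ?measure0 ?lee_fin ?M0 ?fast_ratio_lt1// -subset0 => y [[]].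
    by rewrite /tube/= addrAC subrr add0r ltNge ur.
  rewrite (_ : mkset _ = @close_return R F G j u r).
    apply: (lebesgue_close_return fF fG) => //.
    rewrite (_ : close_return _ _ _ = [set y | E (y + u, y)]); first exact: measurable_diagonal_section.
    apply/seteqP; split => y.
      move=> [y01 yu01 h]; split; last by split; rewrite /= in_itv/=.
      by split; [rewrite /tube/= addrAC subrr add0r|rewrite /= iter_prodmap].
    by move=> [[_]]; rewrite /= iter_prodmap /tube/= => h []; rewrite /= !in_itv/=.
  apply/seteqP; split => y.
    by move=> [[_]]; rewrite /= iter_prodmap /tube/= => h []; rewrite /= !in_itv/=.
  move=> [y01 yu01 h]; split; last by split; rewrite /= in_itv/=.
  by split; [rewrite /tube/= addrAC subrr add0r|rewrite /= iter_prodmap].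
have {f1 fast} f1 : hi' < lo by case: fast => // h; rewrite h in f1.
(* Here [G] is the faster map; exchanging the coordinates reduces to the previous situation. *)
pose E' : set mRR := [set p | E (p.2, p.1)].
have mswap : measurable_fun [set: mRR] (fun p : mRR => (p.2, p.1) : mRR).
  by apply: measurable_fun_pair; [exact: measurable_snd|exact: measurable_fst].
have mE' : measurable E' by rewrite -[X in measurable X]setTI; exact: mswap.
rewrite iE (fubini_tonelli1 _ mI I0).
rewrite [leLHS](_ : _ = \int[leb]_y \int[leb]_x (\1_E' (x, y))%:E)%E; last first.
  by apply: eq_integral => x _; apply: eq_integral => y _.
have EC u : `|u| < r -> [set y | E' (y + u, y)] = @close_return R G F j u r.
  move=> ur; apply/seteqP; split => y.
    move=> [[_]]; rewrite /= iter_prodmap /tube/= => h []; rewrite /= !in_itv/= => ? ?.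
    by split=> //; rewrite distrC.
  move=> [y01 yu01 h]; split; last by split; rewrite /= in_itv/=.
  by split; rewrite /= ?iter_prodmap /tube/= distrC// addrAC subrr add0r.
apply: diagonal_sections_bound => //; first by apply: M0; exact: fast_ratio_lt1.
  by move=> p [[]]; rewrite /tube/= distrC.
move=> u; have [ur|ur] := ltP `|u| r; last first.
  rewrite (_ : mkset _ = set0) ?measure0 ?lee_fin ?M0 ?fast_ratio_lt1// -subset0 => y [[]].
  by rewrite /tube/= distrC addrAC subrr add0r ltNge ur.
rewrite EC//; apply: (lebesgue_close_return fG fF) => //.
by rewrite -EC//; exact: measurable_diagonal_section.
Qed.

End tube_returns.

(** * Hitting times *)


Section hitting.
Context {d} {X : measurableType d} {R : realType} (mu : probability X R) (T : X -> X).
Hypothesis mT : measurable_fun [set: X] T.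
Hypothesis mu_inv : forall A, measurable A -> mu (T @^-1` A) = mu A.
Variables (A : set X) (mA : measurable A).
Local Notation m B := (fine (mu B)).

Definition no_visit l : set X := [set p | forall i, (i < l)%N -> ~ A (iter i T p)].

Lemma measurable_iter_preimage k (B : set X) : measurable B -> measurable (iter k T @^-1` B).
Proof.
move=> mB; elim: k => [|k IH] //.
rewrite (_ : iter k.+1 T @^-1` B = T @^-1` (iter k T @^-1` B)); last first.
  by apply/seteqP; split => p; rewrite /= -iterS iterSr.
by rewrite -[X in measurable X]setTI; exact: mT.
Qed.

Lemma no_visitS l : no_visit l.+1 = T @^-1` no_visit l `\` A.
Proof.
apply/seteqP; split => p.
  move=> H; split; last exact: (H 0%N).
  by move=> i il; rewrite -iterSr; exact: H.
move=> [H pA] [|i] // il; rewrite iterSr; exact: H.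
Qed.

Lemma measurable_no_visit l : measurable (no_visit l).
Proof.
elim: l => [|l IH]; first by rewrite (_ : no_visit 0 = setT)//; apply/seteqP; split.
rewrite no_visitS; apply: measurableD => //.
exact: (measurable_iter_preimage 1 IH).
Qed.

(** By invariance [no_visit l] has the measure of its preimage, which is split according to whether
    the starting point is in [A]. *)
Lemma no_visit_step l : m (no_visit l) = m (no_visit l.+1) + m (A `&` T @^-1` no_visit l).
Proof.
have mW := measurable_no_visit l; have mTW := measurable_iter_preimage 1 mW.
rewrite -(mu_inv mW) (fine_muD mu mTW mA) no_visitS addrC.
by congr (_ + m _); rewrite setIC.
Qed.

Lemma no_visit_lip l k : (k <= l)%N -> m (no_visit l) <= m (no_visit k) <= m (no_visit l) + (l - k)%:R * m A.
Proof.
elim: l => [|l IH]; first by rewrite leqn0 => /eqP->; rewrite mul0r addr0 lexx.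
rewrite leq_eqVlt => /predU1P[->|]; first by rewrite subnn mul0r addr0 lexx.
rewrite ltnS => kl; have /andP[h1 h2] := IH kl.
have mW := measurable_no_visit l; have mTW := measurable_iter_preimage 1 mW.
have h : m (A `&` T @^-1` no_visit l) <= m A by apply: fine_mu_le => //; exact: measurableI.
have h0 : 0 <= m (A `&` T @^-1` no_visit l) by exact: fine_ge0.
have E := no_visit_step l; rewrite subSn// -natr1 mulrDl mul1r.
move: h1 h2 h h0 E; clear; move: (m _) (m _) (m _) (m _) (m _) => x1 x2 x3 x4 x5 *.
by apply/andP; split; lra.
Qed.

Variables (t : nat) (kap gam : R).
Hypothesis t0 : (0 < t)%N.
Hypothesis short : forall j, (0 < j)%N -> m (A `&` iter j T @^-1` A) <= kap.
Hypothesis mix : forall B, measurable B -> `|m (A `&` iter t T @^-1` B) - m A * m B| <= gam.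

(** The points of [A] that return to [A] strictly before time [k]: the error made by ignoring visits
    at times below [k]. *)
Let V k : set X := A `&` [set p | exists2 j, (0 < j < k)%N & A (iter j T p)].

Let VS k : V k.+1 = V k `|` (if (0 < k)%N then A `&` iter k T @^-1` A else set0).
Proof.
apply/seteqP; split => p.
  move=> [Ap [j /andP[j0 jk] Aj]]; move: jk; rewrite ltnS leq_eqVlt => /predU1P[jE|jk].
    by right; rewrite -jE j0.
  by left; split=> //; exists j => //; rewrite j0.
move=> [[Ap [j /andP[j0 jk] Aj]]|]; first by split=> //; exists j => //; rewrite j0 ltnW.
by case: ifP => // k0 [Ap Ak]; split=> //; exists k => //; rewrite k0/=.
Qed.

Let V_bound k : measurable (V k) /\ m (V k) <= k%:R * kap.
Proof.
have kap0 : 0 <= kap by apply: le_trans (short (ltn0Sn 0)); exact: fine_ge0.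
elim: k => [|k [mV hV]].
  have -> : V 0 = set0 by rewrite -subset0 => p [_ [j]]; rewrite ltn0 andbF.
  by rewrite measure0 mul0r.
rewrite VS; case: ifPn => [k0|_]; last first.
  rewrite setU0; split=> //; apply: le_trans hV _.
  by apply: ler_wpM2r => //; rewrite ler_nat.
have mAk : measurable (A `&` iter k T @^-1` A).
  by apply: measurableI => //; exact: measurable_iter_preimage.
split; first exact: measurableU.
rewrite -natr1 mulrDl mul1r; apply: le_trans (lerD hV (short k0)).
rewrite -fineD ?fin_num_measure//; apply: fine_le.
- by rewrite fin_num_measure//; exact: measurableU.
- by rewrite fin_numD !fin_num_measure.
- exact: measureU2.
Qed.

(** In the set [A] followed by no visit, drop the conditions at times below [t], which costs [V t];
    decouple the rest from [A] by mixing; then restore the dropped conditions, which costs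
    [t * mu A] and is multiplied by [mu A]. *)
Lemma no_visit_renewal l :
  `|m (no_visit l.+1) - (1 - m A) * m (no_visit l)| <= t%:R * kap + gam + t%:R * m A * m A.
Proof.
have mW := measurable_no_visit l; have mTW := measurable_iter_preimage 1 mW.
(* The times from [t] to [l] are those left after the gap. If [t] exceeds [l], truncation gives
   [k = 0] and no condition remains. *)
set k := (l.+1 - t)%N; have mWk := measurable_no_visit k.
have mTk := measurable_iter_preimage t mWk.
have mAk : measurable (A `&` iter t T @^-1` no_visit k) by exact: measurableI.
have mAl : measurable (A `&` T @^-1` no_visit l) by exact: measurableI.
have sub : A `&` T @^-1` no_visit l `<=` A `&` iter t T @^-1` no_visit k.
  move=> p [Ap H]; split=> // i ik; rewrite -iterD.
  have -> : (i + t = (i + t).-1.+1)%N by rewrite prednK// addn_gt0 t0 orbT.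
  by rewrite iterSr; apply: H; move: ik t0; rewrite /k; case: (t) => // t' + _; rewrite subSS addnS/= ltn_subRL addnC.
have dif : (A `&` iter t T @^-1` no_visit k) `\` (A `&` T @^-1` no_visit l) `<=` V t.
  move=> p [[Ap H] nH]; split=> //.
  have /existsNP[i /not_implyP[il /contrapT Ai]] : ~ no_visit l (T p) by move=> h; apply: nH.
  exists i.+1; last by rewrite iterSr.
  rewrite /= ltnNge; apply/negP => ti; apply: (H (i.+1 - t)%N).
    by rewrite /k ltn_sub2r// (leq_ltn_trans ti).
  by rewrite -iterD subnK// iterSr.
have [mV hV] := V_bound t.
have e1 : m (A `&` iter t T @^-1` no_visit k) <= m (A `&` T @^-1` no_visit l) + t%:R * kap.
  rewrite (fine_muD mu mAk mAl) (setIidr sub); rewrite lerD2l; apply: le_trans hV.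
  by apply: fine_mu_le => //; exact: measurableD.
have e2 : m (A `&` T @^-1` no_visit l) <= m (A `&` iter t T @^-1` no_visit k) by exact: fine_mu_le.
have /andP[e3 e4] : m (no_visit l) <= m (no_visit k) <= m (no_visit l) + (l - k)%:R * m A.
  by apply: no_visit_lip; rewrite /k; case: (t) t0 => // t' _; rewrite subSS leq_subr.
have a0 : 0 <= m A by exact: fine_ge0.
have e5 : m A * m (no_visit k) <= m A * m (no_visit l) + t%:R * m A * m A.
  have : m (no_visit k) <= m (no_visit l) + t%:R * m A.
    apply: le_trans e4 _; rewrite lerD2l; apply: ler_wpM2r => //; rewrite ler_nat.
    rewrite leq_subLR /k; have [tl|tl] := leqP t l.+1; first by rewrite subnK.
    by apply: leq_trans (leq_addl _ _); exact: ltnW (ltnW tl).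
  by move=> /(ler_wpM2l a0); rewrite mulrDr; congr (_ <= _ + _); rewrite mulrC.
have e6 : m A * m (no_visit l) <= m A * m (no_visit k) by exact: ler_wpM2l.
have e7 := mix mWk; have e8 := no_visit_step l.
have kap0 : 0 <= t%:R * kap by apply: le_trans hV; exact: fine_ge0.
have e9 : 0 <= t%:R * m A * m A by rewrite !mulr_ge0.
move: e1 e2 e5 e6 e7 e8 kap0 e9; rewrite mulrBl mul1r !ler_norml; clear.
move: (m (no_visit l)) (m (no_visit l.+1)) (m (A `&` _)) (m (A `&` _)) (m A * _) (m A * _) (t%:R * kap) (t%:R * _ * _) => x1 x2 x3 x4 x5 x6 x7 x8.
move=> e1 e2 e5 e6 /andP[e7 e7'] e8 e9 e10; apply/andP; split; lra.
Qed.

(** The recursion has factor [1 - mu A] in the unit interval, so the errors of the successive steps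
    merely add up. *)
Lemma no_visit_law l :
  `|m (no_visit l) - (1 - m A) ^+ l| <= l%:R * (t%:R * kap + gam + t%:R * m A * m A).
Proof.
have a0 : 0 <= m A by exact: fine_ge0.
have a1 : m A <= 1.
  by rewrite -[leRHS]/(fine 1%:E) -(probability_setT mu) fine_mu_le.
elim: l => [|l IH].
  rewrite mul0r expr0 (_ : no_visit 0 = setT) ?probability_setT ?subrr ?normr0//.
  by apply/seteqP; split.
set e := t%:R * kap + gam + _ in IH *.
have h := no_visit_renewal l; rewrite -/e in h.
rewrite -natr1 mulrDl mul1r exprS.
have -> : m (no_visit l.+1) - (1 - m A) * (1 - m A) ^+ l =
  (1 - m A) * (m (no_visit l) - (1 - m A) ^+ l) + (m (no_visit l.+1) - (1 - m A) * m (no_visit l)).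
  by ring.
apply: le_trans (ler_normD _ _) _; apply: lerD => //.
rewrite normrM ger0_norm ?subr_ge0//; apply: le_trans IH.
by rewrite ler_piMl// gerBl.
Qed.

End hitting.

(** * Full branches from expanding inverse branches *)


Section density.
Context {R : realType}.
Local Notation mR := (measurableTypeR R).
Local Notation lam := (@lam R).
Variables (w : mR -> R) (M : R).
Hypotheses (mw : measurable_fun [set: mR] w) (wM : forall z, 0 <= w z <= M).

(** The hypotheses are arguments of the constant, so that its measure structure can be declared on
    it. *)
Definition density_measure of measurable_fun [set: mR] w & (forall z, 0 <= w z <= M) :
  set mR -> \bar R := fun B => (\int[lam]_(z in B) (w z)%:E)%E.
Local Notation nu := (density_measure mw wM).

Let w0 z : (0 <= (w z)%:E)%E. Proof. by rewrite lee_fin; case/andP: (wM z). Qed.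

Let mwE : measurable_fun [set: mR] (EFin \o w). Proof. exact/measurable_EFinP. Qed.

Let nu0 : nu set0 = 0%E. Proof. exact: integral_set0. Qed.

Let nu_ge0 B : (0 <= nu B)%E. Proof. exact: integral_ge0. Qed.

Let nu_sigma : semi_sigma_additive nu.
Proof. by apply: semi_sigma_additive_nng_induced => // ? _. Qed.

HB.instance Definition _ := isMeasure.Build _ _ _ nu nu0 nu_ge0 nu_sigma.

Let nu_fin : fin_num_fun nu.
Proof.
move=> B mB; rewrite ge0_fin_numE//.
apply: (@le_lt_trans _ _ (\int[lam]_(z in B) (cst M%:E z))%E).
  apply: ge0_le_integral => //.
  - exact: measurable_funTS.
  - by move=> z _; rewrite lee_fin; case/andP: (wM z).
rewrite integral_cst//.
have M0 : 0 <= M by case/andP: (wM 0) => h1 /(le_trans h1).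
apply: (@le_lt_trans _ _ (M%:E * 1)%E); last by rewrite mule1 ltry.
by rewrite lee_wpmul2l ?lee_fin// -lamT; apply: le_measure; rewrite ?inE.
Qed.

HB.instance Definition _ := Measure_isFinite.Build _ _ _ nu nu_fin.

(** The Radon-Nikodym derivative of this measure agrees almost everywhere with [w], which reduces
    the claim to the change of variables for such derivatives. *)
Lemma integral_density_measure (g : mR -> \bar R) : measurable_fun [set: mR] g ->
  (forall z, 0 <= g z)%E -> (\int[nu]_z g z = \int[lam]_z ((w z)%:E * g z))%E.
Proof.
move=> mg g0.
have nulam : nu `<< lam.
  apply/null_content_dominatesP => A mA A0; rewrite /density_measure.
  by apply: null_set_integral => //; exact: measurable_funTS.
have mRN := measurable_int _ (Radon_Nikodym_SigmaFinite.f_integrable nulam).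
have RN0 := Radon_Nikodym_SigmaFinite.f_ge0 nulam.
rewrite -(Radon_Nikodym_SigmaFinite.change_of_variables nulam)//.
apply: ge0_ae_eq_integral => //.
- exact: emeasurable_funM.
- exact: emeasurable_funM.
- by move=> z _; rewrite mule_ge0.
- by move=> z _; rewrite mule_ge0.
have : ae_eq lam setT (Radon_Nikodym_SigmaFinite.f nu lam) (EFin \o w).
  apply: integral_ae_eq => //.
  - exact: Radon_Nikodym_SigmaFinite.f_integrable.
  - by move=> E _ mE; rewrite -Radon_Nikodym_SigmaFinite.f_integral.
by apply: filterS => z h _; rewrite h// muleC.
Qed.

End density.

Lemma ge0_integral_mrestr {d} {T : measurableType d} {R : realType} (mu : {measure set T -> \bar R})
  (D : set T) (mD : measurable D) (f : T -> \bar R) : measurable_fun setT f ->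
  (forall x, 0 <= f x)%E -> (\int[mrestr mu mD]_x f x = \int[mu]_(x in D) f x)%E.
Proof.
move=> mf f0; rewrite -(setUv D) ge0_integral_setU//; last 2 first.
- exact: measurable_funTS.
- by apply/disj_setPCl.
rewrite [X in (_ + X)%E]null_set_integral ?adde0//; last 3 first.
- exact: measurableC.
- exact: measurable_funTS.
- by rewrite /= /mrestr setICl measure0.
  by apply: eq_measure_integral => A mA AD; rewrite /= /mrestr (setIidl AD).
exact: measurableC.
Qed.

(** The intermediate point is squeezed towards [z], and [w] is continuous there. *)
Lemma is_derive_mvt {R : realType} (f w : R -> R) (z e : R) : 0 < e -> {for z, continuous w} ->
  (forall h, `|h| < e -> exists2 y, `|y - z| <= `|h| & f (h + z) - f z = w y * h) ->
  is_derive z (1 : R) f (w z).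
Proof.
move=> e0 cw H.
have lim : (fun h => h^-1 *: (f (h *: (1 : R) + z) - f z)) @ (0 : R)^' --> w z.
  apply/cvgrPdist_le => eps eps0.
  have /cvgrPdist_le/(_ eps eps0)/nbhs_ballP[d /= d0 Hd] := cw.
  have de0 : 0 < Num.min d e by rewrite lt_min d0.
  apply/nbhs_ballP; exists (Num.min d e) => //= h.
  rewrite /ball/= sub0r normrN lt_min => /andP[hd he] h0.
  have [y yh E] := H h he.
  rewrite [h *: _](mulr1 h) E [_ *: _](_ : _ = w y); last by rewrite /GRing.scale/= mulrC mulfK.
  by apply: Hd; rewrite /ball/= distrC; exact: le_lt_trans hd.
by apply: DeriveDef; [exact: cvgP lim|exact: (cvg_lim _ lim)].
Qed.

(** The mean value identity makes [w] the derivative of [s * S]; what remains is the fundamental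
    theorem of calculus. *)
Lemma integral_branch {R : realType} (s y : R) (S w : R -> R) :
  continuous S -> continuous w -> 0 <= y < 1 ->
  (forall z z' : R, 0 <= z -> z <= z' -> z' <= 1 ->
    exists2 x : R, z <= x <= z' & s * (S z' - S z) = w x * (z' - z)) ->
  (\int[@lebesgue_measure R]_(z in `[y, 1%R]) (w z)%:E = (s * (S 1 - S y))%R%:E)%E.
Proof.
move=> cS cw /andP[y0 y1] mvt.
have csS : continuous (fun z => s * S z) by move=> z; apply: cvgMr; exact: cS.
have der (z : R) : 0 < z < 1 -> is_derive z (1 : R) (fun z => s * S z) (w z).
  move=> /andP[z0 z1]; apply: (@is_derive_mvt R _ w z (Num.min z (1 - z))) => //.
  - by rewrite lt_min z0 subr_gt0.
  - exact: cw.
  move=> h; rewrite lt_min => /andP[hz hz1].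
  have := ler_norm h; have := ler_norm (- h); rewrite normrN => h1 h2.
  have [h0|h0] := leP 0 h.
    have [|||x /andP[x1 x2] E] := mvt z (h + z); try lra.
    exists x; last by rewrite -mulrBr E; congr (_ * _); lra.
    by rewrite !ger0_norm// ?subr_ge0//; lra.
  have [|||x /andP[x1 x2] E] := mvt (h + z) z; try lra.
  exists x.
    by rewrite distrC (ltr0_norm h0) ger0_norm ?subr_ge0//; lra.
  by rewrite -mulrBr -opprB mulrN E; ring.
rewrite (continuous_FTC2 (F := fun z => s * S z) y1).
- by rewrite -EFinB -mulrBr.
- exact: continuous_subspaceT.
- split.
  + move=> z; rewrite in_itv/= => /andP[yz z1].
    by have [] := der z ltac:(by rewrite z1 (le_lt_trans y0)).
  + exact: cvg_at_right_filter (csS y).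
  + exact: cvg_at_left_filter (csS 1).
- move=> z; rewrite in_itv/= => /andP[yz z1].
  by rewrite derive1E; have [_ ->] := der z ltac:(by rewrite z1 (le_lt_trans y0)).
Qed.

Lemma lam_integral_ray {R : realType} (x : R) (w : measurableTypeR R -> R) :
  measurable_fun [set: measurableTypeR R] w -> (forall z, 0 < w z) -> x < 1 ->
  (\int[lam]_(z in `]x, +oo[) (w z)%:E =
   \int[@lebesgue_measure R]_(z in `[(Num.max 0 x)%R, 1%R]) (w z)%:E)%E.
Proof.
move=> mw w0 x1.
have mwE : measurable_fun [set: measurableTypeR R] (EFin \o w) by exact/measurable_EFinP.
have mray : measurable (`]x, +oo[%classic : set (measurableTypeR R)) by exact: measurable_itv.
rewrite [LHS]integral_mkcond.
rewrite (ge0_integral_mrestr (@lebesgue_measure R) (measurable_itv `[0, 1])); last 2 first.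
- by apply/(measurable_restrictT _ _).1 => //; exact: measurable_funTS.
- by move=> z; rewrite patchE; case: ifP => // _; rewrite lee_fin ltW.
rewrite -integral_mkcondr.
have [x0|x0] := ltP x 0.
  congr (integral _ _ _); apply/seteqP; split => z /=; rewrite !in_itv/= andbT.
    by case.
  by move=> /andP[z0 z1]; rewrite z0 z1 (lt_le_trans x0).
rewrite (_ : _ `&` _ = `]x, 1]%classic); last first.
  apply/seteqP; split => z /=; rewrite !in_itv/= andbT; first by move=> [/andP[_ ->] ->].
  by move=> /andP[xz z1]; rewrite xz z1 (le_trans x0 (ltW xz)).
by rewrite integral_itv_obnd_cbnd//; apply: measurable_funTS.
Qed.

(* Both sides are measures, so it is enough to compare them on the half-lines
   ]x, +oo[, where the formula is the fundamental theorem of calculus. *)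
Lemma branch_dual {R : realType} (p q s : R) (F S w : R -> R) (M : R) :
  p < q -> 0 <= p -> q <= 1 ->
  measurable_fun [set: measurableTypeR R] (F : measurableTypeR R -> measurableTypeR R) ->
  continuous S -> continuous w -> (forall z, 0 <= w z <= M) ->
  s = 1 \/ s = -1 ->
  (forall z z' : R, 0 <= z -> z <= z' -> z' <= 1 ->
    exists2 y : R, z <= y <= z' & s * (S z' - S z) = w y * (z' - z)) ->
  (forall z, 0 < w z) -> (forall z, p <= S z <= q) ->
  (forall z : R, 0 < z < 1 -> p < S z < q /\ F (S z) = z) ->
  (forall x, p < x < q -> 0 < F x < 1 /\ S (F x) = x) ->
  forall Phi : measurableTypeR R * measurableTypeR R -> \bar R,
  measurable_fun [set: measurableTypeR R * measurableTypeR R] Phi -> (forall p, 0 <= Phi p)%E ->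
  (\int[lam]_(x in `]p, q[) Phi (F x, x) = \int[lam]_z ((w z)%:E * Phi (z, S z)))%E.
Proof.
move=> pq p0 q1 mF cS cw wM s1 mvt w0 Scc Soo Fpq Phi mPhi Phi0.
pose mR := measurableTypeR R.
have mS : measurable_fun [set: mR] (S : mR -> mR) by exact: continuous_measurable_fun.
have mw : measurable_fun [set: mR] (w : mR -> R) by exact: continuous_measurable_fun.
pose g (z : mR) : \bar R := Phi (z, S z).
have mg : measurable_fun [set: mR] g.
  by apply: (measurableT_comp mPhi); apply: measurable_fun_pair => //; exact: measurable_id.
have g0 z : (0 <= g z)%E by exact: Phi0.
(* Both sides are about to become integrals of the same [g], against the push-forward by [F] of
   Lebesgue measure on the branch and against the measure of density [w]. *)
rewrite -(integral_density_measure mw wM mg)//.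
pose I : set mR := `]p, q[%classic.
have mI : measurable I by exact: measurable_itv.
rewrite (_ : (\int[lam]_(x in _) _)%E = (\int[lam]_(x in I) (g \o F) x)%E); last first.
  by apply: eq_integral => x; rewrite inE/= in_itv/= => /Fpq[_ Sx]; rewrite /g/= Sx.
have mgF : measurable_fun [set: mR] (g \o F) by exact: measurableT_comp.
rewrite -(ge0_integral_mrestr lam mI mgF); last by move=> x; exact: g0.
rewrite -[X in (\int[_]_(x in X) _)%E](preimage_setT (F : mR -> mR)).
rewrite -(ge0_integral_pushforward mF)//.
pose nu1 := pushforward (mrestr lam mI) (F : mR -> mR).
have half (x : R) : nu1 `]x, +oo[%classic = density_measure mw wM `]x, +oo[%classic.
  transitivity (@lebesgue_measure R (((F : mR -> mR) @^-1` `]x, +oo[) `&` I `&` `[0, 1]%classic)); first by [].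
  rewrite /density_measure.
  have [x1|x1] := leP 1 x.
    rewrite (_ : _ `&` I = set0); last first.
      rewrite -subset0 => u [] /=; rewrite !in_itv/= andbT => xF /Fpq[/andP[_ F1] _].
      by have := lt_trans F1 (le_lt_trans x1 xF); rewrite ltxx.
    rewrite set0I measure0 null_set_integral//; first by apply: measurable_funTS; exact/measurable_EFinP.
    transitivity (@lebesgue_measure R (`]x, +oo[%classic `&` `[0, 1]%classic)); first by [].
    rewrite (_ : _ `&` _ = set0) ?measure0// -subset0 => z [] /=; rewrite !in_itv/= andbT => xz /andP[_ z1].
    by have := lt_le_trans (le_lt_trans x1 xz) z1; rewrite ltxx.
  rewrite lam_integral_ray//; set y := Num.max 0 x.
  have y01 : 0 <= y < 1 by rewrite /y le_max lexx/= gt_max ltr01.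
  have /andP[y0 y1] := y01.
  rewrite (integral_branch cS cw y01 mvt).
  have mono (z z' : R) : 0 <= z -> z < z' -> z' <= 1 -> 0 < s * (S z' - S z).
    move=> z0 zz' z1; have [t _ ->] := mvt z z' z0 (ltW zz') z1.
    by rewrite mulr_gt0// subr_gt0.
  (* By monotonicity, the part of the branch where [F] exceeds [x] is the interval between [S y] and
     [S 1], in the order given by the orientation. *)
  have E : (F : mR -> mR) @^-1` `]x, +oo[ `&` I `&` `[0, 1]%classic =
      `]Num.min (S y) (S 1), Num.max (S y) (S 1)[%classic.
    apply/seteqP; split => u /=; rewrite !in_itv/= ?andbT.
      move=> [[xF /Fpq[/andP[F0 F1] SF]] _].
      have yF : y < F u by rewrite /y gt_max F0.
      have h1 := mono _ _ y0 yF (ltW F1); have h2 := mono _ _ (ltW F0) F1 (lexx _).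
      rewrite SF in h1 h2; move: h1 h2.
      case: s1 => ->; rewrite ?mul1r ?mulN1r ?opprB !subr_gt0 => h1 h2.
        by rewrite gt_min h1 lt_max h2 orbT.
      by rewrite gt_min h2 orbT lt_max h1.
    move=> /andP[u1 u2].
    have /andP[a1 a2] := Scc 1; have /andP[b1 b2] := Scc y.
    have pu : p < u by apply: le_lt_trans u1; rewrite le_min a1 b1.
    have uq : u < q by apply: lt_le_trans u2 _; rewrite ge_max a2 b2.
    have /Fpq[/andP[F0 F1] SF] : p < u < q by rewrite pu uq.
    split; last by rewrite (ltW (le_lt_trans p0 pu)) (ltW (lt_le_trans uq q1)).
    split; last by rewrite /I/= in_itv/= pu uq.
    rewrite ltNge; apply/negP => Fx.
    have Fy : F u <= y by rewrite /y le_max Fx orbT.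
    have h1 : 0 <= s * (S y - S (F u)).
      by have [t _ ->] := mvt _ _ (ltW F0) Fy (ltW y1); rewrite mulr_ge0 ?subr_ge0// ltW.
    have h2 := mono _ _ y0 y1 (lexx _).
    rewrite SF in h1; move: h1 h2 u1 u2.
    case: s1 => ->; rewrite ?mul1r ?mulN1r ?opprB ?subr_gt0 ?subr_ge0 => h1 h2.
      by rewrite min_l ?ltW// ltNge h1.
    by rewrite min_r ?ltW// max_l ?ltW// => _; rewrite ltNge h1.
  rewrite E lebesgue_measure_itv/= lte_fin.
  have h2 := mono _ _ y0 y1 (lexx _); move: h2.
  case: s1 => ->; rewrite ?mul1r ?mulN1r ?opprB ?subr_gt0 ?subr_ge0 => h2.
    by rewrite min_l ?ltW// max_r ?ltW// h2.
  by rewrite min_r ?ltW// max_l ?ltW// h2.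
apply: eq_measure_integral => //= A mA _.
pose H : set (set mR) := @RGenOInfty.G R.
apply: (@measure_unique _ _ _ H (fun n => `]- n%:R, +oo[%classic)) => //.
- exact: RGenOInfty.measurableE.
- move=> _ _ [x ->] [y ->]; exists (Num.max x y); apply/seteqP; split => z /=; rewrite !in_itv/= !andbT gt_max.
    by move=> [-> ->].
  by move=> /andP[-> ->].
- by move=> i; exists (- i%:R).
- apply/seteqP; split => // z _; exists (Num.bound z) => //=; rewrite in_itv/= andbT.
  by rewrite ltrNl unstable.ltrNbound.
- by move=> _ [x ->]; exact: half.
- move=> k; apply: (@le_lt_trans _ _ (lam setT)); last by rewrite lamT ltry.
  rewrite /pushforward /mrestr; apply: le_measure; rewrite ?inE//.
  by apply: measurableI => //; rewrite -[X in measurable X]setTI; exact: mF.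
Qed.


(** One branch of [F] over the interval from [p] to [q], of orientation [s]; [full_branch] assembles
    these. *)
Record inverse_branch {R : realType} (F : R -> R) (p q s : R) (S w : R -> R) (lo hi D : R) : Prop := {
  ib_s : s = 1 \/ s = -1;
  ib_cS : continuous S;
  ib_cw : continuous w;
  ib_S : forall z : R, p <= S z <= q;
  ib_w : forall z : R, lo <= w z <= hi;
  ib_wD : forall z z' : R, w z <= expR (D * cdist z z') * w z';
  ib_mvt : forall z z' : R, 0 <= z -> z <= z' -> z' <= 1 ->
    exists2 y : R, z <= y <= z' & s * (S z' - S z) = w y * (z' - z);
  ib_clamp : forall z : R, S (clamp z) = S z;
  ib_Soo : forall z : R, 0 < z < 1 -> p < S z < q /\ F (S z) = z;
  ib_Fpq : forall x : R, p < x < q -> 0 < F x < 1 /\ S (F x) = x }.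

Section expanding.
Context {R : realType} (p q L1 L2 M : R) (E E' : R -> R).
Hypotheses (pq : p < q) (L10 : 0 < L1) (M0 : 0 <= M).
Hypothesis dE : forall x : R, p <= x <= q -> is_derive x (1 : R) E (E' x).
Hypothesis EL : forall x : R, p <= x <= q -> L1 <= E' x <= L2.
Hypothesis EM : forall x y : R, p <= x <= q -> p <= y <= q -> `|E' x - E' y| <= M * `|x - y|.
Hypotheses (Ep : E p = 0) (Eq : E q = 1).

Let mvtE (x y : R) : p <= x -> x <= y -> y <= q ->
  exists2 c, x <= c <= y & E y - E x = E' c * (y - x).
Proof.
move=> px xy yq.
have d c : x <= c <= y -> is_derive c (1 : R) E (E' c).
  by move=> /andP[xc cy]; apply: dE; rewrite (le_trans px xc) (le_trans cy yq).
have [||c] := @MVT_segment R E E' x y xy.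
- by move=> c; rewrite in_itv/= => /andP[xc cy]; apply: d; rewrite !ltW.
- apply: derivable_within_continuous => c; rewrite in_itv/= => xcy.
  by case: (d c xcy).
- by rewrite in_itv/= => xcy Ec; exists c.
Qed.

Let expand (x y : R) : p <= x -> x <= y -> y <= q -> L1 * (y - x) <= E y - E x.
Proof.
move=> px xy yq; have [c /andP[xc cy] ->] := mvtE px xy yq.
apply: ler_wpM2r; first by rewrite subr_ge0.
by have /andP[] := EL (x := c) ltac:(by rewrite (le_trans px xc) (le_trans cy yq)).
Qed.

(** The weight is [v z = 1 / E' (U z)]. As [U] is Lipschitz with constant [1 / L1], the map
    [z |-> E' (U z)] has constant [M / L1]; dividing by [L1] once more gives the relative variation
    of [v], and twice more the absolute one. *)
Lemma expanding_inverse : exists U v : R -> R,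
  [/\ forall z, 0 <= z <= 1 -> p <= U z <= q /\ E (U z) = z,
      forall x, p <= x <= q -> 0 <= E x <= 1 /\ U (E x) = x,
      forall z, 0 <= z <= 1 -> L2^-1 <= v z <= L1^-1,
      forall z z', 0 <= z -> z <= z' -> z' <= 1 ->
        exists2 y, z <= y <= z' & U z' - U z = v y * (z' - z) &
      forall z z', 0 <= z <= 1 -> 0 <= z' <= 1 ->
        v z <= expR (M / L1 ^+ 2 * `|z - z'|) * v z' /\ `|v z - v z'| <= M / L1 ^+ 3 * `|z - z'|].
Proof.
have exU (z : R) : exists x : R, 0 <= z <= 1 -> p <= x <= q /\ E x = z.
  have [z01|nz] := pselect (0 <= z <= 1); last by exists 0.
  have cE : {within `[p, q], continuous E}.
    apply: derivable_within_continuous => c; rewrite in_itv/= => pcq.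
    by case: (dE pcq).
  have [|x] := IVT (v := z) (ltW pq) cE.
    by rewrite Ep Eq min_l ?max_r.
  by rewrite in_itv/= => xpq Ex; exists x.
have [U HU] := choice exU.
have E01 x : p <= x <= q -> 0 <= E x <= 1.
  move=> /andP[px xq]; rewrite -Ep -Eq.
  have h1 := expand (lexx p) px xq; have h2 := expand px xq (lexx q).
  apply/andP; split; rewrite -subr_ge0.
    by apply: le_trans h1; rewrite mulr_ge0 ?(ltW L10)// subr_ge0.
  by apply: le_trans h2; rewrite mulr_ge0 ?(ltW L10)// subr_ge0.
have inj x y : p <= x <= q -> p <= y <= q -> E x = E y -> x = y.
  wlog xy : x y / x <= y.
    by move=> W px py e; have /orP[h|h] := le_total x y; [|apply/esym]; apply: W.
  move=> /andP[px xq] /andP[py yq] e; have := expand px xy yq.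
  rewrite e subrr pmulr_rle0// subr_le0 => yx; by apply/eqP; rewrite eq_le xy yx.
have UE x : p <= x <= q -> U (E x) = x.
  by move=> xpq; have [u1 u2] := HU _ (E01 _ xpq); exact: inj.
have Umono z z' : 0 <= z -> z <= z' -> z' <= 1 -> U z <= U z'.
  move=> z0 zz' z1.
  have zc : 0 <= z <= 1 by rewrite z0 (le_trans zz').
  have zc' : 0 <= z' <= 1 by rewrite z1 (le_trans z0).
  have [/andP[a b] e] := HU z zc; have [/andP[a' b'] e'] := HU z' zc'.
  rewrite leNgt; apply/negP => h.
  have := expand a' (ltW h) b; rewrite e e' => h1.
  have : 0 < L1 * (U z - U z') by rewrite mulr_gt0// subr_gt0.
  by move=> /lt_le_trans/(_ h1); rewrite subr_gt0 ltNge zz'.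
have Ulip z z' : 0 <= z <= 1 -> 0 <= z' <= 1 -> L1 * `|U z - U z'| <= `|z - z'|.
  wlog zz' : z z' / z <= z'.
    by move=> W pz pz'; have /orP[h|h] := le_total z z'; [|rewrite distrC (distrC z)]; apply: W.
  move=> zc zc'; have [/andP[a b] e] := HU z zc; have [/andP[a' b'] e'] := HU z' zc'.
  have UU : U z <= U z' by apply: Umono => //; [case/andP: zc|case/andP: zc'].
  have := expand a UU b'; rewrite e e' distrC ger0_norm ?subr_ge0// => h.
  by rewrite distrC ger0_norm ?subr_ge0.
exists U, (fun z => (E' (U z))^-1); split.
- exact: HU.
- by move=> x xpq; split; [exact: E01|exact: UE].
- move=> z zc; have [u _] := HU z zc; have /andP[l1 l2] := EL u.
  have e0 : 0 < E' (U z) by exact: lt_le_trans l1.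
  by rewrite !lef_pV2 ?posrE ?l1 ?l2//; exact: lt_le_trans l2.
- move=> z z' z0 zz' z1.
  have zc : 0 <= z <= 1 by rewrite z0 (le_trans zz').
  have zc' : 0 <= z' <= 1 by rewrite z1 (le_trans z0).
  have [/andP[a b] e] := HU z zc; have [/andP[a' b'] e'] := HU z' zc'.
  have UU : U z <= U z' by exact: Umono.
  have [c /andP[c1 c2] Ec] := mvtE a UU b'.
  have cpq : p <= c <= q by rewrite (le_trans a c1) (le_trans c2 b').
  exists (E c).
    have g1 := expand a c1 (le_trans c2 b'); have g2 := expand (le_trans a c1) c2 b'.
    rewrite e in g1; rewrite e' in g2.
    rewrite -(subr_ge0 z) -(subr_ge0 (E c)); apply/andP; split.
      by apply: le_trans g1; rewrite mulr_ge0 ?(ltW L10)// subr_ge0.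
    by apply: le_trans g2; rewrite mulr_ge0 ?(ltW L10)// subr_ge0.
  rewrite e e' in Ec; rewrite UE// Ec mulKf// gt_eqF//.
  by have /andP[l1 _] := EL cpq; exact: lt_le_trans l1.
- move=> z z' zc zc'; have [u _] := HU z zc; have [u' _] := HU z' zc'.
  have /andP[l1 _] := EL u; have /andP[l1' _] := EL u'.
  set a := E' (U z) in l1 *; set b := E' (U z') in l1' *.
  have a0 : 0 < a by exact: lt_le_trans l1.
  have b0 : 0 < b by exact: lt_le_trans l1'.
  have ab : `|b - a| <= M / L1 * `|z - z'|.
    rewrite distrC; apply: le_trans (EM u u') _.
    rewrite -mulrA; apply: ler_wpM2l => //.
    by rewrite ler_pdivlMl//; exact: Ulip.
  have d0 : 0 <= M / L1 * `|z - z'| by exact: le_trans ab.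
  split.
    have h : a^-1 <= (1 + M / L1 ^+ 2 * `|z - z'|) * b^-1.
      rewrite ler_pdivlMr// ler_pdivrMl//.
      have h1 : b <= a + M / L1 * `|z - z'| by rewrite -lerBlDl; apply: le_trans ab; exact: ler_norm.
      apply: le_trans h1 _; rewrite mulrDr mulr1 lerD2l.
      have -> : M / L1 ^+ 2 * `|z - z'| = L1^-1 * (M / L1 * `|z - z'|) by field; rewrite gt_eqF.
      by rewrite mulrA ler_peMl// ler_pdivlMr// mul1r.
    apply: le_trans h _; apply: ler_wpM2r; first by rewrite invr_ge0 ltW.
    exact: expR_ge1Dx.
  have -> : a^-1 - b^-1 = (b - a) * (a^-1 * b^-1) by field; rewrite !gt_eqF.
  rewrite normrM.
  have -> : M / L1 ^+ 3 * `|z - z'| = (M / L1 * `|z - z'|) * (L1^-1 * L1^-1) by field; rewrite gt_eqF.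
  apply: ler_pM => //.
  rewrite ger0_norm; last by rewrite mulr_ge0// invr_ge0 ltW.
  by apply: ler_pM; rewrite ?invr_ge0 ?(ltW a0) ?(ltW b0)// lef_pV2 ?posrE.
Qed.

(** A decreasing branch is [1 - E] with [E] increasing, so only the argument of the inverse has to
    be reflected. *)
Lemma expanding_inverse_branch (s : R) (F : R -> R) : s = 1 \/ s = -1 ->
  (forall x, p < x < q -> F x = if s == 1 then E x else 1 - E x) ->
  exists S w : R -> R, inverse_branch F p q s S w (L2^-1) (L1^-1) (M / L1 ^+ 2).
Proof.
move=> s1 HF; have [U [v [HU HE Hv Hmvt Hlip]]] := expanding_inverse.
(* Clamping and reflection in one map: it preserves [cdist] and makes the inverse branch and its
   weight constant outside the unit interval. *)
pose rho (z : R) : R := if s == 1 then clamp z else 1 - clamp z.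
have rho01 z : 0 <= rho z <= 1.
  by rewrite /rho; have := clamp_itv z; case: ifP => // _ /andP[? ?]; apply/andP; split; lra.
have rhod z z' : `|rho z - rho z'| = cdist z z'.
  rewrite /rho /cdist; case: ifP => // _.
  by rewrite (_ : _ - _ = clamp z' - clamp z) 1?distrC//; ring.
have rhol z z' : `|rho z - rho z'| <= `|z - z'| by rewrite rhod; exact: clamp_lip.
have lipc (f : R -> R) (c : R) : 0 <= c -> (forall z z', `|f z - f z'| <= c * `|z - z'|) -> continuous f.
  move=> c0 H x; apply/cvgrPdist_le => e e0.
  have c1 : 0 < c + 1 by rewrite ltr_wpDl.
  have d0 : 0 < e / (c + 1) by rewrite divr_gt0.
  apply/nbhs_ballP; exists (e / (c + 1)) => //= y; rewrite /ball/= => h.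
  apply: le_trans (H _ _) _; apply: (@le_trans _ _ ((c + 1) * `|x - y|)).
    by apply: ler_wpM2r => //; rewrite lerDl.
  by rewrite mulrC -ler_pdivlMr// ltW.
have Ul z z' : 0 <= z <= 1 -> 0 <= z' <= 1 -> `|U z - U z'| <= L1^-1 * `|z - z'|.
  wlog zz' : z z' / z <= z'.
    by move=> W pz pz'; have /orP[h|h] := le_total z z'; [|rewrite distrC (distrC z)]; apply: W.
  move=> /andP[z0 _] /andP[_ z1]; have [y /andP[y1 y2] e] := Hmvt z z' z0 zz' z1.
  rewrite distrC e normrM distrC; apply: ler_wpM2r => //.
  have /andP[v1 v2] := Hv y ltac:(by rewrite (le_trans z0 y1) (le_trans y2 z1)).
  rewrite ger0_norm//; apply: le_trans v1; rewrite invr_ge0.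
  have /andP[l1 l2] := EL (x := p) ltac:(by rewrite lexx ltW).
  by apply: le_trans (le_trans l1 l2); exact: ltW.
have L0 : 0 <= M / L1 ^+ 3 by rewrite divr_ge0// exprn_ge0// ltW.
exists (U \o rho), (v \o rho); split => //.
- apply: (lipc _ (L1^-1)); first by rewrite invr_ge0 ltW.
  move=> z z'; apply: le_trans (Ul _ _ (rho01 _) (rho01 _)) _.
  by apply: ler_wpM2l => //; rewrite invr_ge0 ltW.
- apply: (lipc _ (M / L1 ^+ 3)) => // z z'.
  have [_ h] := Hlip _ _ (rho01 z) (rho01 z'); apply: le_trans h _.
  exact: ler_wpM2l.
- by move=> z; have [] := HU _ (rho01 z).
- by move=> z; exact: Hv.
- by move=> z z'; rewrite -rhod; have [] := Hlip _ _ (rho01 z) (rho01 z').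
- move=> z z' z0 zz' z1; rewrite /= /rho.
  have zc : 0 <= z <= 1 by rewrite z0 (le_trans zz').
  have zc' : 0 <= z' <= 1 by rewrite z1 (le_trans z0).
  rewrite !clamp_id//; case: s1 => ->.
    rewrite eqxx mul1r; have [y yz e] := Hmvt z z' z0 zz' z1; exists y => //.
    have /andP[y1 y2] := yz.
    by rewrite clamp_id// (le_trans z0 y1) (le_trans y2 z1).
  have -> : (-1 == 1 :> R) = false by apply/negbTE; rewrite lt_eqF//; lra.
  rewrite mulN1r opprB.
  have [||| y /andP[y1 y2] e] := Hmvt (1 - z') (1 - z); try lra.
  exists (1 - y); first by apply/andP; split; lra.
  rewrite clamp_id; last by apply/andP; split; lra.
  by rewrite e; congr (v _ * _); lra.
- by move=> z; rewrite /= /rho (clamp_id (clamp_itv z)).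
- move=> z zoo.
  have zc : 0 <= z <= 1 by case/andP: zoo => /ltW-> /ltW->.
  have [u e] := HU _ (rho01 z).
  have rz : 0 < rho z < 1.
    by rewrite /rho clamp_id//; case: ifP => // _; case/andP: zoo => ? ?; apply/andP; split; lra.
  have upq : p < U (rho z) < q.
    case/andP: u => u1 u2; rewrite !lt_neqAle u1 u2 !andbT; apply/andP; split; apply/eqP => h.
      by move: rz; rewrite -e -h Ep ltxx.
    by move: rz; rewrite -e h Eq ltxx andbF.
  split => //; rewrite /= HF// e /rho clamp_id//.
  by case: (s == 1); rewrite ?subKr.
- move=> x xpq; rewrite HF//.
  have xc : p <= x <= q by case/andP: xpq => /ltW-> /ltW->.
  have [Ec UEx] := HE x xc.
  have Eoo : 0 < E x < 1.
    case/andP: Ec => e1 e2; rewrite !lt_neqAle e1 e2 !andbT; apply/andP; split; apply/eqP => h.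
      have xp : x = p by rewrite -UEx -h -Ep; apply: (HE p _).2; rewrite lexx ltW.
      by move: xpq; rewrite xp ltxx.
    have xq : x = q by rewrite -UEx h -Eq; apply: (HE q _).2; rewrite lexx andbT ltW.
    by move: xpq; rewrite xq ltxx andbF.
  split; first by case: ifP => // _; case/andP: Eoo => ? ?; apply/andP; split; lra.
  rewrite /= /rho; case: (s == 1); first by rewrite clamp_id.
  by rewrite clamp_id ?subKr//; case/andP: Ec => ? ?; apply/andP; split; lra.
Qed.

End expanding.

(** * Branches of the perturbed map *)


Lemma is_derive_within {R : realType} (D : set R) (f : R -> R) (x : R) :
  nbhs x D -> derivable_within D f x -> is_derive x (1 : R) f (derive_within D f x).
Proof.
move=> /nbhs_ballP[r /= r0 xD] cf.
set l := derive_within D f x.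
have cl : diff_quotient_within D f x --> l by exact: cf.
have lim : (fun h => h^-1 *: (f (h *: (1 : R) + x) - f x)) @ (0 : R)^' --> l.
  apply/cvgrPdist_le => e e0.
  have /cvgrPdist_le/(_ e e0) := cl.
  move=> /nbhs_ballP[d /= d0 H].
  have dr0 : 0 < Num.min d r by rewrite lt_min d0.
  apply/nbhs_ballP; exists (Num.min d r) => //= h.
  rewrite /ball/= sub0r normrN lt_min => /andP[hd hr] h0.
  have := H (h + x); rewrite /ball/= opprD addrCA subrr addr0 normrN => /(_ hd).
  have hx : h + x != x by rewrite -subr_eq0 addrK.
  move=> /(_ hx); rewrite addrK.
  have -> : h^-1 *: (f (h *: (1 : R) + x) - f x) = (f (h + x) - f x) / h.
    by rewrite [h *: _](mulr1 h) [RHS]mulrC.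
  apply; apply: xD; rewrite /ball/= opprD addrCA subrr addr0 normrN//.
by apply: DeriveDef; [exact: cvgP lim|exact: (cvg_lim _ lim)].
Qed.

(** This is where twice continuous differentiability is used: the second derivative is bounded on
    the compact interval, so the first is Lipschitz. As the branch with its endpoints is interior to
    that interval, one-sided derivatives are ordinary ones on it. *)
Lemma C2_regular {R : realType} (c d p q : R) (h : R -> R) : p < q ->
  `[p, q]%classic `<=` (`[c, d]%classic : set R)° -> C2_on `[c, d]%classic h ->
  (forall x, `[c, d]%classic x -> `|derive_within `[c, d]%classic h x| <= 1) ->
  exists h' : R -> R, exists2 M, 0 <= M &
    [/\ forall x, p <= x <= q -> is_derive x (1 : R) h (h' x),
        forall x, p <= x <= q -> `|h' x| <= 1 &
        forall x y, p <= x <= q -> p <= y <= q -> `|h' x - h' y| <= M * `|x - y|].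
Proof.
move=> pq sub [d1 d2 d3] le1.
set I' := `[c, d]%classic in sub d1 d2 d3 le1 *.
have nb x : p <= x <= q -> nbhs x I' by move=> xpq; apply: (sub x); rewrite /= in_itv.
have I'x x : p <= x <= q -> I' x by move=> /nb/nbhs_singleton.
have cd : c <= d.
  have : I' p by apply: I'x; rewrite lexx ltW.
  by rewrite /I'/= in_itv/= => /andP[]; exact: le_trans.
pose h' := derive_within I' h; pose h2 := derive_within I' h'.
have [x1 _ H1] := EVT_max cd d3; have [x2 _ H2] := EVT_min cd d3.
pose M := Num.max `|h2 x1| `|h2 x2|.
have hM x : p <= x <= q -> `|h2 x| <= M.
  move=> /I'x; rewrite /I'/= => xI; have a := H1 x xI; have b := H2 x xI.
  rewrite -/h' -/h2 in a b; rewrite /M le_max.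
  have := ler_norm (h2 x1); have := ler_norm (- h2 x2); rewrite normrN.
  have [x0|x0] := leP 0 (h2 x) => u v.
    apply/orP; left; rewrite (ger0_norm x0); exact: le_trans v.
  apply/orP; right; rewrite (ltr0_norm x0); apply: le_trans u; by rewrite lerN2.
exists h', M; first by rewrite /M le_max normr_ge0.
have dh' x : p <= x <= q -> is_derive x (1 : R) h' (h2 x).
  by move=> xpq; apply: is_derive_within; [exact: nb|apply: d2; exact: I'x].
split.
- by move=> x xpq; apply: is_derive_within; [exact: nb|apply: d1; exact: I'x].
- by move=> x xpq; apply: le1; exact: I'x.
move=> x y; wlog xy : x y / x <= y.
  by move=> W px py; have /orP[h0|h0] := le_total x y; [|rewrite distrC (distrC x)]; apply: W.
move=> /andP[px _] /andP[_ yq].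
have in_pq z : x <= z <= y -> p <= z <= q.
  by move=> /andP[xz zy]; rewrite (le_trans px xz) (le_trans zy yq).
have [||z] := @MVT_segment R h' h2 x y xy.
- by move=> z; rewrite in_itv/= => /andP[xz zy]; apply: dh'; apply: in_pq; rewrite !ltW.
- apply: derivable_within_continuous => z; rewrite in_itv/= => /in_pq/dh' dz.
  by case: dz.
rewrite in_itv/= => /in_pq zpq E.
by rewrite distrC E normrM (distrC y); apply: ler_wpM2r => //; exact: hM.
Qed.

Lemma closure_itvoo {R : realType} (p q x : R) : p < q -> p <= x <= q -> closure `]p, q[%classic x.
Proof.
move=> pq /andP[px xq] B /nbhs_ballP[e /= e0 eB].
(* The point [x] is moved by the fraction [t] towards the midpoint: this enters the open interval
   and moves [x] by less than [e]. *)
pose t := Num.min (1 / 2) (e / (2 * (q - p))).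
have qp0 : 0 < q - p by rewrite subr_gt0.
have t0 : 0 < t by rewrite lt_min !divr_gt0 ?mulr_gt0.
have t1 : t <= 1 / 2 by rewrite ge_min lexx.
have te : t * (q - p) < e.
  apply: (@le_lt_trans _ _ (e / (2 * (q - p)) * (q - p))).
    by apply: ler_wpM2r; [exact: ltW|rewrite ge_min lexx orbT].
  rewrite (_ : _ * _ = e / 2); first lra.
  by field; rewrite gt_eqF.
pose y := x + t * ((p + q) / 2 - x).
have g1 : 0 <= (1 - t) * (x - p) by apply: mulr_ge0; lra.
have g2 : 0 <= (1 - t) * (q - x) by apply: mulr_ge0; lra.
have g3 : 0 < t * (q - p) by exact: mulr_gt0.
exists y; split.
  by rewrite /= in_itv/= /y; apply/andP; split; lra.
apply: eB; rewrite /ball/= /y opprD addrA subrr sub0r normrN normrM gtr0_norm//.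
apply: le_lt_trans te; apply: ler_wpM2l; first exact: ltW.
by rewrite ler_norml; apply/andP; split; lra.
Qed.

Lemma branch_perturbation_regular {R : realType} (a : int) (k : nat) (h : R -> R) : 0 < `|a| ->
  let p : R := k%:R / `|a|%:~R in let q : R := k.+1%:R / `|a|%:~R in
  branch_perturbation a k h ->
  exists h' : R -> R, exists2 M, 0 <= M &
    [/\ h p = 0 /\ h q = 0, forall x, p <= x <= q -> is_derive x (1 : R) h (h' x),
        forall x, p <= x <= q -> `|h' x| <= 1 &
        forall x y, p <= x <= q -> p <= y <= q -> `|h' x - h' y| <= M * `|x - y|].
Proof.
move=> a0 p q [c [d [sub C2 _ h0 le1]]].
have A0 : 0 < `|a|%:~R :> R by rewrite ltr0z.
have pq : p < q by rewrite /p /q ltr_pM2r ?invr_gt0// ltr_nat.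
have subpq : `[p, q]%classic `<=` (`[c, d]%classic : set R)°.
  move=> x; rewrite /= in_itv/= => xpq; apply: sub; exact: closure_itvoo.
have [h' [M M0 [H1 H2 H3]]] := C2_regular pq subpq C2 le1.
exists h', M => //; split=> //; split; apply: h0; split.
- by apply: closure_itvoo => //; rewrite lexx ltW.
- by rewrite /branch_interval interior_itv_bnd /= in_itv/= ltxx.
- by apply: closure_itvoo => //; rewrite lexx andbT ltW.
- by rewrite /branch_interval interior_itv_bnd /= in_itv/= ltxx andbF.
Qed.

Section map_branches.
Context {R : realType} (a : int) (delta : R).
Hypothesis ha : 1 < `|a|.
Local Notation A := (`|a|%:~R : R).

Let A0 : 0 < A. Proof. by rewrite ltr0z; apply: lt_trans ha. Qed.

Let sgn : R := if 0 < a then 1 else -1.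

Let aA : a%:~R = sgn * A.
Proof.
rewrite /sgn; case: ifP => [a0|a0]; first by rewrite gtr0_norm// mul1r.
by rewrite ler0_norm ?mulN1r ?mulrNz ?opprK// leNgt a0.
Qed.

(** For negative [a] the floor of [a * x] is [- (k + 1)], so the branch is the reflection [1 - _] of
    an increasing one; the factor [sgn] compensates the reflection of the perturbation. *)
Lemma branch_value (h : R -> R) (k : nat) (x : R) : branch_interval a k x ->
  mod1 (a%:~R * x) + delta * h x =
  if sgn == 1 then A * x - k%:R + sgn * delta * h x else 1 - (A * x - k%:R + sgn * delta * h x).
Proof.
rewrite /branch_interval/= in_itv/= ltr_pdivrMr// ltr_pdivlMr// mulrC => /andP[x1 x2].
rewrite /mod1 aA /sgn; case: ifP => a0.
  rewrite eqxx !mul1r; congr (_ - _ + _).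
  have -> : Num.floor (A * x) = k%:Z; last by rewrite -pmulrn.
  by apply/eqP; rewrite floor_eq intrD -!pmulrn natr1 x2 ltW.
have -> : (-1 == 1 :> R) = false by apply/negbTE; rewrite lt_eqF//; lra.
have -> : Num.floor (-1 * A * x) = - k.+1%:Z.
  apply/eqP; rewrite floor_eq mulN1r mulNr intrD !mulrNz -!pmulrn -natr1.
  move: x1 x2; move: (A * x) => y; rewrite -natr1 => x1 x2; apply/andP; split; lra.
rewrite mulrNz -pmulrn -natr1; ring.
Qed.

End map_branches.


Lemma is_derive_affine {R : realType} (A k c : R) (h : R -> R) (x hx : R) :
  is_derive x (1 : R) h hx -> is_derive x (1 : R) (fun y => A * y - k + c * h y) (A + c * hx).
Proof.
move=> dh.
have dA : is_derive x (1 : R) (A *: id : R -> R) (A *: 1) by exact: is_deriveZ.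
have dk : is_derive x (1 : R) (cst k : R -> R) 0 by exact: is_derive_cst.
have dc : is_derive x (1 : R) (c *: h : R -> R) (c *: hx) by exact: is_deriveZ.
have /is_derive_eq := is_deriveD (is_deriveB dA dk) dc.
by apply; rewrite subr0 [A *: _](mulr1 A).
Qed.

Section perturbed_branches.
Context {R : realType} (a : int) (delta : R) (F : R -> R) (f : nat -> R -> R).
Hypotheses (ha : 1 < `|a|) (d0 : 0 <= delta) (da : delta < `|a|%:~R).
Hypothesis hf : forall k, (k < `|a|)%N -> branch_perturbation a k (f k).
Hypothesis Fout : forall x : R, ~ 0 <= x <= 1 -> F x = 0.
Hypothesis HF : forall k x, (k < `|a|)%N -> branch_interval a k x ->
  F x = mod1 (a%:~R * x) + delta * f k x.
Local Notation A := (`|a|%:~R : R).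
Local Notation n := `|a|%N.
Local Notation mR := (measurableTypeR R).

Let An : A = n%:R. Proof. by rewrite -abszE pmulrn. Qed.

Let A0 : 0 < A. Proof. by rewrite ltr0z; apply: lt_trans ha. Qed.

Let p (k : nat) : R := k%:R / A.

(** The perturbation changes the slope [A] by at most [delta] and vanishes at both endpoints, so [E]
    still runs from 0 to 1. Its derivative has Lipschitz constant [delta * M]. *)
Lemma perturbed_inverse_branch (k : nat) : (k < n)%N -> exists S w : R -> R, exists2 D, 0 <= D &
  inverse_branch F (p k) (p k.+1) (if 0 < a then 1 else -1) S w (A + delta)^-1 (A - delta)^-1 D /\
  forall x, p k < x < p k.+1 -> {for x, continuous F}.
Proof.
move=> kn.
have [h' [M M0 [[hp hq] H1 H2 H3]]] := branch_perturbation_regular (lt_trans ltr01 ha) (hf kn).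
rewrite -/(p k) -/(p k.+1) in hp hq H1 H2 H3.
set s : R := if 0 < a then 1 else -1.
have s1 : s = 1 \/ s = -1 by rewrite /s; case: ifP; [left|right].
have sn : `|s| = 1 by case: s1 => ->; rewrite ?normrN normr1.
pose E x : R := A * x - k%:R + s * delta * f k x.
pose E' x : R := A + s * delta * h' x.
have pq : p k < p k.+1 by rewrite /p ltr_pM2r ?invr_gt0// ltr_nat.
have dd x : p k <= x <= p k.+1 -> `|s * delta * h' x| <= delta.
  by move=> /H2 h; rewrite !normrM sn mul1r (ger0_norm d0) ler_piMr.
have dE x : p k <= x <= p k.+1 -> is_derive x (1 : R) E (E' x).
  move=> xpq; have dh := H1 x xpq.
  exact: is_derive_affine.
have EL x : p k <= x <= p k.+1 -> A - delta <= E' x <= A + delta.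
  by move=> /dd; rewrite ler_norml /E' => /andP[u v]; rewrite !lerD2l u v.
have EM x y : p k <= x <= p k.+1 -> p k <= y <= p k.+1 -> `|E' x - E' y| <= delta * M * `|x - y|.
  move=> xpq ypq; rewrite /E' opprD addrACA subrr add0r -mulrBr !normrM sn mul1r (ger0_norm d0) -mulrA.
  by apply: ler_wpM2l => //; exact: H3.
have Ep : E (p k) = 0 by rewrite /E hp mulr0 addr0 /p mulrC divfK ?subrr// gt_eqF.
have Eq : E (p k.+1) = 1.
  by rewrite /E hq mulr0 addr0 /p mulrC divfK ?gt_eqF// -natr1 addrAC subrr add0r.
have Ad : 0 < A - delta by rewrite subr_gt0.
have dM : 0 <= delta * M by exact: mulr_ge0.
have FE x : p k < x < p k.+1 -> F x = if s == 1 then E x else 1 - E x.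
  move=> xpq; have bi : branch_interval a k x by rewrite /branch_interval/= in_itv.
  by rewrite (HF kn bi) (branch_value delta ha (f k) bi).
have [S [w H]] := expanding_inverse_branch pq Ad dM dE EL EM Ep Eq s1 FE.
exists S, w, (delta * M / (A - delta) ^+ 2); first by rewrite divr_ge0// exprn_ge0// ltW.
split=> // x xpq.
have cE : {for x, continuous E}.
  have [] := dE x ltac:(by case/andP: xpq => /ltW-> /ltW->).
  by move=> /derivable1_diffP/differentiable_continuous.
(* [F] is given by the formula on the open branch only, which is a neighbourhood of each of its
   points. *)
have nF : \near x, (if s == 1 then E x else 1 - E x) = F x.
  have : nbhs x `]p k, p k.+1[%classic.
    by apply: open_nbhs_nbhs; split; [exact: itv_open|rewrite /= in_itv].
  by apply: filterS => y; rewrite /= in_itv/= => /FE ->.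
rewrite /prop_for /continuous_at (FE x xpq).
apply: cvg_trans (near_eq_cvg nF) _.
case: (s == 1); first exact: cE.
by apply: cvgB; [exact: cvg_cst|exact: cE].
Qed.

Lemma p_cover x : 0 <= x <= 1 -> x \in [seq p i | i <- iota 0 n.+1] \/
  exists2 k : 'I_n, true & p k < x < p k.+1.
Proof.
move=> /andP[x0 x1].
have Ax0 : 0 <= A * x by rewrite mulr_ge0// ltW.
have := floor_itv (A * x).
have f0 : 0 <= Num.floor (A * x) by rewrite floor_ge0.
case: (Num.floor (A * x)) f0 => // k _; rewrite intrD -!pmulrn => /andP[k1 k2].
have kA : k%:R <= A by apply: le_trans k1 _; rewrite ler_piMr// ltW.
have kn : (k <= n)%N by move: kA; rewrite An ler_nat.
have [e|ne] := eqVneq (k%:R : R) (A * x).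
  left; apply/mapP; exists k; first by rewrite mem_iota/= add0n ltnS.
  by rewrite /p e mulrAC mulfV ?mul1r// gt_eqF.
have k1' : k%:R < A * x by rewrite lt_neqAle ne k1.
have kn' : (k < n)%N.
  by rewrite -(ltr_nat R) -An; apply: lt_le_trans k1' _; rewrite ler_piMr// ltW.
right; exists (Ordinal kn') => //=.
by apply/andP; split; [rewrite ltr_pdivrMr// mulrC|rewrite ltr_pdivlMr// mulrC -natr1].
Qed.

Lemma p_disj (i j : nat) x y : p i < x < p i.+1 -> p j < y < p j.+1 -> x = y -> i = j.
Proof.
rewrite /p !ltr_pdivrMr// !ltr_pdivlMr// => /andP[a1 a2] /andP[b1 b2] e; rewrite e in a1 a2.
have ij : (i < j.+1)%N by rewrite -(ltr_nat R); exact: lt_trans a1 b2.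
have ji : (j < i.+1)%N by rewrite -(ltr_nat R); exact: lt_trans b1 a2.
by apply/eqP; rewrite eqn_leq -ltnS ij -ltnS ji.
Qed.

Lemma p_itv (k : 'I_n) x : p k <= x <= p k.+1 -> 0 <= x <= 1.
Proof.
move=> /andP[x1 x2]; rewrite (le_trans _ x1)/=; last by rewrite divr_ge0// ltW.
by apply: le_trans x2 _; rewrite /p ler_pdivrMr// mul1r An ler_nat.
Qed.

Let I (k : 'I_n) : set mR := `]p k, p k.+1[%classic.

Let mI k : measurable (I k). Proof. exact: measurable_itv. Qed.

Let tI : trivIset setT I.
Proof.
by move=> i j _ _ [x []]; rewrite /I/= !in_itv/= => xi xj; apply: val_inj; exact: (p_disj xi xj).
Qed.

(** On the unit interval this consists of branch endpoints only, where [F] is arbitrary. *)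
Let rest : set mR := ~` \big[setU/set0]_k I k.

Let mbig : measurable (\big[setU/set0]_k I k).
Proof. exact: bigsetU_measurable. Qed.

Let rest_sub : rest `&` `[0, 1]%classic `<=` [set` [seq p i | i <- iota 0 n.+1]].
Proof.
move=> x [xr]; rewrite /= in_itv/= => /p_cover[//|[k _ xk]]; exfalso; apply: xr.
by rewrite (bigD1 k)//=; left; rewrite /I/= in_itv.
Qed.

(** Any larger distortion constant is allowed, so that the two factors of the map can share one. *)
Lemma perturbed_full_branch : exists S w : 'I_n -> R -> R, exists2 D, 0 <= D &
  forall D', D <= D' -> full_branch F S w (A + delta)^-1 (A - delta)^-1 D'.
Proof.
have /choice[S /choice[w /choice[D H]]] : forall k : 'I_n, exists S w : R -> R, exists D, [/\ 0 <= D,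
    forall x, p k < x < p k.+1 -> {for x, continuous F} &
    inverse_branch F (p k) (p k.+1) (if 0 < a then 1 else -1) S w (A + delta)^-1 (A - delta)^-1 D].
  move=> k; have [S [w [D D0 [h cF]]]] := perturbed_inverse_branch (ltn_ord k).
  by exists S, w, D.
have D0 k : 0 <= D k by case: (H k).
have cF (k : 'I_n) x : p k < x < p k.+1 -> {for x, continuous F} by move: x; case: (H k).
have {}H (k : 'I_n) : inverse_branch F (p k) (p k.+1) (if 0 < a then 1 else -1) (S k) (w k) (A + delta)^-1 (A - delta)^-1 (D k).
  by case: (H k).
have lo0 : 0 < (A + delta)^-1 by rewrite invr_gt0 ltr_wpDr.
have frest : finite_set (rest `&` `[0, 1]%classic).
  by apply: sub_finite_set rest_sub _; exact: finite_seq.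
have mrest : measurable rest by exact: measurableC.
have mF : measurable_fun [set: mR] (F : mR -> mR).
  have mFI k : measurable_fun (I k) (F : mR -> mR).
    apply: open_continuous_measurable_fun; first exact: itv_open.
    by move=> x; rewrite inE /I/= in_itv/= => /cF.
  (* Measurability by pieces: [F] is continuous on the branches, arbitrary on a finite set, and 0
     outside the unit interval. *)
  have -> : [set: mR] = \big[setU/set0]_k I k `|` (rest `&` `[0, 1]%classic `|` ~` `[0, 1]%classic).
    rewrite setUIl setUv setIT setUA [_ `|` rest]setUC /rest.
    by rewrite setvU setTU.
  have mfin : measurable (rest `&` `[0, 1]%classic) by apply: measurableI.
  have mout : measurable (~` (`[0, 1]%classic : set mR)) by exact: measurableC.
  apply/measurable_funU => //; first exact: measurableU.
  split.
    suff [] : measurable (\big[setU/set0]_k I k) /\ measurable_fun (\big[setU/set0]_k I k) (F : mR -> mR) by [].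
    elim/big_ind : _ => [|B C [mB fB] [mC fC]|k _].
    - by split => //; exact: measurable_fun_set0.
    - by split; [exact: measurableU|apply/measurable_funU].
    - by split.
  apply/measurable_funU => //; split.
    move=> _ B mB.
    have cB : countable ((rest `&` `[0, 1]%classic) `&` (F : mR -> mR) @^-1` B).
      by apply: finite_set_countable; apply: sub_finite_set frest => x [].
    exact: countable_measurable.
  apply: (eq_measurable_fun (cst (0 : mR) : mR -> mR)); last exact: measurable_cst.
  by move=> x; rewrite inE/= in_itv/= => nx; rewrite Fout.
exists S, w, (\sum_k D k); first by apply: sumr_ge0.
move=> D' DD'.
have DkD' k : D k <= D'.
  by apply: le_trans DD'; rewrite (bigD1 k)//= lerDl sumr_ge0.
split => //.
- by move=> i; apply: continuous_measurable_fun; exact: ib_cS (H i).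
- by move=> i; apply: continuous_measurable_fun; exact: ib_cw (H i).
- by move=> i z; apply: p_itv; exact: ib_S (H i) z.
- by move=> i z; rewrite lo0; exact: ib_w (H i) z.
- move=> i z z'; apply: le_trans (ib_wD (H i) z z') _; apply: ler_wpM2r.
    by case/andP: (ib_w (H i) z') => l _; apply: le_trans l; exact: ltW.
  by rewrite ler_expR; apply: ler_wpM2r => //; exact: normr_ge0.
- by move=> i; exists (if 0 < a then 1 else -1); [exact: ib_s (H i)|exact: ib_mvt (H i)].
- by move=> i; exact: ib_clamp (H i).
- move=> i z /(ib_Soo (H i))[/andP[u1 u2] _].
  have p0 : 0 <= p i by rewrite divr_ge0// ltW.
  have p1 : p i.+1 <= 1 by rewrite /p ler_pdivrMr// mul1r An ler_nat.
  by rewrite (le_lt_trans p0 u1) (lt_le_trans u2 p1).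
- by move=> i z /(ib_Soo (H i))[].
- move=> i j z z' /(ib_Soo (H i))[u _] /(ib_Soo (H j))[v _] e.
  by apply: val_inj; exact: (p_disj u v e).
- exists [seq p i | i <- iota 0 n.+1] => x /p_cover[|[k _ xk]]; first by left.
  have [Fx SFx] := ib_Fpq (H k) xk.
  by right; exists k, (F x).
move=> Phi mPhi Phi0.
have mPF : measurable_fun [set: mR] (fun x : mR => Phi (F x, x)).
  by apply: (measurableT_comp mPhi); apply: measurable_fun_pair => //; exact: measurable_id.
have rest0 : (@lam R) rest = 0%E.
  by rewrite lamE//; apply: countable_lebesgue_measure0; exact: finite_set_countable.
have -> : (\int[lam]_x Phi (F x, x) = \int[lam]_(x in \big[setU/set0]_k I k) Phi (F x, x))%E.
  rewrite -[in LHS](setvU (\big[setU/set0]_k I k)) ge0_integral_setU//.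
  - rewrite [X in (X + _)%E]null_set_integral ?add0e//; exact: measurable_funTS.
  - exact: measurable_funTS.
  - by apply/disj_setPS; rewrite setICl.
rewrite ge0_integral_bigsetU//; last 3 first.
- exact: index_enum_uniq.
- by apply: sub_trivIset tI.
- exact: measurable_funTS.
apply: eq_bigr => k _.
have p0 : 0 <= p k by rewrite divr_ge0// ltW.
have p1 : p k.+1 <= 1 by rewrite /p ler_pdivrMr// mul1r An ler_nat.
have pq : p k < p k.+1 by rewrite /p ltr_pM2r ?invr_gt0// ltr_nat.
have B := H k.
apply: (@branch_dual R (p k) (p k.+1) (if 0 < a then 1 else -1) F (S k) (w k) (A - delta)^-1) => //.
- exact: ib_cS B.
- exact: ib_cw B.
- by move=> z; case/andP: (ib_w B z) => l ->; rewrite andbT; apply: le_trans l; exact: ltW.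
- exact: ib_s B.
- exact: ib_mvt B.
- by move=> z; case/andP: (ib_w B z) => l _; apply: lt_le_trans l.
- exact: ib_S B.
- exact: ib_Soo B.
- exact: ib_Fpq B.
Qed.

End perturbed_branches.

(** * The Poisson law *)



Lemma natr_ge_real {R : realType} (x : R) : exists N : nat, forall n, (N <= n)%N -> x <= n%:R.
Proof.
exists (Num.truncn `|x|).+1 => n Nn; apply: le_trans (ler_norm x) _; apply: ltW.
by apply: lt_le_trans (truncnS_gt _) _; rewrite ler_nat.
Qed.

(** From [x^4 / 4! <= expR x] at [x = - t * ln r]. Three of the four powers of [t] absorb the
    polynomial loss in [n], and the last one gives decay like [1 / t]. *)
Lemma cube_geometric {R : realType} (r : R) : 0 < r < 1 ->
  exists2 c, 0 < c & forall t : nat, t%:R ^+ 3 * r ^+ t * t%:R <= c.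
Proof.
move=> /andP[r0 r1].
have c0 : 0 < - ln r by rewrite oppr_gt0 ln_lt0// r0.
exists (24 / (- ln r) ^+ 4); first by rewrite divr_gt0// exprn_gt0.
move=> t; rewrite mulrAC -exprSr.
have -> : r ^+ t = (expR (- ln r *+ t))^-1.
  by rewrite -mulr_natl expRM_natl expRN lnK ?posrE// exprVn invrK.
rewrite ler_pdivrMr ?expR_gt0// mulrAC ler_pdivlMr ?exprn_gt0// -exprMn.
rewrite mulr_natl.
have := @expR_ge1Dxn R (- ln r *+ t) 3 (mulrn_wge0 _ (ltW c0)).
have -> : 4 `! = 24%N by [].
by move: (expR _) (_ ^+ 4) => a b; lra.
Qed.

(** The choice of scales is [t = n / k], with [k] large but fixed, and [eta = 1 / n^2]. The three
    resulting terms come from the visits within the gap, the cutoff and the mixing rate; each is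
    made at most [e / 3]. *)
Lemma mixing_error_small {R : realType} (C C' K r s e : R) : 0 <= C -> 0 <= C' -> 0 < K ->
  0 < r < 1 -> 0 < s -> 0 < e ->
  exists N, forall n, (N <= n)%N -> exists t eta, [/\ (0 < t)%N, 0 < eta &
   n%:R * (t%:R * (C * (s / n%:R) * (s / n%:R)) + (C' * eta + (1 + eta^-1 / K) * r ^+ t)
     + t%:R * (s / n%:R) * (s / n%:R)) <= e].
Proof.
move=> C0 C'0 K0 r01 s0 e0.
have [c c0 hc] := cube_geometric r01.
(* In [C + 1], the [C] stands for short returns and the 1 for the term [t * (mu A)^2] of the renewal
   estimate. *)
have [k0 /(_ k0.+1 (leqnSn _)) hk] := natr_ge_real (3 * ((C + 1) * s ^+ 2) / e).
set k := k0.+1 in hk; have kR0 : 0 < k%:R :> R by rewrite ltr0n.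
have [N1 hN1] := natr_ge_real (3 * C' / e).
(* The bound obtained for [n^3 * (1 + 1 / K) * r^t * t] from [n <= 2 * k * t]. *)
pose B := 8 * k%:R ^+ 3 * (1 + K^-1) * c.
have [t1 ht1] := natr_ge_real (3 * B / e).
exists (maxn 1 (maxn N1 (k * t1.+1)))%N => n; rewrite !geq_max => /and3P[n0 nN1 nt].
have nR0 : 0 < n%:R :> R by rewrite ltr0n.
have nR1 : 1 <= n%:R :> R by rewrite ler1n.
pose t := (n %/ k)%N.
have tt1 : (t1 < t)%N by rewrite leq_divRL// mulnC.
have tR0 : 0 < t%:R :> R by rewrite ltr0n; apply: leq_ltn_trans tt1.
exists t, (n%:R ^+ 2)^-1; split; [exact: leq_ltn_trans tt1|by rewrite invr_gt0 exprn_gt0|].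
have tk : t%:R * k%:R <= n%:R :> R by rewrite -natrM ler_nat leq_trunc_div.
have nk : n%:R <= 2 * k%:R * t%:R :> R.
  rewrite -!natrM ler_nat; have := ltn_ceil n (ltn0Sn k0 : (0 < k)%N); rewrite -/t => h.
  apply: (leq_trans (ltnW h)); rewrite mulSn -mulnA mul2n -addnn [(k * t)%N]mulnC leq_add2r.
  by rewrite leq_pmull//; apply: leq_ltn_trans tt1.
have e1 : t%:R * ((C + 1) * s ^+ 2) / n%:R <= e / 3.
  rewrite ler_pdivrMr//; move: hk; rewrite ler_pdivrMr// => hk.
  have a0 : 0 <= (C + 1) * s ^+ 2 by rewrite mulr_ge0 ?sqr_ge0// addr_ge0.
  have : t%:R * (3 * ((C + 1) * s ^+ 2)) <= t%:R * (k%:R * e) by apply: ler_wpM2l => //; exact: ltW.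
  have : t%:R * k%:R * e <= n%:R * e by apply: ler_wpM2r => //; exact: ltW.
  have aux (x y z u v : R) : x * y * z <= u -> x * (3 * v) <= x * (z * y) -> x * v <= u / 3 by nra.
  rewrite mulrAC => h1 h2; apply: le_trans (aux _ _ _ _ _ h1 h2) _.
  by rewrite -mulrA mulrC.
have e2 : C' / n%:R <= e / 3.
  rewrite ler_pdivrMr//; move: (hN1 _ nN1); rewrite ler_pdivrMr// [e / 3 * _]mulrC mulrA; clear.
  by move: (n%:R * e) => *; lra.
have e3 : n%:R * (1 + n%:R ^+ 2 / K) * r ^+ t <= e / 3.
  have rt0 : 0 <= r ^+ t by case/andP: r01 => r0 _; rewrite exprn_ge0// ltW.
  apply: (@le_trans _ _ (B / t%:R)); last first.
    rewrite ler_pdivrMr//; move: (ht1 _ (ltnW tt1)); rewrite ler_pdivrMr// [e / 3 * _]mulrC [_ * (e / 3)]mulrA; clear.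
    by move: (t%:R * e) => *; lra.
  apply: (@le_trans _ _ (n%:R ^+ 3 * (1 + K^-1) * r ^+ t)).
    apply: ler_wpM2r => //; rewrite [n%:R ^+ 3]exprS -mulrA; apply: ler_wpM2l; first exact: ltW.
    by rewrite mulrDr mulr1 lerD2r exprn_ege1.
  rewrite ler_pdivlMr//.
  apply: (@le_trans _ _ ((2 * k%:R * t%:R) ^+ 3 * (1 + K^-1) * r ^+ t * t%:R)).
    apply: ler_wpM2r; first exact: ltW.
    apply: ler_wpM2r => //; apply: ler_wpM2r; first by rewrite addr_ge0// invr_ge0 ltW.
    by apply: lerXn2r; rewrite ?nnegrE// ltW// !mulr_gt0.
  have -> : (2 * k%:R * t%:R) ^+ 3 * (1 + K^-1) * r ^+ t * t%:R =
    8 * k%:R ^+ 3 * (1 + K^-1) * (t%:R ^+ 3 * r ^+ t * t%:R) by ring.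
  apply: ler_wpM2l => //; rewrite !mulr_ge0 ?exprn_ge0// ?ltW// addr_gt0// invr_gt0//.
have -> : n%:R * (t%:R * (C * (s / n%:R) * (s / n%:R)) + (C' * (n%:R ^+ 2)^-1 + (1 + ((n%:R ^+ 2)^-1)^-1 / K) * r ^+ t)
     + t%:R * (s / n%:R) * (s / n%:R)) =
   t%:R * ((C + 1) * s ^+ 2) / n%:R + C' / n%:R + n%:R * (1 + n%:R ^+ 2 / K) * r ^+ t.
  rewrite invrK; move: (r ^+ t) (n%:R) nR0 => u x x0; field; rewrite !gt_eqF//.
lra.
Qed.

Lemma exp_limit {R : realType} (s e : R) : 0 < s -> 0 < e ->
  exists N, forall n, (N <= n)%N -> `|(1 - s / n%:R) ^+ n - expR (- s)| <= e.
Proof.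
move=> s0 e0.
have [N1 hN1] := natr_ge_real (2 * s); have [N2 hN2] := natr_ge_real (2 * s ^+ 2 / e).
exists (maxn 1 (maxn N1 N2)) => n; rewrite !geq_max => /and3P[n0 /hN1 nN1 /hN2].
have nR0 : 0 < n%:R :> R by rewrite ltr0n.
rewrite ler_pdivrMr// => nN2.
have [x xE] : exists x, x = s / n%:R by eexists.
rewrite -xE.
have x0 : 0 < x by rewrite xE divr_gt0.
have x12 : x <= 1 / 2 by rewrite xE ler_pdivrMr//; lra.
have nx : n%:R * x = s by rewrite xE mulrC divfK// gt_eqF.
have up : (1 - x) ^+ n <= expR (- s).
  rewrite -nx -mulrN expRM_natl.
  by apply: lerXn2r; rewrite ?nnegrE ?expR_ge0//; [lra|exact: expR_ge1Dx].
(* Indeed [1 / (1 - x) = 1 + x / (1 - x)] is at most [expR (x / (1 - x))]. *)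
have lowx : expR (- (x / (1 - x))) <= 1 - x.
  have y0 : 0 < 1 - x by lra.
  rewrite expRN -[leRHS]invrK lef_pV2 ?posrE ?invr_gt0 ?expR_gt0//.
  apply: le_trans (expR_ge1Dx _); rewrite le_eqVlt; apply/orP; left; apply/eqP.
  by field; rewrite gt_eqF.
have low : expR (- s) * (1 - 2 * s * x) <= (1 - x) ^+ n.
  apply: (@le_trans _ _ (expR (- (x / (1 - x))) ^+ n)); last first.
    by apply: lerXn2r => //; rewrite nnegrE ?expR_ge0//; lra.
  rewrite -expRM_natl.
  apply: (@le_trans _ _ (expR (- s) * expR (- (2 * s * x)))).
    by apply: ler_wpM2l; [exact: expR_ge0|exact: expR_ge1Dx].
  rewrite -expRD ler_expR -mulr_natl mulrN -opprD lerN2.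
  have -> : n%:R * (x / (1 - x)) = s / (1 - x) by rewrite mulrA nx.
  rewrite ler_pdivrMr; last lra.
  have : 0 <= s * x * (1 - 2 * x) by rewrite !mulr_ge0//; lra.
  lra.
have es1 : expR (- s) <= 1 by rewrite -[leRHS]expR0 ler_expR; lra.
have es0 := expR_ge0 (- s).
have sx : 2 * s * x <= e.
  by rewrite xE mulrA ler_pdivrMr//; lra.
have sx0 : 0 <= 2 * s * x by rewrite !mulr_ge0// ltW.
have h : expR (- s) * (2 * s * x) <= e.
  by apply: le_trans sx; rewrite ler_piMl.
rewrite ler_norml; move: low; rewrite mulrBr mulr1.
by move: (expR _ * _) h => u h low; apply/andP; split; lra.
Qed.



(** * Lebesgue measure of the tube and of its boundary layers *)

Section tube_measure.
Context {R : realType}.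
Local Notation leb := (@lebesgue_measure R).
Local Notation mR := (measurableTypeR R).
Local Notation mRR := (measurableTypeR R * measurableTypeR R)%type.
Implicit Types (r : R) (A : set mRR).

Lemma measurable_cdist : measurable_fun [set: mRR] (fun p : mRR => cdist p.1 p.2 : mR).
Proof.
apply: measurableT_comp; first exact: normr_measurable.
apply: measurable_funB; apply: (measurableT_comp measurable_clamp).
  exact: measurable_fst.
exact: measurable_snd.
Qed.

(** It agrees with the tube on the square, and its cutoffs are Lipschitz for [pdist] on the whole
    plane. *)
Definition clamped_tube r : set mRR := [set p | cdist p.1 p.2 < r].

Lemma measurable_clamped_tube r : measurable (clamped_tube r).
Proof.
rewrite -[X in measurable X]setTI (_ : clamped_tube r = (fun p : mRR => cdist p.1 p.2 : mR) @^-1` `]-oo, r[).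
  exact: (measurable_cdist measurableT (measurable_itv _)).
by apply/seteqP; split => p; rewrite /clamped_tube/= in_itv.
Qed.

Lemma clamped_tube_square r : clamped_tube r `&` unit_square = tube r `&` unit_square.
Proof.
apply/seteqP; split => p [+ ps]; case: (ps); rewrite /= !in_itv/= => p1 p2;
  by rewrite /clamped_tube /tube /cdist/= !clamp_id.
Qed.

Lemma lam2_clamped_tube r : lam2 (clamped_tube r) = lam2 (tube r).
Proof.
rewrite !lam2E ?clamped_tube_square//; [exact: measurable_tube|exact: measurable_clamped_tube].
Qed.

Lemma lam2_tube_ge r : 0 <= r <= 1 / 2 -> (r%:E <= lam2 (tube r))%E.
Proof.
move=> /andP[r0 r2]; rewrite -lam2_clamped_tube.
have mc := measurable_clamped_tube r.
have -> : r%:E = (\int[@lam R]_x (cst r%:E : mR -> \bar R) x)%E by rewrite integral_cst//= lamT mule1.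
apply: ge0_le_integral => //.
  exact: measurable_fun_xsection.
move=> x _; rewrite /= lamE.
have /andP[x0 x1] := clamp_itv x.
(* Every section contains an interval of length [r] with one end at [x], taken to the right in the
   left half of the square and to the left in the right half. *)
have [c c0 [cr cx]] : exists2 c, 0 <= c & c + r <= 1 /\ c <= clamp x <= c + r.
  by have [h|h] := leP (clamp x) (1 / 2); [exists (clamp x)|exists (clamp x - r)]; lra.
apply: (@le_trans _ _ (leb `]c, (c + r)[%classic)).
  rewrite lebesgue_measure_itv/= lte_fin; case: ltP => [_|h].
    by rewrite -EFinB lee_fin addrAC subrr add0r.
  by rewrite lee_fin; lra.
apply: le_measure; rewrite ?inE//=.
  by apply: measurableI => //; exact: measurable_xsection.
move=> y; rewrite /= in_itv/= => /andP[cy yc].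
have y01 : 0 <= y <= 1 by apply/andP; split; lra.
split; last by rewrite in_itv.
by rewrite /xsection/= inE /clamped_tube/= /cdist (clamp_id y01) ltr_norml; apply/andP; split; lra.
Qed.

Lemma lam2_annulus r r' : 0 <= r <= r' -> (lam2 (tube r' `\` tube r) <= (2 * (r' - r))%:E)%E.
Proof.
move=> /andP[r0 rr].
have mA : measurable (tube r' `\` tube r : set mRR) by apply: measurableD; exact: measurable_tube.
have -> : (2 * (r' - r))%:E = (\int[@lam R]_x (cst (2 * (r' - r))%:E : mR -> \bar R) x)%E.
  by rewrite integral_cst//= lamT mule1.
apply: ge0_le_integral => //.
  exact: measurable_fun_xsection.
move=> x _; rewrite /= lamE.
apply: (@le_trans _ _ (leb (`[(x - r')%R, (x - r)%R]%classic `|` `[(x + r)%R, (x + r')%R]%classic))).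
  apply: le_measure; rewrite ?inE//=.
  - by apply: measurableI => //; exact: measurable_xsection.
  - by apply: measurableU; exact: measurable_itv.
  move=> y [+ _]; rewrite /xsection/= inE /tube/= => -[h /negP]; rewrite -leNgt !in_itv/= => h'.
  move: h h'; rewrite ltr_norml lter_normr => /andP[h1 h2] /orP[h3|h3]; [left|right]; apply/andP; split; lra.
have h : (leb `[(x - r')%R, (x - r)%R]%classic + leb `[(x + r)%R, (x + r')%R]%classic <= (2 * (r' - r))%:E)%E.
  rewrite !lebesgue_measure_itv/= !lte_fin.
  rewrite (_ : (2 * (r' - r))%:E = ((r' - r)%:E + (r' - r)%:E)%E); last by rewrite -EFinD; congr (_%:E); ring.
  by apply: leeD; case: ifP => _; rewrite -?EFinB lee_fin; lra.
exact: le_trans (measureU2 leb (measurable_itv _) (measurable_itv _)) h.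
Qed.

End tube_measure.



Section poisson_law.
Context {R : realType}.
Local Notation mR := (measurableTypeR R).
Local Notation mRR := (measurableTypeR R * measurableTypeR R)%type.
Context {n m : nat} {F G : R -> R} {S w : 'I_n -> R -> R} {U v : 'I_m -> R -> R}.
Context {lo hi lo' hi' D K0 : R}.
Hypothesis fF : full_branch F S w lo hi D.
Hypothesis fG : full_branch G U v lo' hi' D.
Hypotheses (n0 : (0 < n)%N) (m0 : (0 < m)%N) (hi23 : hi <= 2 / 3) (hi23' : hi' <= 2 / 3).
Hypotheses (K0gt0 : 0 < K0) (DK0 : 9 * D <= K0).
Hypotheses (lo0 : 0 < lo) (hi0 : 0 < hi) (lo0' : 0 < lo') (hi0' : 0 < hi') (D0 : 0 <= D).
Hypothesis fast : hi < lo' \/ hi' < lo.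

Local Notation T := (prodmap F G : mRR -> mRR).
Local Notation C2 := (expR (K0 * 2)).

Variable mu : probability mRR R.
Hypothesis mu_inv : forall A, measurable A -> mu (T @^-1` A) = mu A.
Hypothesis mu_ac : mu `<< (lam \x lam)%E.
Local Notation mass A := (fine (mu A)).
Implicit Types (A B : set mRR) (r eta : R).

Let mass_le A : measurable A -> mass A <= C2 * fine (lam2 A).
Proof.
by move=> mA; case/andP: (mu_bounds fF fG n0 m0 hi23 hi23' K0gt0 DK0 mu_inv mu_ac mA).
Qed.

Lemma mass_square A : measurable A -> mass A = mass (A `&` unit_square).
Proof.
move=> mA; rewrite (fine_muD mu mA measurable_unit_square).
have mD : measurable (A `\` unit_square) by apply: measurableD => //; exact: measurable_unit_square.
suff -> : mass (A `\` unit_square) = 0 by rewrite addr0.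
apply/eqP; rewrite eq_le fine_ge0// andbT; apply: le_trans (mass_le mD) _.
rewrite lam2E// (_ : _ `&` _ = set0) ?measure0 ?mulr0//.
by rewrite -subset0 => p [[]].
Qed.

Lemma eq_mass A B : measurable A -> measurable B -> A `&` unit_square = B `&` unit_square ->
  mass A = mass B.
Proof. by move=> mA mB AB; rewrite mass_square// [RHS]mass_square// AB. Qed.

Lemma mass_annulus r r' : 0 <= r <= r' -> mass (tube r' `\` tube r) <= C2 * (2 * (r' - r)).
Proof.
move=> rr; have mA : measurable (tube r' `\` tube r : set mRR).
  by apply: measurableD; exact: measurable_tube.
apply: le_trans (mass_le mA) _; apply: ler_wpM2l; first exact: expR_ge0.
by rewrite -lee_fin -(lam2_fin mA); exact: lam2_annulus.
Qed.

Lemma tube_le r r' : r <= r' -> tube r `<=` (tube r' : set mRR).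
Proof. by move=> rr p /= h; exact: lt_le_trans h rr. Qed.

(** Radii up to 2 are allowed because [tube_level] searches up to there; the Lebesgue bound holds up
    to 1/2 and is applied at radius [r / 4]. *)
Lemma mass_tube_ge r : 0 <= r <= 2 -> r <= 4 * C2 * mass (tube r).
Proof.
move=> /andP[r0 r2].
have mt := measurable_tube r.
have /andP[h _] := mu_bounds fF fG n0 m0 hi23 hi23' K0gt0 DK0 mu_inv mu_ac mt.
have h4 : r / 4 <= fine (lam2 (tube r : set mRR)).
  rewrite -lee_fin -lam2_fin//; apply: le_trans (lam2_tube_ge _) _; first by apply/andP; split; lra.
  apply: le_measure; rewrite ?inE//; first exact: measurable_tube.
  by apply: tube_le; lra.
have E0 := expR_gt0 (K0 * 2).
move: h; rewrite expRN mulrC ler_pdivrMr// mulrC => h.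
lra.
Qed.

Lemma mass_tube_lip r r' : 0 <= r -> 0 <= r' ->
  `|mass (tube r) - mass (tube r')| <= C2 * 2 * `|r - r'|.
Proof.
wlog rr : r r' / r <= r'.
  by move=> W a b; have /orP[h|h] := le_total r r'; [|rewrite distrC (distrC r)]; apply: W.
move=> r0 _; have mt := measurable_tube r; have mt' := measurable_tube r'.
rewrite distrC (distrC r) (fine_muD mu mt' mt) (setIidr (tube_le rr)) addrAC subrr add0r.
rewrite ger0_norm ?fine_ge0// ger0_norm ?subr_ge0// -mulrA.
by apply: mass_annulus; rewrite r0.
Qed.

(** The mass of the tube is Lipschitz in the radius, 0 at radius 0 and 1 at radius 2, so every level
    is attained exactly. The bound on [r] turns later errors of order [r ^+ 2] into order
    [a ^+ 2]. *)
Lemma tube_level a : 0 < a < 1 -> exists2 r, 0 < r & mass (tube r) = a /\ r <= 4 * C2 * a.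
Proof.
move=> /andP[a0 a1].
pose f r := mass (tube `|r|).
have lipf x y : `|f x - f y| <= C2 * 2 * `|x - y|.
  apply: le_trans (mass_tube_lip _ _) _ => //.
  by apply: ler_wpM2l; [rewrite mulr_ge0// expR_ge0|exact: ler_dist_dist].
have cf : continuous f.
  move=> x; apply/cvgrPdist_le => e e0.
  have C0 : 0 < C2 * 2 by rewrite mulr_gt0// expR_gt0.
  near=> y; apply: le_trans (lipf x y) _; rewrite mulrC -ler_pdivlMr//.
  near: y; apply/nbhs_ballP; exists (e / (C2 * 2)) => /=; first exact: divr_gt0.
  by move=> y /ltW.
have f0 : f 0 = 0.
  rewrite /f normr0 (_ : tube 0 = set0) ?measure0//.
  by rewrite -subset0 => p; rewrite /tube/= ltNge normr_ge0.
have f2 : f 2 = 1.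
  rewrite /f ger0_norm//; have mt := measurable_tube (2 : R).
  have -> : mass (tube 2) = mass [set: mRR] by rewrite (eq_mass mt measurableT)//;
    rewrite setTI; apply: setIidr => p [/=]; rewrite !in_itv/= => p1 p2;
    rewrite /tube/= ltr_norml; apply/andP; split; lra.
  by rewrite probability_setT.
have [r] : exists2 r, r \in `[0, 2] & f r = a.
  apply: IVT; [by []|exact: continuous_subspaceT|].
  by rewrite f0 f2 min_l// max_r// !ltW.
rewrite in_itv/= => /andP[r0 r2]; rewrite /f ger0_norm// => fr.
have rC : r <= 4 * C2 * a by rewrite -fr mass_tube_ge// r0.
exists r => //; rewrite lt_neqAle r0 andbT; apply/negP => /eqP rE.
by move: a0; rewrite -fr -rE -{1}f0 /f normr0 ltxx.
Unshelve. all: by end_near. Qed.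

(** The cutoff falls from 1 to 0 across a layer of width at most [eta] inside the tube: Lipschitz
    constant [1 / eta], mass of the layer of order [eta]. *)
Lemma tube_decay (t : nat) r eta B : 0 < r -> 0 < eta -> measurable B ->
  `|mass (tube r `&` iter t T @^-1` B) - mass (tube r) * mass B| <=
    C2 * 2 * eta + (1 + eta^-1 / K0) * mixrate (K0 + K0) ^+ t.
Proof.
move=> r0 eta0 mB.
have mTB := measurable_preimage_iter fF fG t mB.
have mt := measurable_tube r.
have mct r1 := measurable_clamped_tube r1.
have e1 : mass (tube r `&` iter t T @^-1` B) = mass (clamped_tube r `&` iter t T @^-1` B).
  by apply: eq_mass; rewrite 1?setIAC -?clamped_tube_square 1?setIAC//; apply: measurableI.
have e2 : mass (tube r) = mass (clamped_tube r) by apply: eq_mass; rewrite ?clamped_tube_square.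
rewrite e1 e2.
(* If [eta] exceeds [r], the inner tube is empty and the layer is the whole tube. *)
pose r1 := Num.max (r - eta) 0.
have r1r : 0 <= r1 <= r by rewrite /r1 le_max lexx orbT/= ge_max (ltW r0) gerBl ltW.
have ri : r - r1 <= eta by have : r - eta <= r1; [rewrite /r1 le_max lexx|lra].
pose psi (p : mRR) : R := clamp (eta^-1 * (r - cdist p.1 p.2)).
have i0 : 0 < eta^-1 by rewrite invr_gt0.
apply: le_trans (mu_decay fF fG n0 m0 hi23 hi23' K0gt0 DK0 mu_inv mu_ac t (psi := psi)
  (A' := clamped_tube r1) i0 (mct r) (mct r1) mB _ _ _ _ _) _.
- apply: (measurableT_comp measurable_clamp); apply: measurable_funM; first exact: measurable_cst.
  by apply: measurable_funB; [exact: measurable_cst|exact: measurable_cdist].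
- by move=> p; exact: clamp_itv.
- move=> p q; apply: le_trans (clamp_lip _ _) _; rewrite -mulrBr normrM (ger0_norm (ltW i0)).
  apply: ler_wpM2l; first exact: ltW.
  have -> : r - cdist p.1 p.2 - (r - cdist q.1 q.2) = cdist q.1 q.2 - cdist p.1 p.2 by ring.
  rewrite /pdist /cdist; apply: le_trans (ler_dist_dist _ _) _.
  move: (clamp p.1) (clamp p.2) (clamp q.1) (clamp q.2) => a b c d.
  have -> : c - d - (a - b) = (b - d) - (a - c) by ring.
  by rewrite [leRHS]addrC; exact: ler_normB.
- move=> p; rewrite /clamped_tube/= => h.
  have h1 : 1 <= eta^-1 * (r - cdist p.1 p.2).
    rewrite mulrC ler_pdivlMr// mul1r; move: h; rewrite /r1 lt_max => /orP[h|h]; first lra.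
    by have := cdist_ge0 p.1 p.2; lra.
  by rewrite /psi /clamp min_r// max_r.
- move=> p; rewrite /clamped_tube/= => /negP; rewrite -leNgt => h.
  have h' : eta^-1 * (r - cdist p.1 p.2) <= 0 by rewrite pmulr_rle0// subr_le0.
  by rewrite /psi /clamp min_l ?max_l//; exact: le_trans h' _.
rewrite lerD2r.
rewrite (@eq_mass _ (tube r `\` tube r1)).
- apply: le_trans (mass_annulus r1r) _; rewrite -mulrA.
  by apply: ler_wpM2l; [exact: expR_ge0|apply: ler_wpM2l].
- by apply: measurableD; exact: mct.
- by apply: measurableD; exact: measurable_tube.
- have cE (p : mRR) : unit_square p -> cdist p.1 p.2 = `|p.1 - p.2|.
    by case; rewrite /= !in_itv/= => p1 p2; rewrite /cdist !clamp_id.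
  by apply/seteqP; split => p [+ ps]; rewrite /clamped_tube /tube/= cE.
Qed.

Let iterT_measurable := measurable_prodmap (fb_mF fF) (fb_mF fG).

Lemma short_return : exists2 C, 0 <= C & forall j r, (0 < j)%N -> 0 < r ->
  mass (tube r `&` iter j T @^-1` tube r) <= C * r ^+ 2.
Proof.
pose q := if hi < lo' then hi / lo' else hi' / lo.
have q1 : q < 1.
  rewrite /q; case: ifP => h; first by rewrite ltr_pdivrMr// mul1r.
  by case: fast => [|h']; [rewrite h|rewrite ltr_pdivrMr// mul1r].
pose C := C2 * (16 * expR (3 * D) / (1 - q)).
exists C; first by rewrite !mulr_ge0// ?expR_ge0// invr_ge0 subr_ge0 ltW.
move=> j r j0 r0; have mt := measurable_tube r.
have mA : measurable (tube r `&` iter j T @^-1` tube r).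
  by apply: measurableI => //; exact: (measurable_preimage_iter fF fG).
apply: le_trans (mass_le mA) _; rewrite /C -[leRHS]mulrA; apply: ler_wpM2l; first exact: expR_ge0.
have [q' -> h] := tube_return fF fG lo0 hi0 lo0' hi0' D0 hi23 hi23' j0 r0 fast.
rewrite -lee_fin -(lam2_fin mA); apply: le_trans h _; rewrite lee_fin -/q le_eqVlt.
by apply/orP; left; apply/eqP; ring.
Qed.

Theorem poisson_law (s : R) : 0 < s -> exists r : nat -> R,
  (exists N, forall k, (N <= k)%N -> [/\ (0 < k)%N, 0 < r k & mass (tube (r k)) = s / k%:R]) /\
  (forall e, 0 < e -> exists N, forall k, (N <= k)%N ->
    `|mass (no_visit T (tube (r k)) k) - expR (- s)| <= e).
Proof.
move=> s0; have [N0 hN0] := natr_ge_real (2 * s).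
(* For small [k] the level [s / k] need not be below 1; the radius is then 0, which does not affect
   limits. *)
have H k : exists r, (N0 < k)%N -> [/\ (0 < k)%N, 0 < r & mass (tube r) = s / k%:R /\ r <= 4 * C2 * (s / k%:R)].
  have [kN|kN] := ltnP N0 k; last by exists 0.
  have k0 : (0 < k)%N by apply: leq_ltn_trans kN.
  have kR0 : 0 < k%:R :> R by rewrite ltr0n.
  have [|r r0 rE] := @tube_level (s / k%:R); last by exists r.
  by rewrite divr_gt0//= ltr_pdivrMr// mul1r; have := hN0 _ (ltnW kN); lra.
have /choice[r hr] := H; exists r; split.
  by exists N0.+1 => k /hr[? ? []].
move=> e e0.
have [C C0 hC] := short_return.
have KK0 : 0 <= K0 + K0 by rewrite addr_ge0// ltW.
have e20 : 0 < e / 2 by rewrite divr_gt0.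
have C20 : 0 <= C2 * 2 by rewrite mulr_ge0// expR_ge0.
have C10 : 0 <= C * (4 * C2) ^+ 2 by rewrite mulr_ge0// sqr_ge0.
have [N1 hN1] := mixing_error_small C10 C20 K0gt0 (mixrate_itv KK0) s0 e20.
have [N2 hN2] := exp_limit s0 e20.
exists (maxn N0.+1 (maxn N1 N2)) => k; rewrite !geq_max => /and3P[kN0 /hN1 kN1 /hN2 kN2].
have [k0 rk0 [rE rC]] := hr k kN0; have [t [eta [t0 eta0 he]]] := kN1.
have a0 : 0 <= s / k%:R by rewrite divr_ge0// ltW.
have short j : (0 < j)%N -> mass (tube (r k) `&` iter j T @^-1` tube (r k)) <= C * (4 * C2) ^+ 2 * (s / k%:R) * (s / k%:R).
  move=> j0; apply: le_trans (hC j _ j0 rk0) _.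
  have -> : C * (4 * C2) ^+ 2 * (s / k%:R) * (s / k%:R) = C * (4 * C2 * (s / k%:R)) ^+ 2 by ring.
  apply: ler_wpM2l => //; apply: lerXn2r => //; rewrite nnegrE; first exact: ltW.
  by apply: le_trans rC; exact: ltW.
have mix B (mB : measurable B) := tube_decay t rk0 eta0 mB.
have L := no_visit_law iterT_measurable mu_inv (measurable_tube (r k)) t0 short mix k.
rewrite rE in L.
rewrite (splitr e); apply: le_trans (ler_distD ((1 - s / k%:R) ^+ k) _ _) _.
apply: lerD kN2; apply: le_trans L (le_trans _ he).
by rewrite !addrA.
Qed.

End poisson_law.



(** * From tubes to the observable and from the product map to the given one *)

Lemma mass_setI_full {d} {X : measurableType d} {R : realType} (mu : probability X R) (Q A : set X) :
  measurable Q -> mu Q = 1%E -> measurable A -> mu (Q `&` A) = mu A.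
Proof.
move=> mQ Q1 mA; rewrite setIC [RHS](measureDI mu mA mQ) [X in (_ = X + _)%E](_ : _ = 0%E) ?add0e//.
apply/eqP; rewrite eq_le measure_ge0 andbT.
have <- : mu (~` Q) = 0%E by rewrite probability_setC// Q1 subee.
by apply: le_measure => [| |p []//]; rewrite inE; [exact: measurableD|exact: measurableC].
Qed.

Section observable_tube.
Context {R : realType}.
Implicit Types (r : R) (p : R * R).

Lemma observable_gt r p : 0 < r -> ((- ln r)%:E < observable p)%E = (`|p.1 - p.2| < r).
Proof.
move=> r0; rewrite /observable; have [->|ne] := eqVneq p.1 p.2.
  by rewrite subrr normr0 r0 ltry.
by rewrite lte_fin ltrN2 ltr_ln// posrE// normr_gt0 subr_eq0.
Qed.

Lemma max_process_le (T : R * R -> R * R) n r p : 0 < r ->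
  (max_process T n p <= (- ln r)%:E)%E <-> forall i, (i < n)%N -> ~ (`|(iter i T p).1 - (iter i T p).2| < r).
Proof.
move=> r0; split=> [/bigmax_leP[_ H] i il|H].
  by move: (H (Ordinal il) isT) => /=; rewrite leNgt observable_gt// => /negP.
apply/bigmax_leP; split=> [|i _]; first exact: leNye.
by rewrite leNgt observable_gt//; apply/negP/H.
Qed.

End observable_tube.

Section clipping.
Context {R : realType}.

(** The coordinate maps are only constrained on the unit interval; a fixed value elsewhere makes
    them measurable on the line. *)
Definition zero_outside (F : R -> R) (x : R) : R := if 0 <= x <= 1 then F x else 0.

Lemma branch_interval01 (a : int) k (x : R) : (k < `|a|)%N -> branch_interval a k x -> 0 <= x <= 1.
Proof.
move=> ka; have a0 : 0 < `|a|%:~R :> R by rewrite -abszE -pmulrn ltr0n (leq_ltn_trans _ ka).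
rewrite /branch_interval/= in_itv/= => /andP[x0 x1].
apply/andP; split; first by apply: le_trans (ltW x0); rewrite divr_ge0// ltW.
by apply: le_trans (ltW x1) _; rewrite ler_pdivrMr// mul1r -abszE -pmulrn ler_nat.
Qed.

Lemma branch_intervalP (a : int) k : (k < `|a|)%N -> exists x : R, branch_interval a k x.
Proof.
move=> ka; have a0 : 0 < `|a|%:~R :> R by rewrite -abszE -pmulrn ltr0n (leq_ltn_trans _ ka).
exists ((k%:R + 1 / 2) / `|a|%:~R); rewrite /branch_interval/= in_itv/= !ltr_pM2r ?invr_gt0//.
by rewrite -(natr1 k); apply/andP; split; lra.
Qed.

(** The smallest slope satisfies [|a| - delta > (|a| + 1) / 2 >= 3/2]. *)
Lemma contraction_bounds (a : int) (delta : R) : 1 < `|a| -> 0 <= delta -> delta < (`|a|%:~R - 1) / 2 ->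
  [/\ delta < `|a|%:~R, 0 < (`|a|%:~R + delta)^-1, 0 < (`|a|%:~R - delta)^-1 &
      (`|a|%:~R - delta)^-1 <= 2 / 3].
Proof.
move=> ha d0 da; have A2 : (2 : R) <= `|a|%:~R by rewrite (ler_int R 2).
have h : 3 / 2 <= `|a|%:~R - delta by lra.
split; [lra|rewrite invr_gt0; lra|rewrite invr_gt0; lra|].
by rewrite -[leRHS]invrK lef_pV2 ?posrE ?invf_div//; lra.
Qed.

(** The integers differ by at least 1 and [2 * delta < 1], so the slope intervals of the two factors
    are disjoint. *)
Lemma contraction_gap (a b : int) (delta : R) : `|a| < `|b| -> 0 <= delta -> delta < 1 / 2 ->
  delta < `|a|%:~R -> (`|b|%:~R - delta)^-1 < (`|a|%:~R + delta)^-1.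
Proof.
move=> ab d0 d1 da.
have : (`|a| + 1)%:~R <= `|b|%:~R :> R by rewrite ler_int lezD1.
rewrite intrD => h; rewrite ltf_pV2 ?posrE; lra.
Qed.

End clipping.

Unset Implicit Arguments.

Theorem theorem7p1 (R : realType) (a b : int) (delta : R)
    (T : R * R -> R * R)
    (mu : probability (measurableTypeR R * measurableTypeR R)%type R)
    (ha : 1 < `|a|) (hb : 1 < `|b|) (hab : `|a| != `|b|)
    (hdelta0 : 0 <= delta)
    (hdelta : delta < Num.min (1 / 2)
                        ((Num.min (`|a|%:~R) (`|b|%:~R) - 1) / 2))
    (hT : perturbed_linear_map a b delta T)
    (hmu : acip T mu)
    (s : R) (hs : 0 < s) :
  exists u : nat -> R,
    ((fun n => n%:R%:E *
        mu (unit_square `&` [set p | (u n)%:E < observable p]))%E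
       @ \oo --> s%:E) /\
    ((fun n => mu (unit_square `&` [set p | (max_process T n p <= (u n)%:E)%E]))
       @ \oo --> (expR (- s))%:E).
Proof.
have [Tsq [F0 [G0 TFG]] [f [g [hf hg Tfg]]]] := hT.
have [mu1 mac inv] := hmu.
pose F := zero_outside F0; pose G := zero_outside G0.
have sqP (x y : R) : 0 <= x <= 1 -> 0 <= y <= 1 -> unit_square (x, y).
  by move=> x01 y01; split; rewrite /= in_itv.
have sqE (p : R * R) : unit_square p -> (0 <= p.1 <= 1) /\ (0 <= p.2 <= 1).
  by case; rewrite /= !in_itv.
have TE p : unit_square p -> T p = prodmap F G p.
  by move=> ps; rewrite (TFG p ps) /prodmap /F /G /zero_outside; case: (sqE p ps) => -> ->.
have a0 : (0 < `|a|)%N by rewrite absz_gt0 -normr_gt0 (lt_trans ltr01 ha).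
have b0 : (0 < `|b|)%N by rewrite absz_gt0 -normr_gt0 (lt_trans ltr01 hb).
(* The formula is given for pairs, so the second coordinate is taken in an arbitrary branch, here
   the first one. *)
have HF k x : (k < `|a|)%N -> branch_interval a k x -> F x = mod1 (a%:~R * x) + delta * f k x.
  move=> ka xk; have [y y0] := @branch_intervalP R b 0 b0.
  have ps := sqP x y (branch_interval01 ka xk) (branch_interval01 b0 y0).
  by have := Tfg k 0%N (x, y) ka b0 (conj xk y0); rewrite (TE _ ps) => -[].
have HG k x : (k < `|b|)%N -> branch_interval b k x -> G x = mod1 (b%:~R * x) + delta * g k x.
  move=> kb xk; have [y y0] := @branch_intervalP R a 0 a0.
  have ps := sqP y x (branch_interval01 a0 y0) (branch_interval01 kb xk).
  by have := Tfg 0%N k (y, x) a0 kb (conj y0 xk); rewrite (TE _ ps) => -[].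
have Fout (x : R) : ~ 0 <= x <= 1 -> F x = 0 by move=> /negP/negbTE; rewrite /F /zero_outside => ->.
have Gout (x : R) : ~ 0 <= x <= 1 -> G x = 0 by move=> /negP/negbTE; rewrite /G /zero_outside => ->.
have [d12 da db] : [/\ delta < 1 / 2, delta < (`|a|%:~R - 1) / 2 & delta < (`|b|%:~R - 1) / 2].
  move: hdelta; rewrite lt_min => /andP[-> h]; split=> //; apply: lt_le_trans h _;
    by rewrite ler_pM2r// lerD2r ge_min lexx ?orbT.
have [da' lo0 hi0 hi23] := contraction_bounds ha hdelta0 da.
have [db' lo0' hi0' hi23'] := contraction_bounds hb hdelta0 db.
have [S [w [D1 D10 fF]]] := perturbed_full_branch ha hdelta0 da' hf Fout HF.
have [U [v [D2 D20 fG]]] := perturbed_full_branch hb hdelta0 db' hg Gout HG.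
have D120 : 0 <= D1 + D2 by exact: addr_ge0.
have /fF fF' : D1 <= D1 + D2 by rewrite lerDl.
have /fG fG' : D2 <= D1 + D2 by rewrite lerDr.
(* The 1 keeps the cone constant positive even without distortion, as for the linear map. *)
have K0gt0 : 0 < 9 * (D1 + D2) + 1 by rewrite ltr_wpDl// mulr_ge0.
have DK0 : 9 * (D1 + D2) <= 9 * (D1 + D2) + 1 by rewrite lerDl.
have fast : (`|a|%:~R - delta)^-1 < (`|b|%:~R + delta)^-1 \/ (`|b|%:~R - delta)^-1 < (`|a|%:~R + delta)^-1.
  by move: hab; rewrite neq_lt => /orP[h|h]; [right|left]; exact: contraction_gap.
have msq := @measurable_unit_square R.
have mT := measurable_prodmap (fb_mF fF') (fb_mF fG').
have full A (mA : measurable A) := mass_setI_full msq mu1 mA.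
(* The given map and the product map agree on the square only, which carries [mu]. *)
have mu_inv A : measurable A -> mu (prodmap F G @^-1` A) = mu A.
  move=> mA; rewrite -full; last by rewrite -[X in measurable X]setTI; exact: mT.
  rewrite -[RHS]inv//; congr (mu _); apply/seteqP.
  by split => p [ps]; rewrite /= ?TE// -?TE// => h; split => //=; rewrite ?TE// -?TE.
have mu_ac : mu `<< (lam \x lam)%E.
  move/null_content_dominatesP : mac => mac; apply/null_content_dominatesP => A mA A0.
  rewrite -full//; apply: mac; first exact: measurableI.
  by rewrite setIC; exact: etrans (esym (lam2E mA)) A0.
have [r [[N0 hN0] lim]] := poisson_law fF' fG' a0 b0 hi23 hi23' K0gt0 DK0 lo0 hi0 lo0' hi0' D120 fast mu_inv mu_ac hs.
have iterE i p : unit_square p -> iter i T p = iter i (prodmap F G) p /\ unit_square (iter i T p).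
  by move=> ps; elim: i => [|i [IH IH']]//=; rewrite -IH TE// -TE//; split=> //; exact: Tsq.
(* With this threshold an exceedance is a point of the tube of radius [r n], and [n * mu] of it
   equals [s] exactly once [n] is large. *)
exists (fun n => - ln (r n)); split.
  apply: cvg_near_cst; exists N0 => // n /hN0[n0 rn0 rE].
  rewrite (_ : _ `&` _ = unit_square `&` tube (r n)); last first.
    by apply/seteqP; split => p [ps]; rewrite /= observable_gt.
  have mt := measurable_tube (r n).
  rewrite full// -[mu _]fineK ?fin_num_measure// rE -EFinM mulrC divfK// pnatr_eq0.
  by rewrite -lt0n.
have maxE n : (N0 <= n)%N -> mu (unit_square `&` [set p | (max_process T n p <= (- ln (r n))%:E)%E]) =
    mu (no_visit (prodmap F G) (tube (r n)) n).
  move=> /hN0[n0 rn0 rE].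
  rewrite -[RHS]full; last by apply: measurable_no_visit => //; exact: measurable_tube.
  congr (mu _); apply/seteqP; split => p [ps].
    move=> /(max_process_le T n p rn0) H; split=> // i il.
    by case: (iterE i p ps) => <- _; exact: H.
  move=> H; split=> //; apply/(max_process_le T n p rn0) => i il.
  by case: (iterE i p ps) => -> _; exact: H.
apply/fine_cvgP; split.
  exists N0 => // n Nn; rewrite /= maxE// fin_num_measure//.
  by apply: measurable_no_visit => //; exact: measurable_tube.
apply/cvgrPdist_le => e e0; have [N hN] := lim e e0.
exists (maxn N0 N) => // n; rewrite /= geq_max => /andP[n0 /hN h].
by rewrite maxE// distrC.
Qed.
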